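(* Let $I=(-1,1)$ and consider $u_t=(\mathcal L(u_x))_x$ with Dirichlet data $u(-1,t)=u(1,t)=0$ (in the sense of the context) and initial condition $u(\cdot,0)=u_0$. (a) If $u_0(x)=-|x|+d$, where $d>1$, then $$u(x,t)=-|x|+d-2\min\left\{t,\tfrac{d-1}{2}\right\}$$ and $\Omega(x,t)=-2x$. In particular, $T_{ext}=\frac{d-1}{2}$ and $u(x,T_{ext})=1-|x|$. (b) If $u_0(x)=-|x|+e$, where $e<1$, then $$u(x,t)=\max\left\{u_0(x),\ |x|-2+e+2\min\left\{\sqrt{2t},\tfrac{1-e}{2}\right\}\right\}$$ and $T_{ext}=\frac{(1-e)^2}{8}$. In particular, $$u(x,T_{ext})=\begin{cases}-x-1,& x\in[-1,-\frac{1+e}{2}],\\ -|x|+e,& x\in[-\frac{1+e}{2},\frac{1+e}{2}],\\ x-1,& x\in[\frac{1+e}{2},1].\end{cases}$$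
   Context: $\operatorname{sgn}$ is the multivalued sign graph ($1$ for $p>0$, $-1$ for $p<0$, $[-1,1]$ at $p=0$), $\mathcal L(p)=\operatorname{sgn}(p+1)+\operatorname{sgn}(p-1)$, $W(p)=|p+1|+|p-1|$. For $v\in BV(I)$, $\int_I W(Dv):=|D(v+x)|(I)+|D(v-x)|(I)$. $\gamma$ denotes the trace (one-sided limit from inside $I$ at an endpoint). Solution: $u$ is a solution of $u_t=(\mathcal L(u_x))_x$ if for every $T>0$: $u\in L^\infty(0,T;BV(I))$, $u_t\in L^2(0,T;L^2(I))$ and there is $\Omega\in L^2(0,T;W^{1,2}(I))$ such that for a.e. $t$: (i) $\int_I u_t\varphi\,dx=-\int_I\Omega\varphi_x\,dx$ for all $\varphi\in C_0^\infty(I)$; (ii) $\Omega(\cdot,t)$ is a selection of $\mathcal L\circ u_x(\cdot,t)$, understood in the subdifferential sense: $\int_I W(Dv)\ge\int_I W(Du(\cdot,t))+\int_I\Omega(\cdot,t)\,d(Dv-Du(\cdot,t))$ for all $v\in BV(I)$. The initial condition is understood in $C([0,T];L^2(I))$. Dirichlet data $0$ at $x=\pm1$ means that for a.e. $t>0$: at $x=-1$ either $\gamma u(-1)=0$, or $\gamma u(-1)>0$ and $\gamma\Omega(-1)=2$, or $\gamma u(-1)<0$ and $\gamma\Omega(-1)=-2$; at $x=1$ either $\gamma u(1)=0$, or $\gamma u(1)>0$ and $\gamma\Omega(1)=-2$, or $\gamma u(1)<0$ and $\gamma\Omega(1)=2$. For given $u_0\in BV(I)$ the solution exists and is unique; $u$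 and $\Omega$ in the claim refer to it. Extinction time: $T_{ext}>0$ is the extinction time of $u$ iff $u_t\equiv0$ for all $t>T_{ext}$ and for every $\epsilon>0$, $u_t\not\equiv0$ on $(T_{ext}-\epsilon,T_{ext})$.
   Formalization: Part (b) is stated for -1 ≤ e < 1, since for e < -1 the formula for u and the value of T_ext are false; in (a), Ω(x,t) = -2x is stated for a.e. t in (0, T_ext), since after T_ext the solution is stationary and Ω = 0. *)

(* Defs.v *)
From mathcomp Require Import all_boot all_order all_algebra.
From mathcomp Require Import all_classical all_reals all_analysis.

Set Implicit Arguments.
Unset Strict Implicit.
Unset Printing Implicit Defensive.

Import Order.TTheory GRing.Theory Num.Theory.
Import numFieldNormedType.Exports.

Local Open Scope classical_set_scope.
Local Open Scope ring_scope.

Notation leb R := (@lebesgue_measure R).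

(* Functions of x are total functions R -> R, only looked at on I.  Functions
   of (x, t) are curried with time first: u t is the function u(., t). *)
Definition Iint (R : realType) : set R := `]-1, 1[.
Notation I := (@Iint _).

Definition test_function (R : realType) (a b : R) (phi : R -> R) : Prop :=
  (forall (n : nat) (x : R), derivable (derive1n n phi) x 1) /\
  exists c d : R, [/\ a < c, d < b &
    forall x : R, x \notin `[c, d] -> phi x = 0].

Definition hahn_P (R : realType) (nu : {charge set (measurableTypeR R) -> \bar R}) :=
  projT1 (cid (Hahn_decomposition nu)).
Definition hahn_N (R : realType) (nu : {charge set (measurableTypeR R) -> \bar R}) :=
  projT1 (cid (projT2 (cid (Hahn_decomposition nu)))).
Definition hahn_PN (R : realType) (nu : {charge set (measurableTypeR R) -> \bar R}) :
    hahn_decomposition nu (hahn_P nu) (hahn_N nu) :=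
  projT2 (cid (projT2 (cid (Hahn_decomposition nu)))).

(* Total variation |nu|(A); it does not depend on the Hahn decomposition. *)
Definition tvar (R : realType) (nu : {charge set (measurableTypeR R) -> \bar R})
    (A : set (measurableTypeR R)) : \bar R :=
  charge_variation (hahn_PN nu) A.

Definition charge_int (R : realType)
    (nu : {charge set (measurableTypeR R) -> \bar R}) (A : set (measurableTypeR R))
    (f : R -> R) : R :=
  \int[jordan_pos (hahn_PN nu)]_(x in A) f x
  - \int[jordan_neg (hahn_PN nu)]_(x in A) f x.

(* The distributional derivative of v on I is nu; what nu does outside I is
   irrelevant, here and everywhere below. *)
Definition is_Dmeas (R : realType) (v : R -> R)
    (nu : {charge set (measurableTypeR R) -> \bar R}) : Prop :=
  forall phi : R -> R, test_function (-1) 1 phi ->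
    \int[leb R]_(x in I) (v x * derive1 phi x) = - charge_int nu I phi.

Definition BV_I (R : realType) (v : R -> R) : Prop :=
  (leb R).-integrable I (EFin \o v) /\ exists nu, is_Dmeas v nu.

(* Dv, uniquely determined on the Borel subsets of I when v is in BV(I) *)
Definition Dmeas (R : realType) (v : R -> R) :
    {charge set (measurableTypeR R) -> \bar R} :=
  match pselect (exists nu, is_Dmeas v nu) with
  | left h => projT1 (cid h)
  | right _ => czero
  end.

(* The integral of W(Dv) over I, where W(p) = |p + 1| + |p - 1|. *)
Definition intW (R : realType) (v : R -> R) : \bar R :=
  (tvar (Dmeas (fun x => (v x + x)%R)) I + tvar (Dmeas (fun x => (v x - x)%R)) I)%E.

Definition BV_norm (R : realType) (v : R -> R) : \bar R :=
  (\int[leb R]_(x in I) `|(v x)%:E| + tvar (Dmeas v) I)%E.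

(* Essential one-sided limit at the endpoint c from inside I, so that it does
   not depend on the representative of v. *)
Definition has_trace (R : realType) (v : R -> R) (c l : R) : Prop :=
  forall eps : R, 0 < eps -> exists2 del : R, 0 < del &
    \forall x \ae leb R, I x -> `|x - c| < del -> `|v x - l| < eps.

Definition L2_I (R : realType) (v : R -> R) : Prop :=
  measurable_fun I v /\
  (\int[leb R]_(x in I) ((v x) ^+ 2)%:E < +oo)%E.

Definition weak_deriv (R : realType) (v g : R -> R) : Prop :=
  forall phi : R -> R, test_function (-1) 1 phi ->
    \int[leb R]_(x in I) (v x * derive1 phi x) = - \int[leb R]_(x in I) (g x * phi x).

(* v is the continuous representative of an element of W^{1,2}(I), with weak
   derivative g.  Continuity matters for the integral of v against Du. *)
Definition W12_I (R : realType) (v g : R -> R) : Prop :=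
  [/\ {within I, continuous v}, L2_I v, L2_I g & weak_deriv v g].

Definition meas_Q (R : realType) (T : R) (f : R -> R -> R) : Prop :=
  measurable_fun (`]0, T[ `*` I) (fun p : R * R => f p.1 p.2).

(* L^2(0,T; L^2(I)) *)
Definition L2_Q (R : realType) (T : R) (f : R -> R -> R) : Prop :=
  meas_Q T f /\
  (\int[leb R]_(t in `]0%R, T[) \int[leb R]_(x in I) ((f t x) ^+ 2)%:E < +oo)%E.

Definition Linfty_BV (R : realType) (T : R) (u : R -> R -> R) : Prop :=
  meas_Q T u /\
  exists C : R, \forall t \ae leb R, 0 < t < T ->
    BV_I (u t) /\ (BV_norm (u t) <= C%:E)%E.

Definition L2_W12 (R : realType) (T : R) (f : R -> R -> R) : Prop :=
  L2_Q T f /\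
  exists2 g : R -> R -> R, L2_Q T g &
    \forall t \ae leb R, 0 < t < T -> W12_I (f t) (g t).

(* Weak derivative in time of u as an L^2(I)-valued function: the Bochner
   integrals over (0,T) are computed pointwise in x. *)
Definition time_deriv (R : realType) (T : R) (u ut : R -> R -> R) : Prop :=
  forall psi : R -> R, test_function 0 T psi ->
    \forall x \ae leb R, I x ->
      \int[leb R]_(t in `]0, T[) (u t x * derive1 psi t)
      = - \int[leb R]_(t in `]0, T[) (ut t x * psi t).

Definition C_L2 (R : realType) (T : R) (u : R -> R -> R) : Prop :=
  (forall t : R, 0 <= t <= T -> L2_I (u t)) /\
  forall s : R, 0 <= s <= T ->
    (fun t : R => (\int[leb R]_(x in I) ((u t x - u s x) ^+ 2)%:E)%E)
      @ within `[0, T] (nbhs s) --> 0%E.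

(* Om is a selection of L(v_x), L = W' = sgn(. + 1) + sgn(. - 1), in the
   subdifferential sense. *)
Definition selection (R : realType) (v Om : R -> R) : Prop :=
  forall w : R -> R, BV_I w ->
    (intW v + (charge_int (cadd (Dmeas w) (copp (Dmeas v))) I Om)%:E
     <= intW w)%E.

Definition solution_on (R : realType) (T : R) (u Om : R -> R -> R) : Prop :=
  [/\ Linfty_BV T u,
      L2_W12 T Om &
      exists ut : R -> R -> R,
        [/\ L2_Q T ut, time_deriv T u ut &
            \forall t \ae leb R, 0 < t < T ->
              (forall phi : R -> R, test_function (-1) 1 phi ->
                 \int[leb R]_(x in I) (ut t x * phi x)
                 = - \int[leb R]_(x in I) (Om t x * derive1 phi x)) /\
              selection (u t) (Om t)]].

Definition dirichlet0 (R : realType) (v Om : R -> R) : Prop :=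
  (exists a b : R, [/\ has_trace v (-1) a, has_trace Om (-1) b &
     [\/ a = 0, (0 < a /\ b = 2) | (a < 0 /\ b = - 2)]]) /\
  (exists a b : R, [/\ has_trace v 1 a, has_trace Om 1 b &
     [\/ a = 0, (0 < a /\ b = - 2) | (a < 0 /\ b = 2)]]).

(* u is the representative that is continuous in time with values in L^2(I),
   so u t is meaningful for every t >= 0.  One Om serves all T: choices made
   for each T = 1, 2, ... can be glued along the intervals ]n, n + 1]. *)
Definition is_solution (R : realType) (u0 : R -> R) (u Om : R -> R -> R) : Prop :=
  [/\ forall T : R, 0 < T -> solution_on T u Om,
      forall T : R, 0 < T -> C_L2 T u,
      \forall x \ae leb R, I x -> u 0 x = u0 x &
      \forall t \ae leb R, 0 < t -> dirichlet0 (u t) (Om t)].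

Definition extinction_time (R : realType) (u : R -> R -> R) (Text : R) : Prop :=
  0 < Text /\
  exists ut : R -> R -> R,
    [/\ forall T : R, 0 < T -> L2_Q T ut /\ time_deriv T u ut,
        \forall t \ae leb R, Text < t -> \forall x \ae leb R, I x -> ut t x = 0 &
        forall eps : R, 0 < eps ->
          ~ \forall t \ae leb R, 0 < t -> Text - eps < t < Text ->
              \forall x \ae leb R, I x -> ut t x = 0].

(* Main.v *)
(* Uniqueness is a contraction argument.  For two solutions put w = u1 - u2 and
   z = w_t.  Since z is the x-derivative of Om1 - Om2, integrating by parts
   against the measure Dw gives <w, z> = (boundary terms) - int (Om1 - Om2) dDw.
   The two subdifferential inequalities, each tested with the other solution,
   make the last integral nonnegative; testing a selection with u +- (a unit
   jump) gives |Om| <= 2, so that the boundary conditions make the boundary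
   terms nonpositive.  Hence <w(t), z(t)> <= 0 for a.e. t.  As
   <w(b) - w(a), chi> is the integral of <z, chi> over (a, b), one gets
   |w(b)|^2 - |w(a)|^2 <= 2 (b - a) int_a^b |z|^2, and summing over a fine
   subdivision shows that |w|^2 does not increase.

   Both explicit solutions have the shape v = k(t) + ||x| - r(t)|, with r = 1 in
   (a) and r = 1 - sqrt(2t) in (b).  The slopes of v are +1 and -1, so int W(Dv)
   = 4, and Om is a selection as soon as |Om| <= 2 and Om v_x = |Om|: split Om as
   al + be with |al|, |be| <= 1 and al - be = 2 - |Om|, and pair al with D(w + x)
   and be with D(w - x).

   In (a) the flux is determined because u_t, hence Om up to a constant in x, is
   unique, and the boundary value gamma Om(-1) = 2 is forced by gamma u(-1) > 0
   before extinction. *)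
Require Import Defs.
From mathcomp Require Import all_boot all_order all_algebra.
From mathcomp Require Import all_classical all_reals all_analysis.
From mathcomp Require Import measurable_realfun ring lra.

Set Implicit Arguments.
Unset Strict Implicit.
Unset Printing Implicit Defensive.

Import Order.TTheory GRing.Theory Num.Theory.
Import numFieldNormedType.Exports.

Local Open Scope classical_set_scope.
Local Open Scope ring_scope.

(** * Smooth functions and smooth steps *)

Section smooth.
Context {R : realType}.
Implicit Types (f g : R -> R) (x c d : R).

(** Test functions vanish near the endpoints and derivatives are only distributional, so pointwise
    values are recovered by testing with differences of smooth steps: at Lebesgue points [a] and [b]
    the limit is an increment from [a] to [b]. The same argument serves BV functions in [x], fluxes
    in [x] and scalar products in [t]. Since [Dmeas] is a choice and Hahn sets are too, charges are
    handled through arbitrary representations as a difference of two measures finite on [I]. The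
    energy cannot simply be differentiated: the time identity concerns one fixed [chi], and its
    differentiated form holds off a null set that depends on [chi]. Hence the subdivision for the
    energy, and countably many [chi] for the flux. In (b) put [s = 1 - r]. The flux goes from size 2
    at the boundary to 0 at the kink, so [u_t = 2 / s] on a strip of width [s]. There
    [u = |x| - 2 + e + 2 s], so [u_t = 2 s'], whence [s s' = 1] and [s = sqrt(2t)]. The boundary
    value [e - 1 + 2 s] vanishes when [s = (1 - e) / 2], that is at time [(1 - e)^2 / 8]. *)

Definition flat (k : nat) x : R :=
  if 0 < x then x^-1 ^+ k * expR (- x^-1) else 0.

Lemma flat_ge0 k x : 0 <= flat k x.
Proof.
rewrite /flat; case: ifPn => // x0.
by rewrite mulr_ge0 ?exprn_ge0 ?invr_ge0 ?expR_ge0// ltW.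
Qed.

(** This is [e^y >= y^(k+2) / (k+2)!] at [y = 1/x]. A bound quadratic in [x] is what forces the
    derivative at the origin to be 0. *)
Lemma flat_le k x : `|flat k x| <= k.+2`!%:R * x ^+ 2.
Proof.
rewrite ger0_norm ?flat_ge0// /flat; case: ifPn => x0; last first.
  by rewrite mulr_ge0 ?ler0n ?sqr_ge0.
have y0 : 0 < x^-1 by rewrite invr_gt0.
have H : x^-1 ^+ k.+2 <= k.+2`!%:R * expR x^-1.
  rewrite mulrC -ler_pdivrMr ?ltr0n ?fact_gt0//.
  by apply: le_trans (expR_ge1Dxn k.+1 (ltW y0)); rewrite lerDr.
rewrite expRN ler_pdivrMr ?expR_gt0//.
rewrite -(ler_pM2r (_ : 0 < x^-1 ^+ 2)) ?exprn_gt0//.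
rewrite -exprD addn2 (le_trans H)//.
rewrite [leRHS](_ : _ = k.+2`!%:R * expR x^-1 * (x * x^-1) ^+ 2); last by ring.
by rewrite mulfV ?gt_eqF// expr1n mulr1.
Qed.

(** The powers of [1/x] are part of the family because differentiating [e^(-1/x)] produces them;
    with the index [k] the family spans its own derivatives. *)
Lemma is_derive_flat k x :
  is_derive x 1 (flat k) (flat k.+2 x - k%:R * flat k.+1 x).
Proof.
have [x0|x0|->] := ltrgtP x 0.
- apply: (@near_eq_is_derive _ _ _ (cst 0)); last first.
    by rewrite /flat !ltNge (ltW x0)/= mulr0 subr0; exact: is_derive_cst.
  near=> y; rewrite /flat ifF//; apply/negbTE; rewrite -leNgt ltW//.
  by near: y; exact: lt_nbhsl.
- apply: (@near_eq_is_derive R R R (fun y : R => y^-1 ^+ k * expR (- y^-1))).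
    near=> y; rewrite /flat ifT//.
    by near: y; exact: lt_nbhsr.
  have xn0 : x != 0 by rewrite gt_eqF.
  rewrite /flat x0.
  have dV : is_derive x 1 (fun y : R => y^-1) (- x ^- 2).
    have := @is_deriveV R id x _ _ xn0 (is_derive_id x 1).
    by rewrite /GRing.scale/= mulr1.
  have dE : is_derive x 1 (fun y : R => expR (- y^-1)) (expR (- x^-1) * x ^- 2).
    have dN : is_derive x 1 (fun y : R => - y^-1) (x ^- 2).
      by rewrite -[x ^- 2]opprK; exact: is_deriveN.
    exact: (@is_derive1_comp R expR _ x _ _ (is_derive_expR _) dN).
  case: k => [|k].
    rewrite (_ : (fun y => _) = fun y : R => expR (- y^-1)); last first.
      by apply/funext => y; rewrite expr0 mul1r.
    by apply: is_derive_eq dE _; rewrite mul0r subr0 mulrC exprVn.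
  have dX : is_derive x 1 (fun y : R => y^-1 ^+ k.+1)
      ((k.+1%:R * x^-1 ^+ k) *: (- x ^- 2)).
    rewrite (_ : (fun y => _) = (fun y : R => y^-1) ^+ k.+1); last first.
      by apply/funext => y; rewrite exprfctE.
    exact: is_deriveX.
  apply: is_derive_eq (is_deriveM dX dE) _.
  rewrite /GRing.scale/= -[x ^- 2]exprVn !exprS expr0; ring.
(* At the origin the difference quotient is [flat k z / z], which tends to 0 by [flat_le]. *)
- rewrite /flat ltxx mulr0 subr0 -/(flat k).
  apply/is_derive1_caratheodory; exists (fun z => flat k z / z); split.
  + move=> z; rewrite subr0 [flat k 0]/flat ltxx subr0.
    by have [->|z0] := eqVneq z 0; rewrite ?mulr0 ?divfK// /flat ltxx.
  + rewrite /continuous_at /prop_for invr0 mulr0; apply/cvgr0Pnorm_le => e e0; near=> z.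
    have [->|z0] := eqVneq z 0; first by rewrite invr0 mulr0 normr0 ltW.
    rewrite normrM normfV ler_pdivrMr ?normr_gt0// (le_trans (flat_le k z))//.
    rewrite -[z ^+ 2]ger0_norm ?sqr_ge0// expr2 normrM mulrA ler_pM2r ?normr_gt0//.
    rewrite mulrC -ler_pdivlMr ?ltr0n ?fact_gt0//.
    near: z; apply: (nbhs0_le (V:=R)); by rewrite divr_gt0 ?ltr0n ?fact_gt0.
  + by rewrite invr0 mulr0.
Unshelve. all: by end_near. Qed.

(** A syntactic class closed under differentiation, so that derivatives of all orders exist without
    any of them being computed. Inverses are included for the normalising denominator of the
    steps. *)
Inductive smooth : (R -> R) -> Prop :=
| smooth_flat k c d : smooth (fun x => flat k (c * x + d))
| smooth_cst c : smooth (fun=> c)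
| smoothD f g : smooth f -> smooth g -> smooth (fun x => f x + g x)
| smoothM f g : smooth f -> smooth g -> smooth (fun x => f x * g x)
| smoothV f : (forall x, f x != 0) -> smooth f -> smooth (fun x => (f x)^-1).

Lemma smooth_derive f : smooth f ->
  exists2 g, smooth g & forall x, is_derive x 1 f (g x).
Proof.
elim=> {f} [k c d|c|f g _ [f' sf df] _ [g' sg dg]|f g sf [f' sf' df] sg [g' sg' dg]
  |f f0 sf [f' sf' df]].
- exists (fun x => c * (flat k.+2 (c * x + d) + (- k%:R) * flat k.+1 (c * x + d))).
    apply: smoothM; first exact: smooth_cst.
    apply: smoothD; first exact: smooth_flat.
    by apply: smoothM; [exact: smooth_cst|exact: smooth_flat].
  move=> x; have H : is_derive (c * x + d) 1 (flat k) _ := is_derive_flat k (c * x + d).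
  have H2 : is_derive x 1 (fun x => c * x + d) c.
    by apply: is_derive_eq; rewrite /GRing.scale/= mulr1 !addr0.
  have H3 := @is_derive1_comp R _ _ x _ _ H H2.
  by apply: is_derive_eq; rewrite mulNr mulrC.
- by exists (fun=> 0); [exact: smooth_cst|move=> x; exact: is_derive_cst].
- exists (fun x => f' x + g' x); first exact: smoothD.
  by move=> x; apply: is_deriveD.
- exists (fun x => f x * g' x + g x * f' x).
    by apply: smoothD; apply: smoothM.
  by move=> x; apply: is_deriveM.
- exists (fun x => (- 1 * (f x)^-1) * (f x)^-1 * f' x).
    apply: (smoothM _ sf'); apply: smoothM; last exact: smoothV.
    by apply: smoothM; [exact: smooth_cst|exact: smoothV].
  move=> x; have := @is_deriveV R f x _ _ (f0 x) (df x).
  by rewrite /GRing.scale /= -exprVn expr2 mulN1r mulNr.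
Qed.

Lemma smooth_derive1n f n : smooth f -> smooth (derive1n n f).
Proof.
move=> sf; elim: n => [//|n]; rewrite derive1nS => /smooth_derive[g sg dg].
suff -> : derive1 (derive1n n f) = g by [].
by apply/funext => x; rewrite derive1E; have [] := dg x.
Qed.

Lemma smooth_derivable f n x : smooth f -> derivable (derive1n n f) x 1.
Proof.
by move=> /(smooth_derive1n n)/smooth_derive[g _ dg]; have [] := dg x.
Qed.

(** The classical quotient [f(y) / (f(y) + f(1 - y))] with [f(y) = e^(-1/y)] for [y > 0] and
    [y = c x + d]. One of [y] and [1 - y] is positive, so the denominator never vanishes. *)
Definition smoothstep c d x : R :=
  flat 0 (c * x + d) * (flat 0 (c * x + d) + flat 0 (- c * x + (1 - d)))^-1.

Lemma smooth_smoothstep c d : smooth (smoothstep c d).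
Proof.
apply: smoothM; first exact: smooth_flat.
apply: smoothV; last by apply: smoothD; exact: smooth_flat.
move=> x; rewrite gt_eqF//.
have [x0|x0] := ltP 0 (c * x + d).
  by rewrite ltr_pwDl ?flat_ge0// /flat x0 expr0 mul1r expR_gt0.
have x1 : 0 < - c * x + (1 - d) by lra.
by rewrite ltr_pwDr ?flat_ge0// /flat x1 expr0 mul1r expR_gt0.
Qed.

Lemma smoothstep0 c d x : c * x + d <= 0 -> smoothstep c d x = 0.
Proof. by move=> x0; rewrite /smoothstep {1}/flat ltNge x0/= mul0r. Qed.

Lemma smoothstep1 c d x : 1 <= c * x + d -> smoothstep c d x = 1.
Proof.
move=> x1; have x0 : 0 < c * x + d by lra.
rewrite /smoothstep [flat 0 (- c * x + _)]/flat ifF ?addr0 ?mulfV//.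
  by rewrite gt_eqF// /flat x0 expr0 mul1r expR_gt0.
by apply/negbTE; rewrite -leNgt; lra.
Qed.

Lemma smoothstep_itv c d x : 0 <= smoothstep c d x <= 1.
Proof.
rewrite /smoothstep; set a := flat _ _; set b := flat _ _.
have a0 : 0 <= a by exact: flat_ge0.
have b0 : 0 <= b by exact: flat_ge0.
have [->|an0] := eqVneq (a + b) 0; first by rewrite invr0 mulr0 lexx ler01.
have ab : 0 < a + b by rewrite lt_neqAle eq_sym an0 addr_ge0.
by rewrite divr_ge0 ?addr_ge0//= ler_pdivrMr// mul1r lerDl.
Qed.

(* The n-th step rises from 0 at a to 1 at a + 1 / (n + 1). *)
Definition stepn (n : nat) a x : R := smoothstep n.+1%:R (- (n.+1%:R * a)) x.

Lemma stepn0 n a x : x <= a -> stepn n a x = 0.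
Proof.
move=> xa; apply: smoothstep0; rewrite -mulrBr.
by rewrite mulr_ge0_le0// subr_le0.
Qed.

Lemma stepn1 n a x : a + n.+1%:R^-1 <= x -> stepn n a x = 1.
Proof.
move=> xa; apply: smoothstep1; rewrite -mulrBr -ler_pdivrMl ?ltr0n// mulr1.
by rewrite lerBrDl.
Qed.

Lemma stepn_itv n a x : 0 <= stepn n a x <= 1.
Proof. exact: smoothstep_itv. Qed.

(** All steps are translated dilations of one profile, which makes bounds on their derivatives
    uniform in [a] and linear in [n + 1]. *)
Lemma stepnE n a x : stepn n a x = smoothstep 1 0 (n.+1%:R * (x - a)).
Proof.
rewrite /stepn /smoothstep.
have -> : n.+1%:R * x + - (n.+1%:R * a) = 1 * (n.+1%:R * (x - a)) + 0 by ring.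
by congr (_ * (_ + flat 0 _)^-1); ring.
Qed.

(** A step rises to the right of its position, so the limit is the indicator of an open half-line.
    Convergence of the positions does not decide the case [x = a]; the extra hypothesis does. *)
Lemma stepn_cvg (an : nat -> R) (a x : R) : an n @[n --> \oo] --> a ->
  (x <= a -> \forall n \near \oo, x <= an n) ->
  stepn n (an n) x @[n --> \oo] --> ((a < x)%R%:R : R).
Proof.
move=> ana H; have [ax|xa] := ltP a x; last first.
  by apply: cvg_near_cst; near=> n => /=; rewrite stepn0//; near: n; exact: H.
have e0 : 0 < (x - a) / 2 by rewrite divr_gt0// subr_gt0.
have Hn := near_infty_natSinv_lt (PosNum e0).
apply: cvg_near_cst; near=> n => /=; rewrite stepn1//.
have h1 : an n <= a + (x - a) / 2.
  by near: n; apply: (cvgr_le a) => //; lra.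
have h2 : n.+1%:R^-1 <= (x - a) / 2.
  by apply: ltW; near: n; exact: Hn.
move: h1 h2; move: (n.+1%:R^-1 : R) => e h1 h2; lra.
Unshelve. all: by end_near. Qed.

End smooth.

(** * Test functions *)

Section tools.
Context {R : realType}.
Implicit Types (f g phi : R -> R) (a b c p q x y : R).

Lemma derivable_cont f : (forall x, derivable f x 1) -> continuous f.
Proof.
by move=> df x; apply: differentiable_continuous; exact/derivable1_diffP.
Qed.

Lemma continuous_mfun (D : set R) f : measurable D -> continuous f ->
  measurable_fun D f.
Proof.
by move=> mD cf; apply: subspace_continuous_measurable_fun => //; exact: continuous_subspaceT.
Qed.

Lemma bounded_integrable d (T : measurableType d)
    (m : {measure set T -> \bar R}) (D : set T) (f : T -> R) (M : R) :
  measurable D -> (m D < +oo)%E -> measurable_fun D f ->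
  (forall t, D t -> `|f t| <= M) -> m.-integrable D (EFin \o f).
Proof.
move=> mD mDoo mf fM; apply: measurable_bounded_integrable => //.
exists M; split; first exact: num_real.
by move=> y My t Dt /=; rewrite (le_trans (fM t Dt))// ltW.
Qed.

Lemma integrable_mul_bounded d (T : measurableType d)
    (m : {measure set T -> \bar R}) (D : set T) (f g : T -> R) (M : R) :
  measurable D -> m.-integrable D (EFin \o f) -> measurable_fun D g ->
  (forall t, D t -> `|g t| <= M) ->
  m.-integrable D (EFin \o (fun t => f t * g t)).
Proof.
move=> mD intf mg gM.
have mf : measurable_fun D f by exact/measurable_EFinP/(measurable_int m).
apply: (@le_integrable _ _ _ _ _ mD _ (fun t => (M%:E * (f t)%:E)%E)).
- by apply/measurable_EFinP; exact: measurable_funM.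
- move=> t Dt /=; rewrite lee_fin !normrM mulrC ler_wpM2r//.
  by rewrite (le_trans (gM t Dt))// ler_norm.
- exact: integrableZl.
Qed.

Lemma bounded_compact_support f a b : continuous f ->
  (forall x, x \notin `[a, b] -> f x = 0) -> exists M : R, forall x, `|f x| <= M.
Proof.
move=> cf f0; have [ab|ba] := leP a b; last first.
  exists 0 => x; rewrite f0 ?normr0// in_itv/= negb_and.
  by have [ax|//] := leP a x; rewrite -ltNge (lt_le_trans ba ax).
have cn : {within `[a, b], continuous (fun x => `|f x|)}.
  apply: continuous_subspaceT => x; apply: continuous_comp; first exact: cf.
  exact: norm_continuous.
have [c _ H] := EVT_max ab cn; exists `|f c| => x.
by have [/H//|/f0 ->] := boolP (x \in `[a, b]); rewrite normr0.
Qed.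

Lemma Rintegral_FTC f a b : a < b -> (forall x, derivable f x 1) ->
  continuous (derive1 f) -> \int[leb R]_(x in `[a, b]) derive1 f x = f b - f a.
Proof.
move=> ab df cdf; rewrite /Rintegral.
have cf := derivable_cont df.
have dF : derivable_oo_LRcontinuous f a b.
  split => [x _|  | ]; first exact: df.
  + by apply: cvg_at_right_filter; exact: cf.
  + by apply: cvg_at_left_filter; exact: cf.
exact: (congr1 fine (continuous_FTC2 ab (continuous_subspaceT cdf) dF (fun x _ => erefl))).
Qed.

Lemma itv_lt_pinfty (i : interval R) a b : [set` i] `<=` `[a, b] ->
  (leb R [set` i] < +oo)%E.
Proof.
move=> ib; apply: (@le_lt_trans _ _ (leb R `[a, b])).
  by apply: le_measure => //; rewrite inE; exact: measurable_itv.
by rewrite lebesgue_measure_itv; case: ifP; rewrite ltry.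
Qed.

Lemma itvoo_lty a b : (leb R `]a, b[ < +oo)%E.
Proof. by apply: (@itv_lt_pinfty _ a b); exact: subset_itv_oo_cc. Qed.

Lemma continuous_integrable (i : interval R) a b f : [set` i] `<=` `[a, b] ->
  continuous f -> (leb R).-integrable [set` i] (EFin \o f).
Proof.
move=> ib cf; have [ab|ba] := leP a b; last first.
  rewrite (_ : [set` i] = set0); first exact: integrable_set0.
  by apply/seteqP; split => // x /ib /=; rewrite in_itv/=; lra.
have cn : {within `[a, b], continuous (fun x => `|f x|)}.
  apply: continuous_subspaceT => x; apply: continuous_comp; first exact: cf.
  exact: norm_continuous.
have [c _ H] := EVT_max ab cn.
apply: (@bounded_integrable _ _ _ _ _ `|f c|) => //.
- exact: itv_lt_pinfty ib.
- exact: continuous_mfun.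
- by move=> x /ib /=; exact: H.
Qed.

Section test_functions.
Variables (p q : R) (phi : R -> R).
Hypothesis tphi : test_function p q phi.

Lemma tf_derivable x : derivable phi x 1.
Proof. by have [/(_ 0%N)/(_ x)] := tphi. Qed.

Lemma tf_continuous : continuous phi.
Proof. exact/derivable_cont/tf_derivable. Qed.

Lemma tf_derive_continuous : continuous (derive1 phi).
Proof. by apply: derivable_cont => x; have [/(_ 1%N)/(_ x)] := tphi. Qed.

Lemma tf_derive0 : exists c d, [/\ p < c, d < q,
  forall x, x \notin `[c, d] -> phi x = 0 &
  forall x, x \notin `[c, d] -> derive1 phi x = 0].
Proof.
have [_ [c [d [pc dq phi0]]]] := tphi; exists c, d; split => // x xcd.
suff [_ H] : is_derive x 1 phi 0 by rewrite derive1E.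
have H : is_derive x 1 (cst 0 : R -> R) 0 := is_derive_cst 0 x 1.
apply: near_eq_is_derive H.
move: xcd; rewrite in_itv/= negb_and -!ltNge => /orP[xc|dx].
- near=> y; apply/esym/phi0; rewrite in_itv/= negb_and -!ltNge; apply/orP; left.
  by near: y; exact: lt_nbhsl.
- near=> y; apply/esym/phi0; rewrite in_itv/= negb_and -!ltNge; apply/orP; right.
  by near: y; exact: lt_nbhsr.
Unshelve. all: by end_near. Qed.

Lemma tf_bounded : exists M : R, forall x, `|phi x| <= M.
Proof.
have [c [d [_ _ phi0 _]]] := tf_derive0.
exact: bounded_compact_support tf_continuous phi0.
Qed.

Lemma tf_derive_bounded : exists M : R, forall x, `|derive1 phi x| <= M.
Proof.
have [c [d [_ _ _ phi0]]] := tf_derive0.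
exact: bounded_compact_support tf_derive_continuous phi0.
Qed.

Lemma tf_FTC y : p < y < q -> \int[leb R]_(x in `[y, q[) derive1 phi x = - phi y.
Proof.
move=> /andP[py yq].
rewrite Rintegral_itv_bndo_bndc; last first.
  apply: (@continuous_integrable _ y q); last exact: tf_derive_continuous.
  by move=> x /=; rewrite !in_itv/= => /andP[-> /ltW ->].
rewrite Rintegral_FTC//; [|exact: tf_derivable|exact: tf_derive_continuous].
have [c [d [_ dq phi0 _]]] := tf_derive0.
by rewrite phi0 ?sub0r// in_itv/= negb_and -!ltNge dq orbT.
Qed.

End test_functions.

Lemma smooth_stepn n a : smooth (stepn n a).
Proof. exact: smooth_smoothstep. Qed.

(** To the right of both rises the two steps cancel. This is how a compactly supported test function
    approximates the indicator of an interval. *)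
Lemma stepnB_test p q n a b : p < a -> p < b ->
  a + n.+1%:R^-1 < q -> b + n.+1%:R^-1 < q ->
  test_function p q (fun x => stepn n a x - stepn n b x).
Proof.
move=> pa pb aq bq; split.
  move=> k x; apply: smooth_derivable.
  rewrite (_ : (fun _ => _) = fun x => stepn n a x + - 1 * stepn n b x).
    apply: smoothD; first exact: smooth_stepn.
    by apply: smoothM; [exact: smooth_cst|exact: smooth_stepn].
  by apply/funext => y; rewrite mulN1r.
exists (Num.min a b), (Num.max a b + n.+1%:R^-1); split.
- by rewrite lt_min pa pb.
- by rewrite addr_maxl gt_max aq bq.
- move=> x; rewrite in_itv/= negb_and -!ltNge lt_min addr_maxl gt_max.
  move=> /orP[/andP[xa xb]|/andP[ax bx]].
    by rewrite !stepn0 ?subrr// ltW.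
  by rewrite !stepn1 ?subrr// ltW.
Qed.

Lemma derivable_stepn n a x : derivable (stepn n a) x 1.
Proof. by have := @smooth_derivable R _ 0%N x (smooth_stepn n a). Qed.

Lemma derive_stepn_continuous n a : continuous (derive1 (stepn n a)).
Proof.
by apply: derivable_cont => x; by have := @smooth_derivable R _ 1%N x (smooth_stepn n a).
Qed.

Lemma derive_stepnB n a b x : derive1 (fun x => stepn n a x - stepn n b x) x =
  derive1 (stepn n a) x - derive1 (stepn n b) x.
Proof.
by rewrite !derive1E deriveB//; exact: derivable_stepn.
Qed.

Lemma derive_stepnE n a x :
  derive1 (stepn n a) x = n.+1%:R * derive1 (smoothstep 1 0) (n.+1%:R * (x - a)).
Proof.
have dS z : derivable (smoothstep 1 0 : R -> R) z 1.
  by have := @smooth_derivable R _ 0%N z (smooth_smoothstep 1 0).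
rewrite (_ : stepn n a = smoothstep 1 0 \o (fun x => n.+1%:R * (x - a))); last first.
  by apply/funext => y; rewrite stepnE.
have dl : is_derive x 1 (fun x => n.+1%:R * (x - a)) n.+1%:R.
  by apply: is_derive_eq; rewrite /GRing.scale/= ?subr0 ?mulr1 ?addr0 ?mulr0 ?add0r.
have := @is_derive1_comp R (smoothstep 1 0) _ x _ _ (derivableP (dS _)) dl.
by rewrite derive1E => -[_ ->]; rewrite derive1E mulrC.
Qed.

Lemma derive_stepn_out n a x : x \notin `[a, a + n.+1%:R^-1] ->
  derive1 (stepn n a) x = 0.
Proof.
move=> xcd.
have H (c : R) : (\near x, stepn n a x = c) -> derive1 (stepn n a) x = 0.
  move=> Hc; suff [_ H] : is_derive x 1 (stepn n a) 0 by rewrite derive1E.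
  have H : is_derive x 1 (cst c : R -> R) 0 := is_derive_cst c x 1.
  apply: near_eq_is_derive H.
  by apply: filterS Hc => y ->.
move: xcd; rewrite in_itv/= negb_and -!ltNge => /orP[xc|dx].
- apply: (H 0); near=> y; apply: stepn0; apply: ltW.
  by near: y; exact: lt_nbhsl.
- apply: (H 1); near=> y; apply: stepn1; apply: ltW.
  by near: y; exact: lt_nbhsr.
Unshelve. all: by end_near. Qed.

(** By scaling, one bound on the derivative of the profile, which is continuous with compact
    support, serves all [n] and [a]. *)
Lemma derive_stepn_bound : exists2 C : R, 0 <= C &
  forall n a x, `|derive1 (stepn n a) x| <= C * n.+1%:R.
Proof.
have cS : continuous (derive1 (smoothstep 1 0 : R -> R)).
  by apply: derivable_cont => x; by have := @smooth_derivable R _ 1%N x (smooth_smoothstep 1 0).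
have S0 x : x \notin `[0, 1] -> derive1 (smoothstep 1 0 : R -> R) x = 0.
  have := @derive_stepn_out 0%N 0 x; rewrite derive_stepnE invr1 add0r subr0 !mul1r.
  exact.
have [M HM] := bounded_compact_support cS S0.
exists M; first exact: le_trans (HM 0).
by move=> n a x; rewrite derive_stepnE normrM normr_nat mulrC ler_wpM2r.
Qed.

Lemma int_derive_stepn p q n a : p < a -> a + n.+1%:R^-1 < q ->
  \int[leb R]_(x in `]p, q[) derive1 (stepn n a) x = 1.
Proof.
move=> pa aq; have n0 : 0 < n.+1%:R^-1 :> R by rewrite invr_gt0.
have pq : p < q by rewrite (lt_trans pa)// (lt_trans _ aq)// ltrDl.
have int (i : interval R) : [set` i] `<=` `[p, q] ->
    (leb R).-integrable [set` i] (EFin \o derive1 (stepn n a)).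
  by move=> ipq; exact: continuous_integrable ipq (@derive_stepn_continuous n a).
rewrite Rintegral_itv_bndo_bndc; last by apply: int; exact: subset_itv_oo_cc.
rewrite Rintegral_itv_obnd_cbnd; last by apply: int; exact: subset_itv_oc_cc.
rewrite Rintegral_FTC//; [|exact: derivable_stepn|exact: derive_stepn_continuous].
by rewrite stepn1 ?stepn0 ?subr0// ltW.
Qed.

End tools.

(** * Weak derivatives and Lebesgue points *)

Section averages.
Context {R : realType}.
Implicit Types (f g phi : R -> R) (a b c p q x y : R).

Lemma integrable_mfun d (T : measurableType d) (m : {measure set T -> \bar R})
  (D : set T) (f : T -> R) : m.-integrable D (EFin \o f) -> measurable_fun D f.
Proof. by move=> intf; apply/measurable_EFinP; exact: measurable_int intf. Qed.

Section real_integrable.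
Context d (T : measurableType d) (m : {measure set T -> \bar R}) (D : set T).
Hypothesis mD : measurable D.
Implicit Types u v : T -> R.

Lemma integrableRZ u c : m.-integrable D (EFin \o u) ->
  m.-integrable D (EFin \o (fun t => c * u t)).
Proof. by move=> iu; apply: eq_integrable (integrableZl mD c iu). Qed.

Lemma integrableRD u v : m.-integrable D (EFin \o u) ->
  m.-integrable D (EFin \o v) -> m.-integrable D (EFin \o (fun t => u t + v t)).
Proof. by move=> iu iv; apply: eq_integrable (integrableD mD iu iv). Qed.

Lemma integrableRB u v : m.-integrable D (EFin \o u) ->
  m.-integrable D (EFin \o v) -> m.-integrable D (EFin \o (fun t => u t - v t)).
Proof. by move=> iu iv; apply: eq_integrable (integrableB mD iu iv). Qed.

End real_integrable.

(** Averages become integrals along the radii [2 / (n+1)]. The factor 2 lets the open ball contain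
    the closed interval [[a, a + 1/(n+1)]] on which a step rises. *)
Lemma lebesgue_ptP f a : lebesgue_pt f a -> forall e, 0 < e ->
  \forall n \near \oo, (\int[leb R]_(y in ball a (2 * n.+1%:R^-1)) `|(f y - f a)%:E|
     <= (e * n.+1%:R^-1)%:E)%E.
Proof.
move=> fa e e0.
(* The ball of radius [2 / (n+1)] has measure [4 / (n+1)]. *)
have e40 : 0 < e / 4 by rewrite divr_gt0.
have : \forall r \near (0:R)^'+, (davg f a r < (e / 4)%:E)%E.
  apply: (fa [set y | (y < (e / 4)%:E)%E]) => /=.
  exists (e / 4) => //= y /=; rewrite sub0r normrN => h.
  by rewrite lte_fin (le_lt_trans (ler_norm _) h).
rewrite /at_right near_withinE => -[d /= d0 H].
have d20 : 0 < d / 2 by rewrite divr_gt0.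
have Hn := near_infty_natSinv_lt (PosNum d20).
near=> n.
have n0 : 0 < n.+1%:R^-1 :> R by rewrite invr_gt0.
have nd : n.+1%:R^-1 < d / 2 by near: n; exact: Hn.
have {}H : (davg f a (2 * n.+1%:R^-1) < (e / 4)%:E)%E.
  apply: H => //=.
  by rewrite sub0r normrN gtr0_norm ?mulr_gt0// mulrC -ltr_pdivlMr.
move: H; rewrite /davg /iavg lebesgue_measure_ball; last by rewrite ltW// mulr_gt0.
set J := (\int[_]_(_ in _) _)%E.
have -> : ((2 * n.+1%:R^-1) *+ 2)%:E = (4 * n.+1%:R^-1)%:E :> \bar R.
  by congr EFin; ring.
rewrite inver gt_eqF ?mulr_gt0// => H.
have J0 : (0 <= J)%E by exact: integral_ge0.
move: H J0; case: J => [j|//|//]; last first.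
  by rewrite gt0_muley ?lte_fin ?invr_gt0 ?mulr_gt0// ltNge leey.
rewrite -EFinM !lte_fin lee_fin => H J0.
move: H; rewrite ltr_pdivrMl ?mulr_gt0// => /ltW; congr (_ <= _).
by field.
Unshelve. all: by end_near. Qed.

(** The derivatives of the steps form an approximate identity: mass 1, support of length [1/(n+1)],
    height at most [C (n+1)]. Their being one-sided does no harm at a Lebesgue point. *)
Lemma step_average p q f a : p < a < q -> (leb R).-integrable `]p, q[ (EFin \o f) ->
  lebesgue_pt (f \_ `]p, q[) a ->
  \int[leb R]_(x in `]p, q[) (f x * derive1 (stepn n a) x) @[n --> \oo] --> f a.
Proof.
move=> /andP[pa aq] intf fa.
have [C C0 HC] := @derive_stepn_bound R.
apply/cvgrPdist_le => e e0.
have eC0 : 0 < e / (C + 1) by rewrite divr_gt0// ltr_wpDl.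
have Hn := lebesgue_ptP fa eC0.
have aq0 : 0 < q - a by rewrite subr_gt0.
have Hq := near_infty_natSinv_lt (PosNum aq0).
near=> n.
have n0 : 0 < n.+1%:R^-1 :> R by rewrite invr_gt0.
have nq : a + n.+1%:R^-1 < q by rewrite -ltrBrDl; near: n; exact: Hq.
have Hn' : (\int[leb R]_(y in ball a (2 * n.+1%:R^-1))
    `|((f \_ `]p, q[) y - (f \_ `]p, q[) a)%:E|
    <= (e / (C + 1) * n.+1%:R^-1)%:E)%E by near: n; exact: Hn.
pose J : set R := [set` `]p, q[].
have mJ : measurable J by exact: measurable_itv.
pose rho : R -> R := derive1 (stepn n a).
have mrho : measurable_fun J rho by apply: continuous_mfun => //; exact: derive_stepn_continuous.
have brho x : J x -> `|rho x| <= C * n.+1%:R by move=> _; exact: HC.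
have irho : (leb R).-integrable J (EFin \o rho).
  by apply: (@bounded_integrable _ _ _ _ _ _ (C * n.+1%:R)) => //; exact: itvoo_lty.
have ifrho : (leb R).-integrable J (EFin \o (fun x => f x * rho x)).
  by apply: (@integrable_mul_bounded _ _ _ _ _ _ _ (C * n.+1%:R)).
rewrite -/J -/rho.
have -> : f a = \int[leb R]_(x in J) (f a * rho x).
  by rewrite RintegralZl// int_derive_stepn// mulr1.
have ifa : (leb R).-integrable J (EFin \o (fun x => f a * rho x)) by exact: integrableRZ.
rewrite -RintegralB//.
have mf : measurable_fun J f by exact: integrable_mfun intf.
rewrite -lee_fin EFin_normr_Rintegral//; last first.
  exact: integrableRB.
have mD : measurable_fun J (fun x => f a * rho x - f x * rho x).
  by apply: measurable_funB; apply: measurable_funM => //; exact: measurable_cst.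
apply: (le_trans (le_abse_integral (leb R) mJ _)); first exact/measurable_EFinP.
have mfJ : measurable_fun [set: R] (f \_ J).
  by apply/(measurable_restrictT _ _).1.
pose B : set R := ball a (2 * n.+1%:R^-1).
have mB : measurable B by exact: measurable_ball.
pose h x : \bar R := `|((f \_ J) x - (f \_ J) a)%:E|%E.
have mh : measurable_fun [set: R] h.
  apply: measurableT_comp => //; apply/measurable_EFinP.
  by apply: measurable_funB => //; exact: measurable_cst.
have Ch x : (0 <= (C * n.+1%:R)%:E * h x)%E by apply: mule_ge0; [rewrite lee_fin mulr_ge0|exact: abse_ge0].
(* The kernel vanishes off [[a, a + 1/(n+1)]], which lies in [B], and is at most [C (n+1)] on it. *)
apply: (@le_trans _ _ (\int[leb R]_(x in B) ((C * n.+1%:R)%:E * h x))%E).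
  rewrite integral_mkcond [leRHS]integral_mkcond.
  apply: ge0_le_integral => //.
  - by move=> x _; rewrite patchE; case: ifP.
  - by apply/(measurable_restrictT _ _).1 => //; apply: measurableT_comp => //; exact/measurable_EFinP.
  - apply/(measurable_restrictT _ _).1 => //; apply: measurable_funTS.
    by apply: measurable_funeM.
  - move=> x _; rewrite !patchE; case: ifP => [xJ|_]; last first.
      by case: ifP => // _; exact: Ch.
    have [xa|xa] := boolP (x \in `[a, a + n.+1%:R^-1]).
      rewrite ifT; last first.
        rewrite inE /B /ball/= distrC ger0_norm; last first.
          by move: xa; rewrite in_itv/= => /andP[? _]; rewrite subr_ge0.
        move: xa; rewrite in_itv/= => /andP[_ xa].
        by rewrite ltrBlDl (le_lt_trans xa)// ltrD2l ltr_pMl// ltr1n.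
      rewrite /h !patchE xJ ifT; last by rewrite inE /J/= in_itv/= pa aq.
      rewrite -mulrBl abse_EFin abse_EFin -EFinM lee_fin normrM mulrC distrC.
      by rewrite ler_wpM2r// HC.
    rewrite /rho derive_stepn_out// !mulr0 subrr abse0.
    by case: ifP => // _; exact: Ch.
rewrite ge0_integralZl//; first last.
  - by rewrite lee_fin mulr_ge0.
  - by move=> x _; exact: abse_ge0.
  - exact: measurable_funTS.
apply: (@le_trans _ _ ((C * n.+1%:R)%:E * (e / (C + 1) * n.+1%:R^-1)%:E)%E).
  by apply: lee_wpmul2l; [rewrite lee_fin mulr_ge0|exact: Hn'].
rewrite -EFinM lee_fin.
rewrite [leLHS](_ : _ = e * (C / (C + 1)) * (n.+1%:R * n.+1%:R^-1)); last by ring.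
rewrite mulfV ?gt_eqF// mulr1 ger_pMr// ler_pdivrMr ?mul1r ?lerDl//.
by rewrite ltr_wpDl.
Unshelve. all: by end_near. Qed.

(** The right-hand side of the weak formulation is kept abstract as [L n], so that the derivative
    may be a charge ([BV_primitive]) or a function ([W_primitive]). *)
Lemma weak_increment p q f a b (L : nat -> R) s :
  p < a < q -> p < b < q -> (leb R).-integrable `]p, q[ (EFin \o f) ->
  lebesgue_pt (f \_ `]p, q[) a -> lebesgue_pt (f \_ `]p, q[) b ->
  (forall n, test_function p q (fun x => stepn n a x - stepn n b x) ->
    \int[leb R]_(x in `]p, q[) (f x * derive1 (fun x => stepn n a x - stepn n b x) x)
    = - L n) ->
  L n @[n --> \oo] --> s -> f b - f a = s.
Proof.
move=> pa pb intf fa fb HL Ls.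
have [paq pbq] := (pa, pb).
move: pa pb => /andP[pa aq] /andP[pb bq].
have Ha := step_average paq intf fa.
have Hb := step_average pbq intf fb.
have aq0 : 0 < q - a by rewrite subr_gt0.
have bq0 : 0 < q - b by rewrite subr_gt0.
have Hqa := near_infty_natSinv_lt (PosNum aq0).
have Hqb := near_infty_natSinv_lt (PosNum bq0).
have [C C0 HC] := @derive_stepn_bound R.
have int n c : (leb R).-integrable `]p, q[ (EFin \o (fun x => f x * derive1 (stepn n c) x)).
  apply: (@integrable_mul_bounded _ _ _ _ _ _ _ (C * n.+1%:R)) => //.
  by apply: continuous_mfun => //; exact: derive_stepn_continuous.
have H1 : (\int[leb R]_(x in `]p, q[) (f x * derive1 (stepn n b) x)
    - \int[leb R]_(x in `]p, q[) (f x * derive1 (stepn n a) x)) @[n --> \oo]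
    --> f b - f a by exact: cvgB.
rewrite -(cvg_lim _ H1)//; apply: cvg_lim => //.
apply: cvg_trans Ls; apply: near_eq_cvg; near=> n.
rewrite /= -RintegralB//.
rewrite -[L n]opprK -HL; last first.
  apply: stepnB_test => //; rewrite -ltrBrDl.
    by near: n; exact: Hqa.
  by near: n; exact: Hqb.
rewrite -mulN1r -RintegralZl//; last first.
  rewrite (_ : (fun x => f x * _) = fun x => f x * derive1 (stepn n a) x -
    f x * derive1 (stepn n b) x); last first.
    by apply/funext => x; rewrite derive_stepnB mulrBr.
  exact: integrableRB.
apply: eq_Rintegral => x _; rewrite derive_stepnB.
by move: (f x) (derive1 (stepn n a) x) (derive1 (stepn n b) x) => r1 r2 r3; ring.
Unshelve. all: by end_near. Qed.

Lemma continuous_lebesgue_pt_itv p q f a : p < a < q ->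
  {in `]p, q[, continuous f} -> (leb R).-integrable `]p, q[ (EFin \o f) ->
  lebesgue_pt (f \_ `]p, q[) a.
Proof.
move=> paq cf intf.
have mf : measurable_fun `]p, q[%classic f.
  exact: integrable_mfun intf.
apply: (@continuous_lebesgue_pt _ _ _ [set: R]) => //.
- exact: open_nbhsT.
- by apply/(measurable_restrictT _ _).1.
- have aJ : a \in `]p, q[ by rewrite in_itv.
  have nJ : \near a, (f \_ `]p, q[) a = f a.
    have : nbhs a `]p, q[%classic.
      by apply: open_nbhs_nbhs; split => //; exact: interval_open.
    by apply: filterS => x xJ; rewrite patchE mem_set.
  apply: (cvg_trans (near_eq_cvg _)) => //=; last first.
    rewrite patchE mem_set//; exact: cf.
  by apply: filterS nJ => x ->.
Qed.

Lemma ae_lebesgue_pt p q f : (leb R).-integrable `]p, q[ (EFin \o f) ->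
  \forall x \ae leb R, lebesgue_pt (f \_ `]p, q[) x.
Proof.
move=> intf; apply: lebesgue_differentiation.
exact: integrable_locally.
Qed.

End averages.

(** * Differences of finite measures *)

Section charges.
Context {R : realType}.
Local Notation T := (measurableTypeR R).
Implicit Types (nu : {charge set T -> \bar R}) (m : {measure set T -> \bar R}).
Implicit Types (f g : R -> R) (A : set T).

Definition madd m1 m2 : {measure set T -> \bar R} := measure_add m1 m2.

Lemma maddE m1 m2 A : madd m1 m2 A = (m1 A + m2 A)%E.
Proof. exact: measure_addE. Qed.

Lemma caddE nu1 nu2 A :
  (cadd nu1 nu2 : {charge set T -> \bar R}) A = (nu1 A + nu2 A)%E.
Proof. by []. Qed.

Lemma coppE nu A : (copp nu : {charge set T -> \bar R}) A = (- nu A)%E.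
Proof. by []. Qed.

Lemma mI : measurable (I : set T).
Proof. exact: measurable_itv. Qed.
Hint Resolve mI : core.

Lemma leI_lty : (leb R I < +oo)%E.
Proof. exact: itvoo_lty. Qed.

(** The Jordan decomposition is one such pair, but sums, opposites, Dirac masses and slopes come
    with pairs of their own. Working with any pair avoids computing Hahn sets. *)
Definition charge_diff nu m1 m2 := [/\ (m1 I < +oo)%E, (m2 I < +oo)%E &
  forall A : set T, measurable A -> A `<=` I -> nu A = (m1 A - m2 A)%E].

Lemma measure_subI_fin m A : (m I < +oo)%E -> measurable A -> A `<=` I ->
  m A \is a fin_num.
Proof.
move=> mIoo mA AI; rewrite ge0_fin_numE//; apply: le_lt_trans mIoo.
by apply: le_measure => //; rewrite inE.
Qed.

Lemma finite_measureI (m : {finite_measure set T -> \bar R}) : (m I < +oo)%E.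
Proof. by rewrite -ge0_fin_numE//; exact: fin_num_measure. Qed.

Lemma charge_diff_jordan nu :
  charge_diff nu (jordan_pos (hahn_PN nu)) (jordan_neg (hahn_PN nu)).
Proof.
split; [exact: finite_measureI|exact: finite_measureI|move=> A mA _].
by rewrite (jordan_decomp (hahn_PN nu) mA) /cadd/= cscaleN1.
Qed.

Lemma charge_diff_eq nu m1 m2 m1' m2' : charge_diff nu m1 m2 ->
  charge_diff nu m1' m2' -> forall A, measurable A -> A `<=` I ->
  madd m1 m2' A = madd m1' m2 A.
Proof.
move=> [f1 f2 H] [f1' f2' H'] A mA AI.
rewrite !maddE.
have := H A mA AI; rewrite H'//.
rewrite -(fineK (measure_subI_fin f1 mA AI)) -(fineK (measure_subI_fin f2 mA AI)).
rewrite -(fineK (measure_subI_fin f1' mA AI)) -(fineK (measure_subI_fin f2' mA AI)).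
rewrite -!EFinB -!EFinD => -[h]; congr EFin; lra.
Qed.

Section integrals.
Variables (f : R -> R) (M : R).
Hypothesis mf : measurable_fun (I : set T) f.
Hypothesis fM : forall x, I x -> `|f x| <= M.

Lemma bounded_integrableI m : (m I < +oo)%E -> m.-integrable I (EFin \o f).
Proof. by move=> mIoo; apply: (@bounded_integrable R _ T m I f M). Qed.

Lemma Rintegral_madd m1 m2 : (m1 I < +oo)%E -> (m2 I < +oo)%E ->
  \int[madd m1 m2]_(x in I) f x =
  \int[m1]_(x in I) f x + \int[m2]_(x in I) f x.
Proof.
move=> h1 h2; have i1 := bounded_integrableI h1; have i2 := bounded_integrableI h2.
have E := integral_measure_add mI i1 i2.
rewrite /Rintegral /madd E.
by rewrite fineD//; exact: integrable_fin_num.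
Qed.

(** On [I] the positive measures [m1 + m2'] and [m1' + m2] coincide, so the difference of integrals
    does not see which pair represents the charge. *)
Lemma charge_diff_int nu m1 m2 m1' m2' : charge_diff nu m1 m2 ->
  charge_diff nu m1' m2' ->
  \int[m1]_(x in I) f x - \int[m2]_(x in I) f x =
  \int[m1']_(x in I) f x - \int[m2']_(x in I) f x.
Proof.
move=> H H'; have E := charge_diff_eq H H'.
case: H H' => f1 f2 _ [f1' f2' _].
suff : \int[m1]_(x in I) f x + \int[m2']_(x in I) f x =
    \int[m1']_(x in I) f x + \int[m2]_(x in I) f x by lra.
rewrite -!Rintegral_madd// /Rintegral.
by rewrite (eq_measure_integral _ E).
Qed.

Lemma charge_intE nu m1 m2 : charge_diff nu m1 m2 ->
  charge_int nu I f = \int[m1]_(x in I) f x - \int[m2]_(x in I) f x.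
Proof. exact: charge_diff_int (charge_diff_jordan nu). Qed.

End integrals.

Lemma charge_diff_add nu1 nu2 m1 m2 n1 n2 : charge_diff nu1 m1 m2 ->
  charge_diff nu2 n1 n2 ->
  charge_diff (cadd nu1 nu2) (madd m1 n1) (madd m2 n2).
Proof.
move=> [f1 f2 H] [g1 g2 G]; split.
- by rewrite (maddE m1 n1) lte_add_pinfty.
- by rewrite (maddE m2 n2) lte_add_pinfty.
move=> A mA AI; rewrite caddE H// G// !maddE.
rewrite -(fineK (measure_subI_fin f1 mA AI)) -(fineK (measure_subI_fin f2 mA AI)).
rewrite -(fineK (measure_subI_fin g1 mA AI)) -(fineK (measure_subI_fin g2 mA AI)).
by rewrite -!EFinB -!EFinD -?EFinB; congr EFin; ring.
Qed.

Lemma charge_diff_opp nu m1 m2 : charge_diff nu m1 m2 ->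
  charge_diff (copp nu) m2 m1.
Proof.
move=> [f1 f2 H]; split => // A mA AI; rewrite coppE H//.
rewrite -(fineK (measure_subI_fin f1 mA AI)) -(fineK (measure_subI_fin f2 mA AI)).
by rewrite -!EFinB -EFinN; congr EFin; lra.
Qed.

Lemma charge_diff_ext nu nu' m1 m2 :
  (forall A : set T, measurable A -> A `<=` I -> nu A = nu' A) ->
  charge_diff nu m1 m2 -> charge_diff nu' m1 m2.
Proof. by move=> E [f1 f2 H]; split => // A mA AI; rewrite -E// H. Qed.

Lemma charge_int_add nu1 nu2 f M : measurable_fun (I : set T) f ->
  (forall x, I x -> `|f x| <= M) ->
  charge_int (cadd nu1 nu2) I f = charge_int nu1 I f + charge_int nu2 I f.
Proof.
move=> mf fM; have c1 := charge_diff_jordan nu1; have c2 := charge_diff_jordan nu2.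
rewrite (charge_intE mf fM (charge_diff_add c1 c2)).
case: c1 c2 => a1 b1 _ [a2 b2 _].
by rewrite !(Rintegral_madd mf fM)// /charge_int; lra.
Qed.

Lemma charge_int_opp nu f M : measurable_fun (I : set T) f ->
  (forall x, I x -> `|f x| <= M) ->
  charge_int (copp nu) I f = - charge_int nu I f.
Proof.
move=> mf fM; have c1 := charge_diff_jordan nu.
by rewrite (charge_intE mf fM (charge_diff_opp c1)) /charge_int; lra.
Qed.

Lemma charge_int_ext nu nu' f M : measurable_fun (I : set T) f ->
  (forall x, I x -> `|f x| <= M) ->
  (forall A : set T, measurable A -> A `<=` I -> nu A = nu' A) ->
  charge_int nu I f = charge_int nu' I f.
Proof.
move=> mf fM E; have c1 := charge_diff_jordan nu.
by rewrite [RHS](charge_intE mf fM (charge_diff_ext E c1)).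
Qed.

Lemma charge_intD nu f g M N : measurable_fun (I : set T) f ->
  (forall x, I x -> `|f x| <= M) -> measurable_fun (I : set T) g ->
  (forall x, I x -> `|g x| <= N) ->
  charge_int nu I (fun x => f x + g x) = charge_int nu I f + charge_int nu I g.
Proof.
move=> mf fM mg gN; have [f1 f2 _] := charge_diff_jordan nu.
rewrite /charge_int !RintegralD//; first lra.
all: by apply: bounded_integrableI; eassumption.
Qed.

Lemma tvar_fin nu : tvar nu I \is a fin_num.
Proof.
rewrite /tvar /charge_variation fin_numD.
by rewrite !fin_num_measure.
Qed.

Lemma fine_tvar nu : fine (tvar nu I) =
  fine (jordan_pos (hahn_PN nu) I) + fine (jordan_neg (hahn_PN nu) I).
Proof. by rewrite /tvar /charge_variation fineD ?fin_num_measure. Qed.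

Lemma charge_int_le_tvar nu f M : measurable_fun (I : set T) f ->
  (forall x, I x -> `|f x| <= M) ->
  charge_int nu I f <= M * fine (tvar nu I).
Proof.
move=> mf fM; have [f1 f2 _] := charge_diff_jordan nu.
have icst c m : (m I < +oo)%E -> m.-integrable I (EFin \o (fun=> c : R)).
  by move=> moo; apply: (@bounded_integrable _ _ _ _ _ _ `|c|).
have h1 : \int[jordan_pos (hahn_PN nu)]_(x in I) f x <=
    M * fine (jordan_pos (hahn_PN nu) I).
  rewrite -Rintegral_cst//; apply: le_Rintegral => //.
  - exact: (bounded_integrableI mf fM).
  - exact: icst.
  - by move=> x Ix; rewrite (le_trans (ler_norm _))// fM.
have h2 : - M * fine (jordan_neg (hahn_PN nu) I) <=
    \int[jordan_neg (hahn_PN nu)]_(x in I) f x.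
  rewrite -Rintegral_cst//; apply: le_Rintegral => //.
  - exact: icst.
  - exact: (bounded_integrableI mf fM).
  - by move=> x Ix; rewrite lerNl (le_trans _ (fM _ Ix))// -normrN ler_norm.
rewrite fine_tvar mulrDr /charge_int; apply: lerD => //.
by rewrite lerNl -mulNr.
Qed.

(** Minimality of the Jordan decomposition: the variation is [nu] on the positive Hahn set minus
    [nu] on the negative one, and replacing each [nu] by [m1 - m2] leaves at most [m1 + m2]. *)
Lemma tvar_le nu m1 m2 : charge_diff nu m1 m2 -> (tvar nu I <= m1 I + m2 I)%E.
Proof.
move=> [f1 f2 H]; rewrite /tvar /charge_variation.
have [[mP _] [mN _] PN PN0] := hahn_PN nu.
have mIP : measurable (I `&` hahn_P nu) by exact: measurableI.
have mIN : measurable (I `&` hahn_N nu) by exact: measurableI.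
have -> : jordan_pos (hahn_PN nu) I = nu (I `&` hahn_P nu).
  by rewrite jordan_posE cjordan_posE /crestr0 mem_set.
have -> : jordan_neg (hahn_PN nu) I = (- nu (I `&` hahn_N nu))%E.
  by rewrite jordan_negE cjordan_negE /crestr0 mem_set.
rewrite !H//; try exact: subIsetl.
have E (m : {measure set T -> \bar R}) :
    m I = (m (I `&` hahn_P nu) + m (I `&` hahn_N nu))%E.
  rewrite -measureU//; last by rewrite setIACA PN0 setI0.
  by rewrite -setIUr PN setIT.
rewrite (E m1) (E m2).
have s1 := @subIsetl _ I (hahn_P nu); have s2 := @subIsetl _ I (hahn_N nu).
have q1 := measure_subI_fin f1 mIP s1; have q2 := measure_subI_fin f1 mIN s2.
have q3 := measure_subI_fin f2 mIP s1; have q4 := measure_subI_fin f2 mIN s2.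
have g1 : 0 <= fine (m1 (I `&` hahn_N nu)) by rewrite fine_ge0.
have g2 : 0 <= fine (m2 (I `&` hahn_P nu)) by rewrite fine_ge0.
rewrite -(fineK q1) -(fineK q2) -(fineK q3) -(fineK q4).
rewrite -!EFinB -!EFinD lee_fin; lra.
Qed.

Lemma fine_tvar_add nu1 nu2 :
  fine (tvar (cadd nu1 nu2) I) <= fine (tvar nu1 I) + fine (tvar nu2 I).
Proof.
have c1 := charge_diff_jordan nu1; have c2 := charge_diff_jordan nu2.
have := tvar_le (charge_diff_add c1 c2).
rewrite -fineD ?tvar_fin// !maddE => h; apply: fine_le; rewrite ?tvar_fin//.
  by rewrite fin_numD !tvar_fin.
by rewrite (le_trans h)// addeACA.
Qed.

(** The two charges may have unrelated Hahn sets; [tvar_le] applied both ways removes the dependence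
    on them. It is needed because [Dmeas] is determined only inside [I]. *)
Lemma tvar_ext nu nu' :
  (forall A : set T, measurable A -> A `<=` I -> nu A = nu' A) ->
  tvar nu I = tvar nu' I.
Proof.
move=> E; apply/eqP; rewrite eq_le; apply/andP; split; apply: tvar_le.
  by apply: (@charge_diff_ext nu') => [A mA AI|]; [rewrite E|exact: charge_diff_jordan].
by apply: (@charge_diff_ext nu) => [A mA AI|]; [rewrite E|exact: charge_diff_jordan].
Qed.

End charges.
#[export] Hint Resolve mI : core.

(** * Fubini for real-valued integrals *)

Lemma measurable_le_nat d (X : measurableType d) {R : realType} (D : set X) (F G : X -> R) :
  measurable D -> measurable_fun D F -> measurable_fun D G ->
  measurable_fun D (fun p => (F p <= G p)%R%:R : R).
Proof.
move=> mD mF mG; rewrite (_ : (fun p => _) = fun p => if F p <= G p then 1 else 0 : R).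
  apply: measurable_fun_if => //.
  exact: measurable_fun_ler.
by apply/funext => p; case: (F p <= G p).
Qed.

Section fubini.
Context d1 d2 (T1 : measurableType d1) (T2 : measurableType d2) {R : realType}.
Variables (m1 : {sigma_finite_measure set T1 -> \bar R}).
Variables (m2 : {sigma_finite_measure set T2 -> \bar R}).
Variables (D1 : set T1) (D2 : set T2) (G : T1 -> T2 -> R).
Hypotheses (mD1 : measurable D1) (mD2 : measurable D2).
Hypothesis mG : measurable_fun (D1 `*` D2) (fun p => G p.1 p.2).
(** Extension by zero, so that Fubini is applied on the whole product space. *)
Let H : T1 * T2 -> R := (fun p => G p.1 p.2) \_ (D1 `*` D2).

Let mH : measurable_fun setT (EFin \o H).
Proof.
apply/measurable_EFinP; apply/(measurable_restrictT _ _).1 => //.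
exact: measurableX.
Qed.

Let HE1 x : D1 x -> (fun y => H (x, y)) = G x \_ D2.
Proof.
move=> D1x; apply/funext => y; rewrite /H !patchE; case: ifPn.
  by rewrite inE => -[/= _ D2y]; rewrite mem_set.
rewrite notin_setE /= => h; rewrite ifF//; apply/negbTE.
by rewrite notin_setE => D2y; apply: h.
Qed.

Let HE2 y : D2 y -> (fun x => H (x, y)) = (fun x => G x y) \_ D1.
Proof.
move=> D2y; apply/funext => x; rewrite /H !patchE; case: ifPn.
  by rewrite inE => -[/= D1x _]; rewrite mem_set.
rewrite notin_setE /= => h; rewrite ifF//; apply/negbTE.
by rewrite notin_setE => D1x; apply: h.
Qed.

Let H01 x y : ~ D1 x -> H (x, y) = 0.
Proof.
by move=> D1x; rewrite /H patchE ifF//; apply/negbTE; rewrite notin_setE => -[].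
Qed.

Let H02 x y : ~ D2 y -> H (x, y) = 0.
Proof.
by move=> D2y; rewrite /H patchE ifF//; apply/negbTE; rewrite notin_setE => -[].
Qed.

Lemma measurable_section1 x : D1 x -> measurable_fun D2 (G x).
Proof.
move=> D1x; apply/(measurable_restrictT _ mD2).2; rewrite -(HE1 D1x).
by apply: measurable_fun_pair2; exact/measurable_EFinP.
Qed.

Lemma measurable_section2 y : D2 y -> measurable_fun D1 (fun x => G x y).
Proof.
move=> D2y; apply/(measurable_restrictT _ mD1).2; rewrite -(HE2 D2y).
by apply: measurable_fun_pair1; exact/measurable_EFinP.
Qed.

Lemma measurable_integral_abs :
  measurable_fun D1 (fun x => \int[m2]_(y in D2) `|(G x y)%:E|)%E.
Proof.
have mA : measurable_fun setT (fun u => `|(EFin \o H) u|%E).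
  exact: measurableT_comp.
have A0 u : (0 <= `|(EFin \o H) u|)%E by exact: abse_ge0.
have := @measurable_fun_fubini_tonelli_F _ _ T1 T2 R m2 _ mA A0.
move=> /(measurable_funS measurableT (@subsetT _ D1)).
apply: eq_measurable_fun => x; rewrite inE => D1x.
rewrite /fubini_F [RHS]integral_mkcond; apply: eq_integral => y _ /=.
have := HE1 D1x => /(congr1 (fun f => f y)) /= ->.
by rewrite !patchE; case: ifP => //; rewrite normr0.
Qed.

Hypothesis G_lty : (\int[m1]_(x in D1) \int[m2]_(y in D2) `|(G x y)%:E| < +oo)%E.

Let iH : (m1 \x m2)%E.-integrable setT (EFin \o H).
Proof.
apply/integrable12ltyP; first exact: mH.
apply: le_lt_trans G_lty.
rewrite [leRHS]integral_mkcond le_eqVlt; apply/orP; left; apply/eqP.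
apply: eq_integral => x _; rewrite patchE; case: ifPn => [|].
  rewrite inE => D1x; rewrite [RHS]integral_mkcond; apply: eq_integral => y _ /=.
  have := HE1 D1x => /(congr1 (fun f => f y)) /=; rewrite !patchE => ->.
  by case: ifP => //; rewrite normr0.
rewrite notin_setE => D1x; apply: integral0_eq => y _ /=.
by rewrite H01// normr0.
Qed.

Lemma Rfubini_ae1 : \forall x \ae m1, D1 x -> m2.-integrable D2 (EFin \o G x).
Proof.
have := ae_integrable1 iH; apply: filterS => x hx D1x.
have := (@integrable_restrict _ _ _ m2 D2 mD2 setT measurableT (EFin \o G x)).2.
rewrite setTI; apply; apply: eq_integrable hx => // y _ /=.
have := HE1 D1x => /(congr1 (fun f => f y)) /= ->.
by rewrite !patchE; case: ifP.
Qed.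

Lemma Rfubini_ae2 :
  \forall y \ae m2, D2 y -> m1.-integrable D1 (EFin \o (fun x => G x y)).
Proof.
have := ae_integrable2 iH; apply: filterS => y hy D2y.
have := (@integrable_restrict _ _ _ m1 D1 mD1 setT measurableT (EFin \o (fun x => G x y))).2.
rewrite setTI; apply; apply: eq_integrable hy => // x _ /=.
have := HE2 D2y => /(congr1 (fun f => f x)) /= ->.
by rewrite !patchE; case: ifP.
Qed.

Let FE1 x : D1 x -> fine (fubini_F m2 (EFin \o H) x) = \int[m2]_(y in D2) G x y.
Proof.
move=> D1x; rewrite Rintegral_mkcond -(HE1 D1x) /Rintegral /fubini_F.
by congr fine; apply: eq_integral => y _.
Qed.

Let FE2 y : D2 y -> fine (fubini_G m1 (EFin \o H) y) = \int[m1]_(x in D1) G x y.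
Proof.
move=> D2y; rewrite Rintegral_mkcond -(HE2 D2y) /Rintegral /fubini_G.
by congr fine; apply: eq_integral => x _.
Qed.

Lemma integrable_fubini_G : m2.-integrable setT (fubini_G m1 (EFin \o H)).
Proof.
apply/integrableP; split; first exact: (measurable_fubini_G iH).
apply: le_lt_trans ((integrable21ltyP m1 m2 mH).1 iH).
have mA : measurable_fun setT (fun u => `|(EFin \o H) u|%E).
  exact: measurableT_comp.
have A0 u : (0 <= `|(EFin \o H) u|)%E by exact: abse_ge0.
apply: ge0_le_integral => //.
- by apply: measurableT_comp => //; exact: (measurable_fubini_G iH).
- exact: (@measurable_fun_fubini_tonelli_G _ _ T1 T2 R m1 _ mA A0).
- move=> y _; apply: le_abse_integral => //.
  by apply: measurable_fun_pair1.
Qed.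

Lemma integrable_fine d (T : measurableType d) (m : {measure set T -> \bar R})
  (f : T -> \bar R) : m.-integrable setT f ->
  m.-integrable setT (EFin \o (fine \o f)).
Proof.
move=> /integrableP[mf foo]; apply/integrableP; split.
  by apply/measurable_EFinP; exact: measurableT_comp.
apply: le_lt_trans foo; apply: ge0_le_integral => //.
- apply: measurableT_comp => //; apply/measurable_EFinP; exact: measurableT_comp.
- exact: measurableT_comp.
- by move=> x _ /=; case: (f x) => //=; rewrite ?normr0 leey.
Qed.

Lemma Rintegrable_fubini1 :
  m1.-integrable D1 (EFin \o (fun x => \int[m2]_(y in D2) G x y)).
Proof.
have := integrable_fine (integrable_fubini_F iH).
move=> /(integrableS measurableT mD1 (@subsetT _ D1)).
by apply: eq_integrable => // x; rewrite inE => D1x /=; rewrite FE1.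
Qed.

Lemma Rintegrable_fubini2 :
  m2.-integrable D2 (EFin \o (fun y => \int[m1]_(x in D1) G x y)).
Proof.
have := integrable_fine integrable_fubini_G.
move=> /(integrableS measurableT mD2 (@subsetT _ D2)).
by apply: eq_integrable => // x; rewrite inE => D1x /=; rewrite FE2.
Qed.

(** An integrable function is finite almost everywhere, so truncating its infinite values by [fine]
    keeps the integral. Section integrals need this. *)
Lemma integral_fine d (T : measurableType d) (m : {measure set T -> \bar R})
  (f : T -> \bar R) : m.-integrable setT f ->
  \int[m]_x (fine (f x)) = fine (\int[m]_x f x)%E.
Proof.
move=> intf; have [mf _] := integrableP _ _ _ intf.
congr fine; apply: ae_eq_integral => //.
  by apply/measurable_EFinP; exact: measurableT_comp.
have := integrable_ae measurableT intf; apply: filterS => x /= h _.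
by rewrite fineK// h.
Qed.

Lemma Rfubini : \int[m1]_(x in D1) \int[m2]_(y in D2) G x y =
  \int[m2]_(y in D2) \int[m1]_(x in D1) G x y.
Proof.
transitivity (\int[m1]_x fine (fubini_F m2 (EFin \o H) x)).
  rewrite Rintegral_mkcond; apply: eq_Rintegral => x _.
  rewrite patchE; case: ifPn; rewrite ?inE ?notin_setE => D1x; first by rewrite FE1.
  by rewrite /fubini_F integral0_eq// => y _ /=; rewrite H01.
transitivity (\int[m2]_x fine (fubini_G m1 (EFin \o H) x)); last first.
  rewrite [RHS]Rintegral_mkcond; apply: eq_Rintegral => x _.
  rewrite patchE; case: ifPn; rewrite ?inE ?notin_setE => D1x; first by rewrite FE2.
  by rewrite /fubini_G integral0_eq// => y _ /=; rewrite H02.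
rewrite !integral_fine; [|exact: integrable_fubini_G|exact: (integrable_fubini_F iH)].
by congr fine; exact: Fubini.
Qed.

End fubini.

(** * Exchanging a primitive with an outer integral *)

Section primitives.
Context {R : realType}.
Local Notation T := (measurableTypeR R).
Variables (m : {sigma_finite_measure set T -> \bar R}) (p q : R) (z h : R -> R).
Hypothesis iz : (leb R).-integrable `]p, q[ (EFin \o z).
Hypothesis ih : m.-integrable `]p, q[ (EFin \o h).

Lemma Rintegral_le_ind x : x < q ->
  \int[m]_(y in `]p, q[) (h y * (y <= x)%R%:R) = \int[m]_(y in `]p, x]) h y.
Proof.
move=> xq; have -> : `]p, x]%classic = `]p, q[ `&` [set y | y <= x].
  apply/seteqP; split => y /=; rewrite !in_itv/=.
    by move=> /andP[-> yx]; rewrite yx (le_lt_trans yx).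
  by move=> [/andP[-> _] ->].
rewrite Rintegral_mkcondr; apply: eq_Rintegral => y _; rewrite patchE.
case: ifPn => [|]; first by rewrite inE/= => ->; rewrite mulr1.
by rewrite notin_setE/= => /negP/negbTE ->; rewrite mulr0.
Qed.

Lemma Rintegral_ge_ind y : p < y ->
  \int[leb R]_(x in `]p, q[) (z x * (y <= x)%R%:R) = \int[leb R]_(x in `[y, q[) z x.
Proof.
move=> py; have -> : `[y, q[%classic = `]p, q[ `&` [set x | y <= x].
  apply/seteqP; split => x /=; rewrite !in_itv/=.
    by move=> /andP[yx ->]; rewrite yx (lt_le_trans py).
  by move=> [/andP[_ ->] ->].
rewrite Rintegral_mkcondr; apply: eq_Rintegral => x _; rewrite patchE.
case: ifPn => [|]; first by rewrite inE/= => ->; rewrite mulr1.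
by rewrite notin_setE/= => /negP/negbTE ->; rewrite mulr0.
Qed.

Let J : set R := [set` `]p, q[].
Let G (x y : R) : R := z x * (h y * (y <= x)%R%:R).

Let mJ : measurable (J : set T). Proof. exact: measurable_itv. Qed.

Let mle : measurable_fun setT (fun u : T * T => (u.2 <= u.1)%R%:R : R).
Proof. exact: measurable_le_nat. Qed.

Let mG : measurable_fun ((J : set T) `*` (J : set T)) (fun u => G u.1 u.2).
Proof.
have mz : measurable_fun J z := integrable_mfun iz.
have mh : measurable_fun J h := integrable_mfun ih.
have m1 : measurable_fun ((J : set T) `*` (J : set T)) (fun u : T * T => z u.1).
  apply: (@measurable_comp _ _ _ _ _ _ J z _ (@fst T T)) => //.
    by move=> _ [[a b] [/= ? ?] <-].
  exact: measurable_funTS.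
have m2 : measurable_fun ((J : set T) `*` (J : set T)) (fun u : T * T => h u.2).
  apply: (@measurable_comp _ _ _ _ _ _ J h _ (@snd T T)) => //.
    by move=> _ [[a b] [/= ? ?] <-].
  exact: measurable_funTS.
by do 2 apply: measurable_funM => //; exact: measurable_funTS.
Qed.

(** The indicator is at most 1, so the double integral is bounded by the product of the two L1
    norms. *)
Let G_lty : (\int[leb R]_(x in J) \int[m]_(y in J) `|(G x y)%:E| < +oo)%E.
Proof.
have mz : measurable_fun J z := integrable_mfun iz.
have mh : measurable_fun J h := integrable_mfun ih.
have /integrableP[_ hoo] := ih; have /integrableP[_ zoo] := iz.
pose K : \bar R := (\int[m]_(y in J) `|(h y)%:E|)%E.
have K0 : (0 <= K)%E by exact: integral_ge0.
apply: (@le_lt_trans _ _ (\int[leb R]_(x in J) (K * `|(z x)%:E|))%E); last first.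
  rewrite ge0_integralZl//; last first.
    by apply: measurableT_comp => //; exact/measurable_EFinP.
  by apply: lte_mul_pinfty => //; rewrite ge0_fin_numE.
apply: ge0_le_integral => //.
- by move=> x _; exact: integral_ge0.
- exact: (measurable_integral_abs m mJ mJ mG).
- by apply: emeasurable_funM => //; apply: measurableT_comp => //; exact/measurable_EFinP.
- move=> x Jx; rewrite muleC -ge0_integralZl//; last first.
    by apply: measurableT_comp => //; exact/measurable_EFinP.
  apply: ge0_le_integral => //.
  + apply: measurableT_comp => //; apply/measurable_EFinP.
    exact: (measurable_section1 mJ mJ mG).
  + apply: emeasurable_funM => //; apply: measurableT_comp => //; exact/measurable_EFinP.
  + move=> y Jy; rewrite !abse_EFin -EFinM lee_fin !normrM ler_wpM2l//.
    by case: (y <= x); rewrite ?normr1 ?normr0 ?mulr1 ?mulr0.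
Qed.

Let inner1 x : J x ->
  \int[m]_(y in J) G x y = z x * \int[m]_(y in `]p, x]) h y.
Proof.
move=> Jx; have /andP[px xq] : p < x < q by move: Jx; rewrite /J/= in_itv.
rewrite -(Rintegral_le_ind xq) -RintegralZl//.
apply: (@integrable_mul_bounded _ _ _ _ _ _ _ 1) => //.
  have := measurable_section1 (D1 := setT) (D2 := J) (G := fun x y : R => (y <= x)%R%:R).
  by apply => //; exact: measurable_funTS.
by move=> y _; case: (y <= x); rewrite ?normr1 ?normr0.
Qed.

Let inner2 y : J y ->
  \int[leb R]_(x in J) G x y = h y * \int[leb R]_(x in `[y, q[) z x.
Proof.
move=> Jy; have /andP[py yq] : p < y < q by move: Jy; rewrite /J/= in_itv.
rewrite -(Rintegral_ge_ind py) -RintegralZl//.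
  by apply: eq_Rintegral => x _; rewrite /G; ring.
apply: (@integrable_mul_bounded _ _ _ _ _ _ _ 1) => //.
  have := measurable_section2 (D1 := J) (D2 := setT) (G := fun x y : R => (y <= x)%R%:R).
  by apply => //; exact: measurable_funTS.
by move=> x _; case: (y <= x); rewrite ?normr1 ?normr0.
Qed.

Lemma integrable_primitive : (leb R).-integrable `]p, q[
  (EFin \o (fun x => z x * \int[m]_(y in `]p, x]) h y)).
Proof.
have := Rintegrable_fubini1 mJ mJ mG G_lty; apply: eq_integrable => //.
by move=> x; rewrite inE => Jx /=; rewrite inner1.
Qed.

(** Both sides integrate [z x * h y] over the triangle [y <= x]. The diagonal belongs to it on both
    sides, which matters because [m] may have atoms. *)
Lemma fubini_primitive :
  \int[leb R]_(x in `]p, q[) (z x * \int[m]_(y in `]p, x]) h y) =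
  \int[m]_(y in `]p, q[) (h y * \int[leb R]_(x in `[y, q[) z x).
Proof.
transitivity (\int[leb R]_(x in J) \int[m]_(y in J) G x y).
  by apply: eq_Rintegral => x; rewrite inE => Jx; rewrite inner1.
rewrite (Rfubini mJ mJ mG G_lty).
by apply: eq_Rintegral => y; rewrite inE => Jy; rewrite inner2.
Qed.

End primitives.

(** * Uniqueness of the distributional derivative *)

Section dominated_steps.
Context {R : realType}.
Local Notation T := (measurableTypeR R).
Implicit Types (m : {measure set T -> \bar R}) (h v w : R -> R) (a b c x : R).

Lemma measurable_stepn (D : set T) n c : measurable D -> measurable_fun D (stepn n c).
Proof.
move=> mD; apply: (continuous_mfun mD); apply: derivable_cont => x.
exact: derivable_stepn.
Qed.

Lemma measurable_lt_ind (D : set T) c :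
  measurable D -> measurable_fun D (fun x : R => (c < x)%R%:R : R).
Proof.
move=> mD; rewrite (_ : (fun x => _) = fun x : R => if c < x then 1 else 0 : R).
  apply: measurable_funTS; apply: measurable_fun_ifT => //.
  exact: measurable_fun_ltr.
by apply/funext => x; case: (c < x).
Qed.

Lemma measurable_le_ind (D : set T) c :
  measurable D -> measurable_fun D (fun x : R => (x <= c)%R%:R : R).
Proof.
move=> mD; rewrite (_ : (fun x => _) = fun x : R => if x <= c then 1 else 0 : R).
  apply: measurable_funTS; apply: measurable_fun_ifT => //.
  exact: measurable_fun_ler.
by apply/funext => x; case: (x <= c).
Qed.

(** Dominated convergence with majorant [|h|]: a difference of two steps lies in [[-1, 1]]. *)
Lemma cvg_int_stepn m (D : set T) h (an bn : nat -> R) a b :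
  measurable D -> m.-integrable D (EFin \o h) ->
  (forall x, D x -> stepn n (an n) x @[n --> \oo] --> ((a < x)%R%:R : R)) ->
  (forall x, D x -> stepn n (bn n) x @[n --> \oo] --> ((b < x)%R%:R : R)) ->
  \int[m]_(x in D) (h x * (stepn n (an n) x - stepn n (bn n) x)) @[n --> \oo] -->
  \int[m]_(x in D) (h x * ((a < x)%R%:R - (b < x)%R%:R)).
Proof.
move=> mD ih Ha Hb.
have mh := integrable_mfun ih.
pose f_ n x : \bar R := (h x * (stepn n (an n) x - stepn n (bn n) x))%:E.
pose f x : \bar R := (h x * ((a < x)%R%:R - (b < x)%R%:R))%:E.
have fin : (\int[m]_(x in D) f x)%E \is a fin_num.
  apply: integrable_fin_num => //; apply: (@integrable_mul_bounded R _ _ _ _ _ _ 1) => //.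
    by apply: measurable_funB; exact: measurable_lt_ind.
  move=> x _; case: (a < x); case: (b < x);
    by rewrite ?subrr ?subr0 ?sub0r ?normrN ?normr1 ?normr0.
have H : (\int[m]_(x in D) f_ n x)%E @[n --> \oo] --> (\int[m]_(x in D) f x)%E.
  apply: (@dominated_cvg _ _ _ m D mD f_ f (fun x => `|h x|%:E)) => //.
  - move=> n; apply/measurable_EFinP; apply: measurable_funM => //.
    by apply: measurable_funB; exact: measurable_stepn.
  - move=> x Dx; apply: cvg_EFin; first exact: nearW.
    by apply: cvgM; [exact: cvg_cst|apply: cvgB; [exact: Ha|exact: Hb]].
  - by have := integrable_abse ih; apply: eq_integrable.
  - move=> n x Dx; rewrite /f_ abse_EFin lee_fin normrM -[leRHS]mulr1 ler_wpM2l//.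
    have := stepn_itv n (an n) x; have := stepn_itv n (bn n) x.
    by rewrite ler_norml; lra.
by rewrite -(fineK fin) in H; exact: (fine_cvg H).
Qed.

(* Clamping the position into I keeps stepn n (clamp n c) - stepn n (clamp n d)
   an admissible test function for every real c and d. *)
Definition clamp (n : nat) c : R :=
  Num.max (-1 + n.+1%:R^-1) (Num.min c (1 - 2 * n.+1%:R^-1)).

Lemma clamp_test n c d : (0 < n)%N -> test_function (-1) 1
  (fun x => stepn n (clamp n c) x - stepn n (clamp n d) x).
Proof.
move=> n0.
have e0 : 0 < n.+1%:R^-1 :> R by rewrite invr_gt0.
have e1 : 2 * n.+1%:R^-1 <= 1 :> R.
  by rewrite ler_pdivrMr ?ltr0n// mul1r ler_nat.
suff H k : (-1 < clamp n k) * (clamp n k + n.+1%:R^-1 < 1).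
  by apply: stepnB_test; rewrite H.
move: e0 e1; rewrite /clamp; move: (n.+1%:R^-1 : R) => e e0 e1.
split; first by rewrite lt_max; apply/orP; left; lra.
by rewrite addr_maxl gt_max addr_minl gt_min; apply/andP; split; [lra|apply/orP; right; lra].
Qed.

Lemma stepn_clamp c x : I x ->
  stepn n (clamp n c) x @[n --> \oo] --> ((c < x)%R%:R : R).
Proof.
rewrite /Iint /= in_itv/= => /andP[x1 x2].
have [cx|xc] := ltP c x; apply: cvg_near_cst.
  have e0 : 0 < Num.min ((x + 1) / 2) (x - c).
    by rewrite lt_min divr_gt0 ?subr_gt0//; lra.
  have Hn := near_infty_natSinv_lt (PosNum e0).
  near=> n => /=; apply: stepn1.
  have : n.+1%:R^-1 < Num.min ((x + 1) / 2) (x - c) by near: n; exact: Hn.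
  rewrite lt_min /clamp; move: (n.+1%:R^-1 : R) => e /andP[h1 h2].
  by rewrite addr_maxl ge_max; apply/andP; split; [lra|rewrite addr_minl ge_min; apply/orP; left; lra].
have e0 : 0 < (1 - x) / 2 by rewrite divr_gt0// subr_gt0.
have Hn := near_infty_natSinv_lt (PosNum e0).
near=> n => /=; apply: stepn0.
have : n.+1%:R^-1 < (1 - x) / 2 by near: n; exact: Hn.
rewrite /clamp; move: (n.+1%:R^-1 : R) => e h.
by rewrite le_max; apply/orP; right; rewrite le_min xc/=; lra.
Unshelve. all: by end_near. Qed.

(** Limits of steps give equality on the traces on [I] of the intervals []a, b]], a generating
    pi-system. These intervals range over the whole line, hence the clamped positions. *)
Lemma eq_measureI m1 m2 : (m1 I < +oo)%E -> (m2 I < +oo)%E ->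
  (forall phi, test_function (-1) 1 phi ->
    \int[m1]_(x in I) phi x = \int[m2]_(x in I) phi x) ->
  forall A : set T, measurable A -> A `<=` I -> m1 A = m2 A.
Proof.
move=> f1 f2 H.
have E a b : a <= b -> m1 (`]a, b]%classic `&` I) = m2 (`]a, b]%classic `&` I).
  move=> ab.
  have c1 m : (m I < +oo)%E -> m.-integrable I (EFin \o (fun=> 1 : R)).
    by move=> moo; apply: (@bounded_integrable R _ _ _ _ _ `|1|).
  have h1 m (moo : (m I < +oo)%E) := cvg_int_stepn mI (c1 m moo)
    (fun x => @stepn_clamp a x) (fun x => @stepn_clamp b x).
  have : \int[m1]_(x in I) (1 * ((a < x)%R%:R - (b < x)%R%:R)) =
         \int[m2]_(x in I) (1 * ((a < x)%R%:R - (b < x)%R%:R)).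
    rewrite -(cvg_lim _ (h1 m1 f1))//; apply: cvg_lim => //.
    apply: cvg_trans (h1 m2 f2); apply: near_eq_cvg; near=> n.
    under eq_Rintegral do rewrite mul1r.
    under [RHS]eq_Rintegral do rewrite mul1r.
    apply/esym/H/clamp_test; near: n; exact: nbhs_infty_gt.
  have e m : \int[m]_(x in I) (1 * ((a < x)%R%:R - (b < x)%R%:R)) =
      fine (m (`]a, b]%classic `&` I)).
    rewrite -integral_indic; [|exact: mI|exact: measurable_itv].
    congr fine; apply: eq_integral => x _; rewrite indicE mul1r; congr EFin.
    have [ax|xa] := ltP a x; have [bx|xb] := ltP b x.
    - by rewrite subrr memNset//= in_itv/= ax/= leNgt bx.
    - by rewrite subr0 mem_set//= in_itv/= ax xb.
    - by move: (le_lt_trans xa (le_lt_trans ab bx)); rewrite ltxx.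
    - by rewrite subrr memNset//= in_itv/= ltNge xa.
  have mab : measurable (`]a, b]%classic `&` I : set T) by exact: measurableI.
  have s := @subIsetr _ `]a, b]%classic (I : set T).
  rewrite !e -(fineK (measure_subI_fin f1 mab s)) -(fineK (measure_subI_fin f2 mab s)).
  by move=> /= ->.
move=> A mA AI.
have bd (X : set T) : measurable X -> (m1 (X `&` I) < +oo)%E.
  move=> mX; apply: le_lt_trans f1; apply: le_measure => //; rewrite inE//.
  exact: measurableI.
suff : mrestr m1 mI A = mrestr m2 mI A by rewrite /mrestr (setIidl AI).
apply: (@measure_unique _ R T (@ocitv R) (fun k => `](- k%:R : R), k%:R]%classic)) => //.
- by move=> X Y mX mY; exact: (@ocitvI R).
- by move=> k; exact: is_ocitv.
- apply/seteqP; split => // x _; exists (Num.bound `|x|) => //=.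
  rewrite in_itv/=; have := archi_boundP (normr_ge0 x).
  by rewrite ltr_norml => /andP[-> /ltW].
- move=> X oX; change (m1 (X `&` I) = m2 (X `&` I)).
  case/ocitvP: oX => [->|[[a b] /= ab ->]]; first by rewrite set0I !measure0.
  by rewrite E// ltW.
- by move=> k; exact: (bd _ (measurable_itv _)).
Unshelve. all: by end_near. Qed.

(** Adding the negative part of each charge to the positive part of the other turns the claim into
    an equality of positive measures. *)
Lemma Dmeas_uniq v nu nu' : is_Dmeas v nu -> is_Dmeas v nu' ->
  forall A : set T, measurable A -> A `<=` I -> nu A = nu' A.
Proof.
move=> Hv Hv' A mA AI.
have [f1 f2 c] := charge_diff_jordan nu.
have [f1' f2' c'] := charge_diff_jordan nu'.
have := @eq_measureI (madd (jordan_pos (hahn_PN nu)) (jordan_neg (hahn_PN nu')))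
  (madd (jordan_pos (hahn_PN nu')) (jordan_neg (hahn_PN nu))) _ _ _ A mA AI.
rewrite !maddE => E; rewrite c// c'//.
move: E; set K := (forall phi, test_function _ _ phi -> _).
rewrite -(fineK (measure_subI_fin f1 mA AI)) -(fineK (measure_subI_fin f2 mA AI)).
rewrite -(fineK (measure_subI_fin f1' mA AI)) -(fineK (measure_subI_fin f2' mA AI)).
rewrite -!EFinB -!EFinD => E.
suff /(E (lte_add_pinfty f1 f2') (lte_add_pinfty f1' f2)) [h] : K.
  congr EFin; move: h; move: (fine _) (fine _) (fine _) (fine _) => r1 r2 r3 r4; lra.
move=> phi tphi; have [M hM] := tf_bounded tphi.
have mphi : measurable_fun (I : set T) phi.
  by apply: (continuous_mfun mI); exact: (tf_continuous tphi).
rewrite !(Rintegral_madd mphi (fun x _ => hM x))//.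
have := Hv _ tphi; rewrite (Hv' _ tphi) /charge_int => /oppr_inj.
move: (\int[_]_(_ in _) _) (\int[_]_(_ in _) _) (\int[_]_(_ in _) _) (\int[_]_(_ in _) _).
by move=> r1 r2 r3 r4; lra.
Qed.

Lemma DmeasP v : (exists nu, is_Dmeas v nu) -> is_Dmeas v (Dmeas v).
Proof.
by move=> h; rewrite /Dmeas; case: pselect => // h'; exact: (projT2 (cid h')).
Qed.

Lemma DmeasE v nu : is_Dmeas v nu ->
  forall A : set T, measurable A -> A `<=` I -> Dmeas v A = nu A.
Proof. by move=> Hv; apply: (Dmeas_uniq _ Hv); apply: DmeasP; exists nu. Qed.

Lemma is_DmeasD v w nu eta : (leb R).-integrable I (EFin \o v) ->
  (leb R).-integrable I (EFin \o w) -> is_Dmeas v nu -> is_Dmeas w eta ->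
  is_Dmeas (fun x => v x + w x) (cadd nu eta).
Proof.
move=> iv iw Hv Hw phi tphi; have [M hM] := tf_bounded tphi.
have [N hN] := tf_derive_bounded tphi.
have mphi : measurable_fun (I : set T) phi.
  by apply: (continuous_mfun mI); exact: (tf_continuous tphi).
have mdphi : measurable_fun (I : set T) (derive1 phi).
  by apply: (continuous_mfun mI); exact: (tf_derive_continuous tphi).
rewrite (charge_int_add _ _ mphi (fun x _ => hM x)) opprD -(Hv _ tphi) -(Hw _ tphi).
rewrite -RintegralD//; last 2 first.
- by apply: (@integrable_mul_bounded R _ _ _ _ _ _ N).
- by apply: (@integrable_mul_bounded R _ _ _ _ _ _ N).
by apply: eq_Rintegral => x _; rewrite mulrDl.
Qed.

Lemma is_DmeasN v nu : (leb R).-integrable I (EFin \o v) -> is_Dmeas v nu ->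
  is_Dmeas (fun x => - v x) (copp nu).
Proof.
move=> iv Hv phi tphi; have [M hM] := tf_bounded tphi.
have [N hN] := tf_derive_bounded tphi.
have mphi : measurable_fun (I : set T) phi.
  by apply: (continuous_mfun mI); exact: (tf_continuous tphi).
have mdphi : measurable_fun (I : set T) (derive1 phi).
  by apply: (continuous_mfun mI); exact: (tf_derive_continuous tphi).
rewrite (charge_int_opp _ mphi (fun x _ => hM x)) -(Hv _ tphi).
rewrite -mulN1r -RintegralZl//.
  by apply: eq_Rintegral => x _; rewrite mulN1r mulNr.
by apply: (@integrable_mul_bounded R _ _ _ _ _ _ N).
Qed.

Lemma integrableN v : (leb R).-integrable I (EFin \o v) ->
  (leb R).-integrable I (EFin \o (fun x => - v x)).
Proof.
move=> iv; have := integrableRZ mI (-1) iv.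
by apply: eq_integrable => // x _ /=; rewrite mulN1r.
Qed.

Lemma is_DmeasB v w nu eta : (leb R).-integrable I (EFin \o v) ->
  (leb R).-integrable I (EFin \o w) -> is_Dmeas v nu -> is_Dmeas w eta ->
  is_Dmeas (fun x => v x - w x) (cadd nu (copp eta)).
Proof.
move=> iv iw Hv Hw; apply: is_DmeasD => //; first exact: integrableN.
exact: is_DmeasN.
Qed.

End dominated_steps.

(** * Functions of bounded variation and integration by parts *)

Section ibp.
Context {R : realType}.
Local Notation T := (measurableTypeR R).
Implicit Types (nu : {charge set T -> \bar R}) (f g v w z phi : R -> R) (a b c p q x y : R).

Local Notation Pos nu := (jordan_pos (hahn_PN nu)).
Local Notation Neg nu := (jordan_neg (hahn_PN nu)).

(** The distribution function [nu(]-1, x])] for [x] in [I], encoded as an integral so that the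
    calculus of [charge_int] applies. *)
Definition cumul nu x : R := charge_int nu I (fun y => (y <= x)%R%:R).

Lemma ae_mono (P Q : R -> Prop) : (\forall x \ae leb R, P x) ->
  (forall x, P x -> Q x) -> \forall x \ae leb R, Q x.
Proof.
move=> [N [mN N0 HN]] PQ; exists N; split => // x nQ; apply: HN => Px.
by apply: nQ; exact: PQ.
Qed.

Lemma ae_and (P Q : R -> Prop) : (\forall x \ae leb R, P x) ->
  (\forall x \ae leb R, Q x) -> \forall x \ae leb R, P x /\ Q x.
Proof.
move=> [N [mN N0 HN]] [M [mM M0 HM]]; exists (N `|` M); split.
- exact: measurableU.
- by rewrite measureU0.
- move=> x nPQ; apply: contrapT => /not_orP[Nx Mx]; apply: nPQ; split.
    by apply: contrapT => nP; apply/Nx/HN.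
  by apply: contrapT => nQ; apply/Mx/HM.
Qed.

Lemma ae_ex p q (P : R -> Prop) : p < q -> (\forall x \ae leb R, P x) ->
  exists2 x, p < x < q & P x.
Proof.
move=> pq [N [mN N0 HN]]; apply: contrapT => H.
have JN : `]p, q[%classic `<=` N.
  move=> x /=; rewrite in_itv/= => xJ; apply: HN => Px; apply: H.
  by exists x.
have : (leb R `]p, q[ <= leb R N)%E.
  by apply: le_measure => //; rewrite inE//; exact: measurable_itv.
by rewrite N0 lebesgue_measure_itv/= lte_fin pq -EFinB lee_fin leNgt subr_gt0 pq.
Qed.

Lemma stepn_cst_cvg a x : stepn n a x @[n --> \oo] --> ((a < x)%R%:R : R).
Proof.
apply: (@stepn_cvg _ (fun=> a)); first exact: cvg_cst.
by move=> xa; exact: nearW.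
Qed.

Lemma lt_le_ind a b x :
  (a < x)%R%:R - (b < x)%R%:R = (x <= b)%R%:R - (x <= a)%R%:R :> R.
Proof. by rewrite !leNgt; case: (a < x); case: (b < x) => /=; ring. Qed.

Lemma integrable_le_ind (m : {measure set T -> \bar R}) (D : set T) g c :
  measurable D -> m.-integrable D (EFin \o g) ->
  m.-integrable D (EFin \o (fun x => g x * (x <= c)%R%:R)).
Proof.
move=> mD ig; apply: (@integrable_mul_bounded R _ _ _ _ _ _ 1) => //.
  exact: measurable_le_ind.
by move=> x _; case: (x <= c); rewrite ?normr1 ?normr0.
Qed.

Lemma int_lt_ind (m : {measure set T -> \bar R}) (D : set T) g a b :
  measurable D -> m.-integrable D (EFin \o g) ->
  \int[m]_(x in D) (g x * ((a < x)%R%:R - (b < x)%R%:R)) =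
  \int[m]_(x in D) (g x * (x <= b)%R%:R) - \int[m]_(x in D) (g x * (x <= a)%R%:R).
Proof.
move=> mD ig; rewrite -RintegralB//; try exact: integrable_le_ind.
by apply: eq_Rintegral => x _; rewrite lt_le_ind mulrBr.
Qed.

Lemma integrable_cst1 (m : {measure set T -> \bar R}) (D : set T) c :
  measurable D -> (m D < +oo)%E -> m.-integrable D (EFin \o (fun=> c)).
Proof.
by move=> mD moo; apply: (@bounded_integrable R _ _ _ _ _ `|c|).
Qed.

(** One Lebesgue point of [v] is fixed; the increment from it to any other Lebesgue point is the
    charge of the interval between them, with its sign. *)
Lemma BV_primitive v nu : (leb R).-integrable I (EFin \o v) -> is_Dmeas v nu ->
  exists c, \forall x \ae leb R, I x -> v x = c + cumul nu x.
Proof.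
move=> iv Hv; have Hleb := ae_lebesgue_pt iv.
have [a0 Ia0 La0] := @ae_ex (-1) 1 _ (gtrN (ltr01 : (0 : R) < 1)) Hleb.
exists (v a0 - cumul nu a0); apply: (ae_mono Hleb) => b Lb Ib.
suff : v b - v a0 = cumul nu b - cumul nu a0 by lra.
have Ib' : -1 < b < 1 by move: Ib; rewrite /Iint/= in_itv.
have [f1 f2 _] := charge_diff_jordan nu.
have i1 (m : {measure set T -> \bar R}) :
    (m I < +oo)%E -> m.-integrable (I : set T) (EFin \o (fun=> 1 : R)).
  exact: (integrable_cst1 _ mI).
pose L n := charge_int nu I (fun x => 1 * (stepn n a0 x - stepn n b x)).
apply: (@weak_increment R (-1) 1 v a0 b L) => //.
- move=> n tphi; rewrite (Hv _ tphi); congr (- charge_int _ _ _).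
  by apply/funext => x; rewrite mul1r.
- have C (m : {measure set T -> \bar R}) (moo : (m I < +oo)%E) := cvg_int_stepn mI (i1 m moo)
    (fun x _ => @stepn_cst_cvg a0 x) (fun x _ => @stepn_cst_cvg b x).
  have := cvgB (C _ f1) (C _ f2); rewrite !int_lt_ind//; try exact: i1.
  have e (m : {measure set T -> \bar R}) c : \int[m]_(x in I) (1 * (x <= c)%R%:R) = \int[m]_(x in (I : set T)) (x <= c)%R%:R :> R.
    by apply: eq_Rintegral => x _; rewrite mul1r.
  rewrite !e /cumul /charge_int.
  set A := Rintegral _ _ _; set B := Rintegral _ _ _.
  set A' := Rintegral _ _ _; set B' := Rintegral _ _ _ => H.
  have -> : A - A' - (B - B') = A - B - (A' - B') by ring.
  exact: H.
Qed.

Lemma Rintegral_split p q z y : p < y < q ->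
  (leb R).-integrable `]p, q[ (EFin \o z) ->
  \int[leb R]_(x in `[y, q[) z x =
  \int[leb R]_(x in `]p, q[) z x - \int[leb R]_(x in `]p, y]) z x.
Proof.
move=> /andP[py yq] iz.
rewrite -Rintegral_itv_obnd_cbnd; last first.
  apply: integrableS iz => // x /=; rewrite !in_itv/= => /andP[yx ->].
  by rewrite (lt_trans py yx).
by rewrite -(Rintegral_itvB iz)// bnd_simp ltW.
Qed.

Lemma primitive_bounded p q z y : p < y < q ->
  (leb R).-integrable `]p, q[ (EFin \o z) ->
  `|\int[leb R]_(x in `]p, y]) z x| <= \int[leb R]_(x in `]p, q[) `|z x|.
Proof.
move=> /andP[py yq] iz.
have s : `]p, y]%classic `<=` `]p, q[.
  by move=> x /=; rewrite !in_itv/= => /andP[-> xy]; rewrite (le_lt_trans xy yq).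
have iz' : (leb R).-integrable `]p, y] (EFin \o z) by apply: integrableS iz.
apply: le_trans (le_normr_Rintegral _ iz') _ => //.
have ia (D : set R) : (leb R).-integrable D (EFin \o z) ->
    (leb R).-integrable D (EFin \o (fun x => `|z x|)).
  by move=> iD; have := integrable_norm iD.
have := ia _ iz => /integrableP[ma aoo].
apply: fine_le.
- by apply: integrable_fin_num => //; exact: ia.
- by apply: integrable_fin_num => //; exact: ia.
- by apply: ge0_subset_integral => // x _; rewrite lee_fin.
Qed.

(** Measurability in [x] is read off from Fubini with the constant 1 as outer factor. *)
Lemma measurable_primitive p q z : (leb R).-integrable `]p, q[ (EFin \o z) ->
  measurable_fun `]p, q[ (fun x => \int[leb R]_(y in `]p, x]) z y).
Proof.
move=> iz.
have i1 : (leb R).-integrable `]p, q[ (EFin \o (fun=> 1 : R)).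
  by apply: integrable_cst1 => //; exact: itvoo_lty.
have := integrable_mfun (integrable_primitive i1 iz).
by apply: eq_measurable_fun => x _; rewrite mul1r.
Qed.

Lemma Rintegral_bigcst (m : {sigma_finite_measure set T -> \bar R}) x : x < 1 ->
  \int[m]_(y in I) (y <= x)%R%:R = \int[m]_(y in `]-1, x]) (1 : R) :> R.
Proof.
move=> x1; rewrite -(@Rintegral_le_ind R m (-1) 1 (fun=> 1) x x1).
by apply: eq_Rintegral => y _; rewrite mul1r.
Qed.

(** Integration by parts: with [G' = z] and [Dw = nu], the right-hand side is
    [G(1) w(1) - G(-1) w(-1)] minus the integral of [G] against [nu]. Here [c] is the value of [w]
    at -1 and [c + nu(I)] its value at 1, in the sense of traces. *)
Lemma BV_ibp z w nu c (g0 : R) (G : R -> R) : (leb R).-integrable I (EFin \o z) ->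
  (forall x, I x -> G x = g0 + \int[leb R]_(y in `]-1, x]) z y) ->
  measurable_fun I w -> (\forall x \ae leb R, I x -> w x = c + cumul nu x) ->
  \int[leb R]_(x in I) (z x * w x) =
  (g0 + \int[leb R]_(x in I) z x) * (c + charge_int nu I (fun=> 1)) - g0 * c
  - charge_int nu I G.
Proof.
move=> iz HG mw Hw; have [f1 f2 _] := charge_diff_jordan nu.
have i1 (m : {measure set T -> \bar R}) :
    (m I < +oo)%E -> m.-integrable (I : set T) (EFin \o (fun=> 1 : R)).
  exact: (integrable_cst1 _ mI).
have mz : measurable_fun I z := integrable_mfun iz.
have iP := integrable_primitive iz (i1 (Pos nu) f1).
have iN := integrable_primitive iz (i1 (Neg nu) f2).
have FP := fubini_primitive iz (i1 (Pos nu) f1).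
have FN := fubini_primitive iz (i1 (Neg nu) f2).
set p1 := (fun x => z x * _) in iP; set n1 := (fun x => z x * _) in iN.
set g1 := g0 + _.
have mG : measurable_fun (I : set T) G.
  have := measurable_funD (@measurable_cst _ _ _ _ (I : set T) g0) (measurable_primitive iz).
  by apply: eq_measurable_fun => x; rewrite inE => Ix /=; rewrite HG.
have bG x : I x -> `|G x| <= `|g0| + \int[leb R]_(x in I) `|z x|.
  move=> Ix; rewrite HG// (le_trans (ler_normD _ _))// lerD2l.
  by apply: primitive_bounded => //; move: Ix; rewrite /Iint/= in_itv.
(* The inner integral of [z] from [y] to 1 is [G(1) - G(y)]; this is applied to both Jordan
   parts. *)
have E (m : {measure set T -> \bar R}) : (m I < +oo)%E ->
    \int[m]_(y in I) (1 * \int[leb R]_(x in `[y, 1[) z x) =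
    g1 * \int[m]_(y in I) (1 : R) - \int[m]_(y in I) G y.
  move=> moo; have iG := bounded_integrableI mG bG moo.
  rewrite -RintegralZl//; last exact: i1.
  rewrite -RintegralB//; last exact: (integrableRZ mI _ (i1 m moo)).
  apply: eq_Rintegral => y; rewrite inE => Iy; rewrite mulr1 mul1r HG//.
  have Iy' : -1 < y < 1 by move: Iy; rewrite /Iint/= in_itv.
  rewrite (Rintegral_split Iy' iz).
  by rewrite /g1; ring.
transitivity (\int[leb R]_(x in I) (c * z x + (p1 x - n1 x))).
  have icz := integrableRZ mI c iz.
  have ipn := integrableRB mI iP iN.
  congr fine; apply: ae_eq_integral => //.
  - by apply/measurable_EFinP; exact: measurable_funM.
  - exact: measurable_int (integrableRD mI icz ipn).
  - apply: (ae_mono Hw) => x Hx Ix; rewrite Hx// /cumul /charge_int.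
    have x1 : x < 1 by move: Ix; rewrite /Iint/= in_itv/= => /andP[].
    by rewrite !Rintegral_bigcst// /p1 /n1; congr EFin; ring.
rewrite RintegralD//; [|exact: integrableRZ|exact: integrableRB].
rewrite RintegralB// RintegralZl// /p1 /n1 FP FN !E// /charge_int /g1.
ring.
Qed.

(** Continuity makes every point a Lebesgue point, so the identity holds at every [x] and not merely
    almost everywhere. *)
Lemma W_primitive p q f g : p < q -> {in `]p, q[, continuous f} ->
  (leb R).-integrable `]p, q[ (EFin \o f) -> (leb R).-integrable `]p, q[ (EFin \o g) ->
  (forall phi, test_function p q phi -> \int[leb R]_(x in `]p, q[) (f x * derive1 phi x)
    = - \int[leb R]_(x in `]p, q[) (g x * phi x)) ->
  exists c, forall x, p < x < q -> f x = c + \int[leb R]_(y in `]p, x]) g y.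
Proof.
move=> pq cf intf ig H; pose a0 := (p + q) / 2.
have pa0 : p < a0 < q by rewrite /a0; lra.
exists (f a0 - \int[leb R]_(y in `]p, a0]) g y) => b pb.
suff : f b - f a0 = \int[leb R]_(y in `]p, b]) g y - \int[leb R]_(y in `]p, a0]) g y by lra.
pose L n := \int[leb R]_(x in `]p, q[) (g x * (stepn n a0 x - stepn n b x)).
apply: (@weak_increment R p q f a0 b L) => //.
- exact: continuous_lebesgue_pt_itv.
- exact: continuous_lebesgue_pt_itv.
- by move=> n /H ->.
- have mJ : measurable (`]p, q[%classic : set T) by exact: measurable_itv.
  have := cvg_int_stepn mJ ig
    (fun x _ => @stepn_cst_cvg a0 x) (fun x _ => @stepn_cst_cvg b x).
  rewrite int_lt_ind// !Rintegral_le_ind//; first by case/andP: pa0.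
  by case/andP: pb.
Qed.

(** Converse of [W_primitive]: the constant drops out because [derive1 phi] has integral zero, and
    Fubini moves the primitive onto it. *)
Lemma AC_weak p q c f g phi : p < q -> (leb R).-integrable `]p, q[ (EFin \o g) ->
  (forall x, p < x < q -> f x = c + \int[leb R]_(y in `]p, x]) g y) ->
  test_function p q phi -> \int[leb R]_(x in `]p, q[) (f x * derive1 phi x)
    = - \int[leb R]_(x in `]p, q[) (g x * phi x).
Proof.
move=> pq ig Hf tphi.
have mJ : measurable (`]p, q[%classic : set T) by exact: measurable_itv.
have idphi : (leb R).-integrable `]p, q[ (EFin \o derive1 phi).
  apply: (@continuous_integrable _ _ p q); first exact: subset_itv_oo_cc.
  exact: (tf_derive_continuous tphi).
have ip := integrable_primitive idphi ig.
have d0 : \int[leb R]_(x in `]p, q[) derive1 phi x = 0.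
  have [a [b [pa bq phi0 dphi0]]] := tf_derive0 tphi.
  rewrite Rintegral_itv_bndo_bndc// Rintegral_itv_obnd_cbnd; last first.
    apply: (@continuous_integrable _ _ p q); first exact: subset_itv_oc_cc.
    exact: (tf_derive_continuous tphi).
  rewrite Rintegral_FTC//; [|exact: (tf_derivable tphi)|exact: (tf_derive_continuous tphi)].
  by rewrite !phi0 ?subrr// in_itv/= negb_and -!ltNge ?pa ?bq ?orbT.
transitivity (\int[leb R]_(x in `]p, q[) (c * derive1 phi x +
    derive1 phi x * \int[leb R]_(y in `]p, x]) g y)).
  apply: eq_Rintegral => x; rewrite inE/= in_itv/= => px; rewrite Hf//; ring.
rewrite RintegralD//; last exact: (integrableRZ mJ).
rewrite RintegralZl// d0 mulr0 add0r (fubini_primitive idphi ig).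
rewrite -mulN1r -RintegralZl//; last first.
  have [M hM] := tf_bounded tphi.
  apply: (@integrable_mul_bounded R _ _ _ _ _ _ M) => //.
  by apply: (continuous_mfun mJ); exact: (tf_continuous tphi).
apply: eq_Rintegral => y; rewrite inE/= in_itv/= => py.
by rewrite (tf_FTC tphi py); ring.
Qed.

End ibp.

(** * The scalar product of L2 *)

Section L2.
Context {R : realType}.
Local Notation T := (measurableTypeR R).
Implicit Types (f g h v w z chi phi : R -> R) (a b c p q x y : R).

Definition ip f g : R := \int[leb R]_(x in I) (f x * g x).

Lemma L2_mfun f : L2_I f -> measurable_fun (I : set T) f.
Proof. by case. Qed.

Lemma sqr_mule_le (s t : R) : `|s * t| <= s ^+ 2 + t ^+ 2.
Proof.
rewrite normrM -(real_normK (num_real s)) -(real_normK (num_real t)).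
have := sqr_ge0 (`|s| - `|t|); have := sqr_ge0 (`|s| + `|t|).
have := normr_ge0 s; have := normr_ge0 t; nra.
Qed.

Lemma L2_sqr f : L2_I f -> (leb R).-integrable (I : set T) (EFin \o (fun x => f x ^+ 2)).
Proof.
move=> [mf foo]; apply/integrableP; split.
  by apply/measurable_EFinP; exact: measurable_funX.
apply: le_lt_trans foo; rewrite le_eqVlt; apply/orP; left; apply/eqP.
by apply: eq_integral => x _ /=; rewrite ger0_norm ?sqr_ge0.
Qed.

Lemma L2_mul f g : L2_I f -> L2_I g ->
  (leb R).-integrable (I : set T) (EFin \o (fun x => f x * g x)).
Proof.
move=> Lf Lg; apply: (@le_integrable _ _ _ _ _ mI _ (EFin \o (fun x => f x ^+ 2 + g x ^+ 2))).
- apply/measurable_EFinP; apply: measurable_funM; exact: L2_mfun.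
- move=> x _ /=; rewrite lee_fin (le_trans (sqr_mule_le _ _))//.
  by rewrite ger0_norm// addr_ge0// sqr_ge0.
- by apply: (integrableRD mI); exact: L2_sqr.
Qed.

Lemma bounded_L2 f (M : R) : measurable_fun (I : set T) f ->
  (forall x, I x -> `|f x| <= M) -> L2_I f.
Proof.
move=> mf fM; split=> //.
have := @bounded_integrable R _ T (leb R) I (fun x => f x ^+ 2) (M ^+ 2) mI leI_lty.
move=> H; have /integrableP[_] : (leb R).-integrable (I : set T) (EFin \o (fun x => f x ^+ 2)).
  apply: H; first exact: measurable_funX.
  move=> x Ix; rewrite normrX ler_pXn2r ?nnegrE//; first exact: fM.
  by rewrite (le_trans _ (fM x Ix)).
apply: le_lt_trans; rewrite le_eqVlt; apply/orP; left; apply/eqP.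
by apply: eq_integral => x _ /=; rewrite ger0_norm ?sqr_ge0.
Qed.

Lemma L2_cst c : L2_I (fun=> c).
Proof. by apply: (@bounded_L2 _ `|c|) => //; exact: measurable_cst. Qed.

Lemma L2_int f : L2_I f -> (leb R).-integrable (I : set T) (EFin \o f).
Proof.
move=> Lf; have := L2_mul Lf (L2_cst 1).
by apply: eq_integrable => // x _ /=; rewrite mulr1.
Qed.

Lemma L2_ipE f : L2_I f -> (\int[leb R]_(x in I) ((f x) ^+ 2)%:E = (ip f f)%:E)%E.
Proof.
move=> Lf; rewrite /ip /Rintegral fineK; last first.
  by apply: integrable_fin_num => //; exact: L2_mul.
by apply: eq_integral => x _; rewrite expr2.
Qed.

Lemma L2_Z f c : L2_I f -> L2_I (fun x => c * f x).
Proof.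
move=> Lf; split.
  apply: measurable_funM; [exact: measurable_cst|exact: L2_mfun].
have /integrableP[_] := integrableRZ mI (c ^+ 2) (L2_sqr Lf).
apply: le_lt_trans; rewrite le_eqVlt; apply/orP; left; apply/eqP.
by apply: eq_integral => x _ /=; congr EFin; rewrite exprMn ger0_norm// mulr_ge0// sqr_ge0.
Qed.

Lemma L2_D f g : L2_I f -> L2_I g -> L2_I (fun x => f x + g x).
Proof.
move=> Lf Lg; split; first by apply: measurable_funD; exact: L2_mfun.
have /integrableP[_] := integrableRZ mI 2 (integrableRD mI (L2_sqr Lf) (L2_sqr Lg)).
apply: le_lt_trans; apply: ge0_le_integral => //.
- by move=> x _; rewrite lee_fin sqr_ge0.
- apply/measurable_EFinP; apply: measurable_funX; apply: measurable_funD; exact: L2_mfun.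
- apply: measurableT_comp => //; apply/measurable_EFinP.
  apply: measurable_funM; first exact: measurable_cst.
  by apply: measurable_funD; apply: measurable_funX; exact: L2_mfun.
- move=> x _ /=; rewrite lee_fin ger0_norm; last by rewrite mulr_ge0// addr_ge0// sqr_ge0.
  by have := sqr_ge0 (f x - g x); nra.
Qed.

Lemma L2_B f g : L2_I f -> L2_I g -> L2_I (fun x => f x - g x).
Proof.
move=> Lf /(L2_Z (-1)) Lg; have := L2_D Lf Lg.
by congr L2_I; apply/funext => x; rewrite mulN1r.
Qed.

Lemma ipC f g : ip f g = ip g f.
Proof. by apply: eq_Rintegral => x _; rewrite mulrC. Qed.

Lemma ipBl f g h : L2_I f -> L2_I g -> L2_I h ->
  ip (fun x => f x - g x) h = ip f h - ip g h.
Proof.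
move=> Lf Lg Lh; rewrite /ip -RintegralB//; [|exact: L2_mul|exact: L2_mul].
by apply: eq_Rintegral => x _; rewrite mulrBl.
Qed.

Lemma ipBr f g h : L2_I f -> L2_I g -> L2_I h ->
  ip h (fun x => f x - g x) = ip h f - ip h g.
Proof. by move=> Lf Lg Lh; rewrite ipC ipBl// !(ipC h). Qed.

Lemma ip_ge0 f : 0 <= ip f f.
Proof. by apply: Rintegral_ge0 => x _; rewrite -expr2 sqr_ge0. Qed.

Lemma ipZl f g c : L2_I f -> L2_I g -> ip (fun x => c * f x) g = c * ip f g.
Proof.
move=> Lf Lg; rewrite /ip -RintegralZl//; last exact: L2_mul.
by apply: eq_Rintegral => x _; rewrite mulrA.
Qed.

Lemma ip_young f g : L2_I f -> L2_I g -> 2 * ip f g <= ip f f + ip g g.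
Proof.
move=> Lf Lg; have := ip_ge0 (fun x => f x - g x).
have LB := L2_B Lf Lg.
by rewrite ipBl// !ipBr// (ipC g f); lra.
Qed.

(** A weighted Young inequality, used throughout in place of Cauchy-Schwarz: the weight is tuned to
    the smallness at hand and no square root appears. *)
Lemma ip_abs f g (e : R) : 0 < e -> L2_I f -> L2_I g ->
  `|ip f g| <= e * ip f f + e^-1 * ip g g.
Proof.
move=> e0 Lf Lg; have en : e != 0 by rewrite gt_eqF.
have H k : L2_I (fun x => k * f x) by exact: L2_Z.
(* The signs [k = 1] and [k = -1] give the two halves of the absolute value. *)
have Y (k : R) : k ^+ 2 = 1 -> 2 * (k * ip f g) <= e * ip f f + e^-1 * ip g g.
  move=> k2; have := ip_young (H (k * e)) Lg.
  have -> : ip (fun x => k * e * f x) (fun x => k * e * f x) =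
    k * e * (k * e * ip f f) by rewrite ipZl// ipC ipZl.
  rewrite ipZl// => Y1.
  rewrite -(ler_pM2l e0); move: Y1.
  have -> : k * e * (k * e * ip f f) = k ^+ 2 * (e * (e * ip f f)) by ring.
  have -> : e * (e * ip f f + e^-1 * ip g g) = e * (e * ip f f) + (e * e^-1) * ip g g by ring.
  by rewrite k2 mul1r mulfV// mul1r; congr (_ <= _); ring.
have m1 : (-1 : R) ^+ 2 = 1 by rewrite sqrrN expr1n.
have := Y 1 (expr1n _ _); have := Y (-1) m1.
rewrite ler_norml mul1r mulN1r => h1 h2.
have p1 : 0 <= e * ip f f by rewrite mulr_ge0 ?ip_ge0// ltW.
have p2 : 0 <= e^-1 * ip g g by rewrite mulr_ge0 ?ip_ge0// invr_ge0 ltW.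
by apply/andP; split; lra.
Qed.

Lemma ip0_ae f : L2_I f -> ip f f = 0 -> \forall x \ae leb R, I x -> f x = 0.
Proof.
move=> Lf f0; have := L2_ipE Lf; rewrite f0 => E.
have mf2 : measurable_fun (I : set T) (EFin \o (fun x => f x ^+ 2)).
  by apply/measurable_EFinP; apply: measurable_funX; exact: L2_mfun.
have [+ _] := ae_eq_integral_abs (leb R) mI mf2.
rewrite (_ : (\int[leb R]_(x in I) _)%E = 0%E); last first.
  by apply: etrans E; apply: eq_integral => x _ /=; rewrite ger0_norm ?sqr_ge0.
move=> /(_ erefl) H; apply: (ae_mono H) => x /= + Ix => /(_ Ix)[] /eqP.
by rewrite sqrf_eq0 => /eqP.
Qed.

Lemma Rintegral_ae_eq d (X : measurableType d) (m : {measure set X -> \bar R})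
    (D : set X) (F G : X -> R) : measurable D ->
  m.-integrable D (EFin \o F) -> m.-integrable D (EFin \o G) ->
  (\forall x \ae m, D x -> F x = G x) ->
  \int[m]_(x in D) F x = \int[m]_(x in D) G x.
Proof.
move=> mD iF iG FG; congr fine; apply: ae_eq_integral => //.
- exact: measurable_int iF.
- exact: measurable_int iG.
- by apply: filterS FG => x h Dx /=; rewrite h.
Qed.

Lemma Rintegral_ae_le (D : set T) (F G : R -> R) : measurable D ->
  (leb R).-integrable D (EFin \o F) -> (leb R).-integrable D (EFin \o G) ->
  (\forall x \ae leb R, D x -> F x <= G x) ->
  \int[leb R]_(x in D) F x <= \int[leb R]_(x in D) G x.
Proof.
move=> mD iF iG FG.
have mF := integrable_mfun iF; have mG := integrable_mfun iG.
(* The minimum lies below [G] everywhere and equals [F] almost everywhere. *)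
pose K x := Num.min (F x) (G x).
have iK : (leb R).-integrable D (EFin \o K).
  apply: (@le_integrable _ _ _ _ _ mD _ (EFin \o (fun x => `|F x| + `|G x|))).
  - by apply/measurable_EFinP; exact: measurable_minr.
  - move=> x _ /=; rewrite lee_fin [leRHS]ger0_norm ?addr_ge0// /K /Num.min.
    by case: ifP => _; rewrite ?lerDl ?lerDr.
  - by apply: (integrableRD mD); exact: integrable_norm.
rewrite (@Rintegral_ae_eq _ _ _ D F K)//.
  by apply: le_Rintegral => // x _; rewrite /K ge_min lexx orbT.
by apply: (ae_mono FG) => x h Dx; rewrite /K min_l// h.
Qed.

End L2.

(** * Weak derivatives in time *)

Section time.
Context {R : realType}.
Local Notation T := (measurableTypeR R).
Implicit Types (f g h chi phi psi : R -> R) (u v w z : R -> R -> R) (a b c t s x y : R).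

Lemma C_L2_eps (S : R) u s (e : R) : C_L2 S u -> 0 <= s <= S -> 0 < e ->
  exists2 d : R, 0 < d & forall t, 0 <= t <= S -> `|s - t| < d ->
    ip (fun x => u t x - u s x) (fun x => u t x - u s x) < e.
Proof.
move=> [L2u Cu] sS e0.
have := Cu s sS [set y | (y < e%:E)%E].
have : nbhs (0%:E : \bar R) [set y | (y < e%:E)%E].
  exists e => //= y /=; rewrite sub0r normrN => h.
  by rewrite lte_fin (le_lt_trans (ler_norm _) h).
move=> h /(_ h) [d /= d0 H]; exists d => // t tS st.
have := H t st; rewrite /= in_itv/= => /(_ tS).
by rewrite L2_ipE ?lte_fin//; apply: L2_B; exact: L2u.
Qed.

(** The squared norm is a continuous function of time on a compact interval, so it attains a
    maximum. *)
Lemma C_L2_bounded (S : R) u : 0 < S -> C_L2 S u ->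
  exists M : R, forall t, 0 <= t <= S -> ip (u t) (u t) <= M.
Proof.
move=> S0 Cu; have [L2u _] := Cu.
pose E t := ip (u t) (u t).
suff cE : {within `[0, S], continuous E}.
  have [c _ H] := EVT_max (ltW S0) cE; exists (E c) => t tS.
  by apply: H; rewrite in_itv.
apply/subspace_continuousP => s /=; rewrite in_itv/= => sS.
apply/cvgrPdist_le => e e0.
have Es0 : 0 <= E s by exact: ip_ge0.
(* With [w = u t - u s], the change of the squared norm is at most [(1 + 2k) |w|^2 + 2 |u s|^2 / k].
   This [k] makes the last term at most [e / 2], and [t] close to [s] handles the other; the [+ 1]
   keeps [k] positive. *)
pose k := 4 * (E s + 1) / e.
have k0 : 0 < k by rewrite divr_gt0// mulr_gt0//; lra.
have kE : k^-1 * E s <= e / 4.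
  rewrite /k; rewrite [leLHS](_ : _ = (e / 4) * (E s / (E s + 1))); last first.
    by field; rewrite !gt_eqF//; lra.
  by rewrite ger_pMr ?divr_gt0// ler_pdivrMr; lra.
have k1 : 0 < 1 + 2 * k by lra.
have [d d0 H] := C_L2_eps Cu sS (divr_gt0 (divr_gt0 e0 (ltr0n R 2)) k1).
exists d => //= t /= st; rewrite in_itv/= => tS.
have := H t tS st; set w := (fun x => _) => D.
have Lt := L2u t tS; have Ls := L2u s sS; have Lw : L2_I w := L2_B Lt Ls.
have -> : E s - E t = - (ip w w + 2 * ip w (u s)).
  by rewrite /E /w !ipBl// !ipBr// (ipC (u s) (u t)); ring.
rewrite normrN (le_trans (ler_normD _ _))// ger0_norm ?ip_ge0// normrM ger0_norm//.
have Y := ip_abs k0 Lw Ls.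
have D' : ip w w * (1 + 2 * k) < e / 2 by rewrite -ltr_pdivlMr.
move: Y D' kE; rewrite -/(E s).
move: (ip w w) (`|ip w (u s)|) (k^-1 * E s) => r1 r2 r3 Y D' kE; nra.
Qed.

Lemma C_L2_ip_continuous (S : R) u chi : C_L2 S u -> L2_I chi ->
  {in `]0, S[, continuous (fun t => ip (u t) chi)}.
Proof.
move=> Cu Lc s; rewrite in_itv/= => /andP[s0 sS]; have [L2u _] := Cu.
have sS' : 0 <= s <= S by rewrite !ltW.
apply/cvgrPdist_le => e e0.
have X0 : 0 <= ip chi chi by exact: ip_ge0.
pose k := 2 * (ip chi chi + 1) / e.
have k0 : 0 < k by rewrite divr_gt0// mulr_gt0//; lra.
have kE : k^-1 * ip chi chi <= e / 2.
  rewrite /k; rewrite [leLHS](_ : _ = (e / 2) * (ip chi chi / (ip chi chi + 1))); last first.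
    by field; rewrite !gt_eqF//; lra.
  by rewrite ger_pMr ?divr_gt0// ler_pdivrMr; lra.
have [d d0 H] := C_L2_eps Cu sS' (divr_gt0 (divr_gt0 e0 (ltr0n R 2)) k0).
near=> t.
have tS : 0 <= t <= S.
  apply/andP; split; apply: ltW; near: t; [exact: lt_nbhsr|exact: lt_nbhsl].
have st : `|s - t| < d by near: t; exists d.
have := H t tS st; set w := (fun x => _) => D.
have Lt := L2u t tS; have Ls := L2u s sS'; have Lw : L2_I w := L2_B Lt Ls.
have -> : ip (u s) chi - ip (u t) chi = - ip w chi by rewrite /w ipBl//; ring.
rewrite normrN (le_trans (ip_abs k0 Lw Lc))//.
have D' : k * ip w w < e / 2 by rewrite mulrC -ltr_pdivlMr.
lra.
Unshelve. all: by end_near. Qed.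

Local Notation J S := (`]0, S[%classic : set T).

Lemma mJ (S : R) : measurable (J S).
Proof. exact: measurable_itv. Qed.

Lemma measurable_sndI (S : R) chi : measurable_fun (I : set T) chi ->
  measurable_fun (J S `*` (I : set T)) (fun p : T * T => chi p.2).
Proof.
move=> mchi; apply: (@measurable_comp _ _ _ _ _ _ (I : set T) chi _ (@snd T T)) => //.
  by move=> _ [[a b] [/= ? ?] <-].
exact: measurable_funTS.
Qed.

Lemma measurable_fstJ (S : R) psi : measurable_fun (J S) psi ->
  measurable_fun (J S `*` (I : set T)) (fun p : T * T => psi p.1).
Proof.
move=> mpsi; apply: (@measurable_comp _ _ _ _ _ _ (J S) psi _ (@fst T T)) => //.
- by move=> _ [[a b] [/= ? ?] <-].
- exact: measurable_funTS.
Qed.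

Lemma L2Q_mfun (S : R) z t : L2_Q S z -> 0 < t < S -> measurable_fun (I : set T) (z t).
Proof.
move=> [mz _] tS; apply: (@measurable_section1 _ _ T T R (J S) I z) => //.
Qed.

Lemma L2Q_sqr_lty (S : R) z : L2_Q S z ->
  measurable_fun (J S `*` (I : set T)) (fun p : T * T => z p.1 p.2 ^+ 2) /\
  (\int[leb R]_(t in J S) \int[leb R]_(x in I) `|(z t x ^+ 2)%:E| < +oo)%E.
Proof.
move=> [mz zoo]; split; first exact: measurable_funX.
apply: le_lt_trans zoo; rewrite le_eqVlt; apply/orP; left; apply/eqP.
apply: eq_integral => t _; apply: eq_integral => x _.
by rewrite gee0_abs// lee_fin sqr_ge0.
Qed.

Lemma L2Q_ae (S : R) z : L2_Q S z -> \forall t \ae leb R, 0 < t < S -> L2_I (z t).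
Proof.
move=> Lz; have [m2 loo] := L2Q_sqr_lty Lz.
apply: (ae_mono (Rfubini_ae1 (mJ S) mI m2 loo)) => t H tS.
split; first exact: L2Q_mfun tS.
have /integrableP[_] := H (ltac:(by rewrite /= in_itv)).
apply: le_lt_trans; rewrite le_eqVlt; apply/orP; left; apply/eqP.
by apply: eq_integral => x _ /=; rewrite ger0_norm ?sqr_ge0.
Qed.

Lemma L2Q_norm_integrable (S : R) z : L2_Q S z ->
  (leb R).-integrable (J S) (EFin \o (fun t => ip (z t) (z t))).
Proof.
move=> Lz; have [m2 loo] := L2Q_sqr_lty Lz.
have := Rintegrable_fubini1 (mJ S) mI m2 loo.
by apply: eq_integrable => [|t _]; [exact: mJ|congr EFin; apply: eq_Rintegral => x _; rewrite expr2].
Qed.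

(** The integrand is at most [N (z^2 + chi^2)] in absolute value; this is the summability under
    which Fubini is used. *)
Lemma L2Q_lty (S : R) z chi psi (N : R) : L2_Q S z -> L2_I chi ->
  measurable_fun (J S) psi -> (forall t, J S t -> `|psi t| <= N) ->
  measurable_fun (J S `*` (I : set T)) (fun p : T * T => z p.1 p.2 * chi p.2 * psi p.1) /\
  (\int[leb R]_(t in J S) \int[leb R]_(x in I) `|(z t x * chi x * psi t)%:E| < +oo)%E.
Proof.
move=> Lz Lc mpsi bpsi; have [m2 loo] := L2Q_sqr_lty Lz; have [mz _] := Lz.
have mG : measurable_fun (J S `*` (I : set T))
    (fun p : T * T => z p.1 p.2 * chi p.2 * psi p.1).
  apply: measurable_funM; last exact: measurable_fstJ.
  by apply: measurable_funM => //; apply: measurable_sndI; exact: L2_mfun.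
split; first exact: mG.
have [S0|S0] := leP S 0.
  by rewrite set_itv_ge ?integral_set0// bnd_simp -leNgt.
have N0 : 0 <= N.
  apply: le_trans (bpsi (S / 2) _); first exact: normr_ge0.
  by rewrite /= in_itv/=; lra.
pose X := ip chi chi.
have X0 : 0 <= X by exact: ip_ge0.
have mK : measurable_fun (J S) (fun t => \int[leb R]_(x in I) `|(z t x ^+ 2)%:E|)%E.
  exact: (measurable_integral_abs (leb R) (mJ S) mI m2).
pose K t : \bar R := ((\int[leb R]_(x in I) `|(z t x ^+ 2)%:E|) + X%:E)%E.
have mK' : measurable_fun (J S) K by apply: emeasurable_funD.
have K0 t : J S t -> (0 <= K t)%E by move=> _; rewrite adde_ge0// integral_ge0.
apply: (@le_lt_trans _ _ (\int[leb R]_(t in J S) (N%:E * K t))%E); last first.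
  rewrite ge0_integralZl//.
  apply: lte_mul_pinfty; [by rewrite lee_fin|by []|].
  have K1 t : J S t -> (0 <= \int[leb R]_(x in I) `|(z t x ^+ 2)%:E|)%E.
    by move=> _; exact: integral_ge0.
  rewrite ge0_integralD//.
  rewrite lte_add_pinfty// integral_cst//.
  by rewrite lte_mul_pinfty// ?lee_fin//; exact: itvoo_lty.
apply: ge0_le_integral => //.
- by move=> t _; exact: integral_ge0.
- exact: (measurable_integral_abs (leb R) (mJ S) mI mG).
- by apply: emeasurable_funM.
- move=> t tS; have tS' : 0 < t < S by move: tS; rewrite /= in_itv.
  have mzt := L2Q_mfun Lz tS'.
  have mz2 : measurable_fun (I : set T) (fun x => `|(z t x ^+ 2)%:E|%E).
    by apply: measurableT_comp => //; apply/measurable_EFinP; exact: measurable_funX.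
  have mc2 : measurable_fun (I : set T) (fun x => (chi x ^+ 2)%:E : \bar R).
    by apply/measurable_EFinP; apply: measurable_funX; exact: L2_mfun.
  rewrite /K /X -(L2_ipE Lc) -ge0_integralD//; last by move=> x _; rewrite lee_fin sqr_ge0.
  have m2' := emeasurable_funD mz2 mc2.
  rewrite -ge0_integralZl//; last by move=> x _; rewrite adde_ge0// lee_fin sqr_ge0.
  apply: ge0_le_integral => //.
  + apply: measurableT_comp => //; apply/measurable_EFinP.
    apply: measurable_funM; last exact: measurable_cst.
    by apply: measurable_funM => //; exact: L2_mfun.
  + apply: emeasurable_funM; first exact: measurable_cst.
    exact: emeasurable_funD.
  + move=> x _; rewrite !abse_EFin -EFinD -EFinM lee_fin normrM mulrC.
    apply: ler_pM => //; first exact: bpsi.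
    by rewrite (ger0_norm (sqr_ge0 _)) sqr_mule_le.
Qed.

Lemma L2Q_ip_integrable (S : R) z chi : L2_Q S z -> L2_I chi ->
  (leb R).-integrable (J S) (EFin \o (fun t => ip (z t) chi)).
Proof.
move=> Lz Lc.
have [mG Goo] := @L2Q_lty S z chi (fun=> 1) 1 Lz Lc (@measurable_cst _ _ _ _ _ _)
  (fun t _ => ltac:(by rewrite normr1)).
have := Rintegrable_fubini1 (mJ S) mI mG Goo.
by apply: eq_integrable => [|t _]; [exact: mJ|congr EFin; apply: eq_Rintegral => x _; rewrite mulr1].
Qed.

Lemma C_L2_L2Q (S : R) u : 0 < S -> meas_Q S u -> C_L2 S u -> L2_Q S u.
Proof.
move=> S0 mu Cu; split=> //; have [M HM] := C_L2_bounded S0 Cu.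
have [L2u _] := Cu.
have m2 : measurable_fun (J S `*` (I : set T)) (fun p : T * T => u p.1 p.2 ^+ 2).
  exact: measurable_funX.
have M0 : 0 <= M by apply: le_trans (HM 0 _); [exact: ip_ge0|rewrite lexx ltW].
apply: (@le_lt_trans _ _ (\int[leb R]_(t in J S) M%:E)%E); last first.
  rewrite integral_cst//.
  by rewrite lte_mul_pinfty// ?lee_fin//; exact: itvoo_lty.
apply: ge0_le_integral => //.
- by move=> t _; apply: integral_ge0 => x _; rewrite lee_fin sqr_ge0.
- have := @measurable_integral_abs _ _ T T R (leb R) (J S) I (fun t x => u t x ^+ 2) (mJ S) mI m2.
  apply: eq_measurable_fun => t _; apply: eq_integral => x _.
  by rewrite gee0_abs// lee_fin sqr_ge0.
- by move=> t; rewrite /= in_itv/= => /andP[t0 tS]; rewrite L2_ipE ?lee_fin;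
    [apply: HM|apply: L2u]; rewrite !ltW.
Qed.

(** [time_deriv] is an identity in [t] for almost every [x]. Multiplying by [chi x], integrating in
    [x] and exchanging the integrals turns it into a scalar identity in time. *)
Lemma weak_time_ip (S : R) u ut chi phi : 0 < S -> meas_Q S u -> C_L2 S u ->
  L2_Q S ut -> time_deriv S u ut -> L2_I chi -> test_function 0 S phi ->
  \int[leb R]_(t in `]0, S[) (ip (u t) chi * derive1 phi t) =
  - \int[leb R]_(t in `]0, S[) (ip (ut t) chi * phi t).
Proof.
move=> S0 mu Cu Lut Hut Lc tphi; have Lu := C_L2_L2Q S0 mu Cu; have [L2u _] := Cu.
have [M hM] := tf_bounded tphi; have [N hN] := tf_derive_bounded tphi.
have mphi : measurable_fun (J S) phi.
  by apply: (continuous_mfun (mJ S)); exact: (tf_continuous tphi).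
have mdphi : measurable_fun (J S) (derive1 phi).
  by apply: (continuous_mfun (mJ S)); exact: (tf_derive_continuous tphi).
have [mA Aoo] := L2Q_lty Lu Lc mdphi (fun t _ => hN t).
have [mB Boo] := L2Q_lty Lut Lc mphi (fun t _ => hM t).
(* The case [chi = 1] gives integrability in time for almost every [x], which allows the factor
   [chi x] to be pulled out. *)
have [mA1 A1oo] := L2Q_lty Lu (L2_cst 1) mdphi (fun t _ => hN t).
have [mB1 B1oo] := L2Q_lty Lut (L2_cst 1) mphi (fun t _ => hM t).
transitivity (\int[leb R]_(t in J S) \int[leb R]_(x in I) (u t x * chi x * derive1 phi t)).
  apply: eq_Rintegral => t; rewrite inE/= in_itv/= => /andP[t0 tS].
  by rewrite /ip -RintegralZr//; apply: L2_mul => //; apply: L2u; rewrite !ltW.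
rewrite (Rfubini (mJ S) mI mA Aoo).
transitivity (\int[leb R]_(x in I) (- 1 * \int[leb R]_(t in J S) (ut t x * chi x * phi t))).
  apply: Rintegral_ae_eq => //.
  - exact: (Rintegrable_fubini2 (mJ S) mI mA Aoo).
  - by apply: (integrableRZ mI); exact: (Rintegrable_fubini2 (mJ S) mI mB Boo).
  - have := ae_and (Hut _ tphi) (ae_and (Rfubini_ae2 (mJ S) mI mA1 A1oo)
      (Rfubini_ae2 (mJ S) mI mB1 B1oo)).
    move=> H; apply: (ae_mono H) => x [H1 [H2 H3]] Ix.
    have {}H2 : (leb R).-integrable (J S) (EFin \o (fun t => u t x * derive1 phi t)).
      by have := H2 Ix; apply: eq_integrable => [|t _]; [exact: mJ|rewrite /= mulr1].
    have {}H3 : (leb R).-integrable (J S) (EFin \o (fun t => ut t x * phi t)).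
      by have := H3 Ix; apply: eq_integrable => [|t _]; [exact: mJ|rewrite /= mulr1].
    transitivity (chi x * \int[leb R]_(t in J S) (u t x * derive1 phi t)).
      rewrite -RintegralZl//.
      by apply: eq_Rintegral => t _; ring.
    rewrite (H1 Ix) mulN1r mulrN; congr (- _).
    rewrite -RintegralZl//.
    by apply: eq_Rintegral => t _; ring.
rewrite RintegralZl//; last exact: (Rintegrable_fubini2 (mJ S) mI mB Boo).
rewrite mulN1r -(Rfubini (mJ S) mI mB Boo); congr (- _).
apply: Rintegral_ae_eq => //.
- exact: (Rintegrable_fubini1 (mJ S) mI mB Boo).
- apply: (@integrable_mul_bounded R _ _ _ _ _ _ M) => //.
  exact: L2Q_ip_integrable.
- apply: (ae_mono (L2Q_ae Lut)) => t H; rewrite /= in_itv/= => tS.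
  by rewrite /ip -RintegralZr//; apply: L2_mul => //; exact: H.
Qed.

(** The scalar function [ip (u t) chi] is continuous in [t], so the identity holds at every time;
    the energy estimate evaluates it at prescribed times. *)
Lemma time_ip (S : R) u ut chi : 0 < S -> meas_Q S u -> C_L2 S u ->
  L2_Q S ut -> time_deriv S u ut -> L2_I chi ->
  exists c, forall t, 0 < t < S ->
    ip (u t) chi = c + \int[leb R]_(r in `]0, t]) ip (ut r) chi.
Proof.
move=> S0 mu Cu Lut Hut Lc; apply: W_primitive => //.
- exact: C_L2_ip_continuous.
- exact: L2Q_ip_integrable (C_L2_L2Q S0 mu Cu) Lc.
- exact: L2Q_ip_integrable.
- by move=> phi tphi; exact: weak_time_ip.
Qed.

End time.

(** * Monotonicity of the energy *)

Section energy.
Context {R : realType}.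
Local Notation T := (measurableTypeR R).
Implicit Types (f g h chi phi psi : R -> R) (u v w z : R -> R -> R) (a b c t s x y : R).

Lemma Rintegral_itv_add S g a b : 0 < a -> a <= b -> b < S ->
  (leb R).-integrable `]0, S[ (EFin \o g) ->
  \int[leb R]_(r in `]0, b]) g r - \int[leb R]_(r in `]0, a]) g r =
  \int[leb R]_(r in `]a, b]) g r.
Proof.
move=> a0 ab bS ig.
have ig' : (leb R).-integrable `]0, b] (EFin \o g).
  by apply: integrableS ig => // x /=; rewrite !in_itv/= => /andP[-> xb]; rewrite (le_lt_trans xb bS).
by rewrite (Rintegral_itvB ig')// bnd_simp// ltW.
Qed.

Lemma integrable_sub S g a b : 0 < a -> b < S ->
  (leb R).-integrable `]0, S[ (EFin \o g) ->
  (leb R).-integrable `]a, b] (EFin \o g).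
Proof.
move=> a0 bS; apply: integrableS => // x /=; rewrite !in_itv/= => /andP[ax xb].
by rewrite (lt_trans a0 ax) (le_lt_trans xb bS).
Qed.

Lemma Rintegral_itv_cst c a b : a <= b -> \int[leb R]_(r in `]a, b]) c = c * (b - a).
Proof.
move=> ab; rewrite Rintegral_cst//; congr (_ * _).
have /= := @lebesgue_measure_itv R `]a, b]; rewrite lte_fin => E.
apply: (etrans (congr1 fine E)); have [_|ba] := ltP a b => //=.
by have -> : b = a by [apply/eqP; rewrite eq_le ba ab]; rewrite subrr.
Qed.

Section nonincreasing.
Variables (S : R) (w z : R -> R -> R).
Hypothesis Lw : forall t, 0 < t < S -> L2_I (w t).
Hypothesis Lz : L2_Q S z.
Hypothesis wz : forall chi, L2_I chi -> exists c, forall t, 0 < t < S ->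
  ip (w t) chi = c + \int[leb R]_(r in `]0, t]) ip (z r) chi.
Hypothesis wz_le0 : \forall t \ae leb R, 0 < t < S -> ip (w t) (z t) <= 0.

Let n r := ip (z r) (z r).

Let in_n : (leb R).-integrable `]0, S[ (EFin \o n).
Proof. exact: L2Q_norm_integrable. Qed.

Lemma ip_increment chi a b : L2_I chi -> 0 < a -> a <= b -> b < S ->
  ip (w b) chi - ip (w a) chi = \int[leb R]_(r in `]a, b]) ip (z r) chi.
Proof.
move=> Lc a0 ab bS; have [c H] := wz Lc.
rewrite !H ?(lt_le_trans a0 ab)// ?a0 ?(le_lt_trans ab bS)//.
rewrite -(Rintegral_itv_add a0 ab bS); last exact: L2Q_ip_integrable.
by ring.
Qed.

(** First [|w b|^2 - |w a|^2 <= 2 <w b - w a, w b>], which is twice the integral over [s] of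
    [<z s, w b>]. For almost every [s] one has [<z s, w b> = <z s, w s> + <z s, w b - w s>]: the
    first term is nonpositive, and the second is an integral of [<z s, z r>], bounded by Young. *)
Lemma energy_step a b : 0 < a -> a <= b -> b < S ->
  ip (w b) (w b) - ip (w a) (w a) <=
  2 * (b - a) * \int[leb R]_(r in `]a, b]) n r.
Proof.
have fin (X Y m p q : R) : p * m <= q * m -> X <= Y ->
    2^-1 * X + 2^-1 * (m * p) <= 2^-1 * Y + 2^-1 * q * m by lra.
move=> a0 ab bS.
have aS := le_lt_trans ab bS; have b0 := lt_le_trans a0 ab.
have Lb : L2_I (w b) by apply: Lw; rewrite b0 bS.
have La : L2_I (w a) by apply: Lw; rewrite a0 aS.
set Z := \int[leb R]_(r in _) _.
have in_ab : (leb R).-integrable `]a, b] (EFin \o n) := integrable_sub a0 bS in_n.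
have ab_fin : (leb R `]a, b] < +oo)%E.
  by apply: (@itv_lt_pinfty _ _ a b); exact: subset_itv_oc_cc.
have icst (c : R) : (leb R).-integrable `]a, b] (EFin \o (fun=> c)).
  exact: integrable_cst1.
(* The difference of the two sides is [|w b - w a|^2]. *)
have step1 : ip (w b) (w b) - ip (w a) (w a) <= 2 * (ip (w b) (w b) - ip (w a) (w b)).
  by have := ip_young La Lb; lra.
apply: (le_trans step1); rewrite -mulrA ler_pM2l// (ip_increment Lb a0 ab bS).
(* The bound is written as an integral over [s] of its two Young halves, so that it can be compared
   with the integrand. *)
have -> : (b - a) * Z = \int[leb R]_(r in `]a, b]) (2^-1 * Z + (2^-1 * (b - a)) * n r).
  rewrite RintegralD//; last exact: integrableRZ.
  by rewrite Rintegral_itv_cst// RintegralZl// -/Z; field.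
apply: Rintegral_ae_le => //.
- by apply: (integrable_sub a0 bS); exact: L2Q_ip_integrable.
- by apply: integrableRD => //; exact: integrableRZ.
apply: (ae_mono (ae_and (L2Q_ae Lz) wz_le0)) => s [Lzs wz0].
rewrite /= in_itv/= => /andP[as_ sb].
have s0 := lt_trans a0 as_; have sS := le_lt_trans sb bS.
have {}Lzs : L2_I (z s) by apply: Lzs; rewrite s0 sS.
have {}wz0 : ip (w s) (z s) <= 0 by apply: wz0; rewrite s0 sS.
(* The function [z s] is frozen and used as test function for the increment of [w] from [s] to
   [b]. *)
rewrite ipC; have := ip_increment Lzs s0 sb bS => E.
suff : \int[leb R]_(r in `]s, b]) ip (z r) (z s) <= 2^-1 * Z + 2^-1 * (b - a) * n s by lra.
have sb_fin : (leb R `]s, b] < +oo)%E.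
  by apply: (@itv_lt_pinfty _ _ s b); exact: subset_itv_oc_cc.
have in_sb : (leb R).-integrable `]s, b] (EFin \o n) := integrable_sub s0 bS in_n.
have ins : (leb R).-integrable `]s, b] (EFin \o (fun=> n s)).
  exact: integrable_cst1.
apply: (@le_trans _ _ (\int[leb R]_(r in `]s, b]) (2^-1 * n r + 2^-1 * n s))).
  apply: Rintegral_ae_le => //.
  - by apply: (integrable_sub s0 bS); exact: L2Q_ip_integrable.
  - by apply: integrableRD => //; apply: integrableRZ.
  - apply: (ae_mono (L2Q_ae Lz)) => r Lzr; rewrite /= in_itv/= => /andP[sr rb].
    have {}Lzr : L2_I (z r) by apply: Lzr; rewrite (lt_trans s0 sr) (le_lt_trans rb bS).
    by have := ip_young Lzr Lzs; rewrite -/(n r) -/(n s); lra.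
rewrite RintegralD//; [|exact: integrableRZ|exact: integrableRZ].
rewrite !RintegralZl// Rintegral_itv_cst//.
have n0 r : 0 <= n r by exact: ip_ge0.
have Zs : \int[leb R]_(r in `]s, b]) n r <= Z.
  rewrite /Z -(Rintegral_itv_add a0 ab bS in_n) -(Rintegral_itv_add s0 sb bS in_n).
  suff : 0 <= \int[leb R]_(r in `]a, s]) n r.
    by rewrite -(Rintegral_itv_add a0 (ltW as_) sS in_n) subr_ge0 => h; rewrite lerD2l lerN2.
  by apply: Rintegral_ge0.
have h : (b - s) * n s <= (b - a) * n s by rewrite ler_wpM2r// lerD2l lerN2 ltW.
exact: fin h Zs.
Qed.

(** Over [k + 1] equal pieces of length [h], the errors of [energy_step] add up to [2 h] times one
    fixed integral, so they vanish in the limit. *)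
Lemma energy_nonincreasing a b : 0 < a -> a <= b -> b < S ->
  ip (w b) (w b) <= ip (w a) (w a).
Proof.
move=> a0 ab bS.
pose Nn t := \int[leb R]_(r in `]a, t]) n r.
pose C := 2 * (b - a) * Nn b.
have key k : ip (w b) (w b) - ip (w a) (w a) <= C * k.+1%:R^-1.
  pose h := (b - a) / k.+1%:R.
  have h0 : 0 <= h by rewrite divr_ge0// subr_ge0.
  pose p i := a + i%:R * h.
  have pa i : a <= p i by rewrite lerDl mulr_ge0.
  have pS i : (i <= k.+1)%N -> p i <= b.
    move=> ik; rewrite /p /h mulrA -lerBrDl ler_pdivrMr ?ltr0n// mulrC ler_wpM2l ?subr_ge0//.
    by rewrite ler_nat.
  have ind i : (i <= k.+1)%N ->
      ip (w (p i)) (w (p i)) - ip (w a) (w a) <= 2 * h * Nn (p i).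
    elim: i => [|i IHi] ik.
      rewrite /p mul0r addr0 subrr; apply: mulr_ge0; first by rewrite mulr_ge0.
      by apply: Rintegral_ge0 => r _; exact: ip_ge0.
    have pp : p i <= p i.+1 by rewrite /p lerD2l ler_wpM2r// ler_nat.
    have p0 : 0 < p i := lt_le_trans a0 (pa i).
    have pS1 : p i.+1 < S := le_lt_trans (pS _ ik) bS.
    have pSi : p i < S := le_lt_trans pp pS1.
    have := energy_step p0 pp pS1.
    have -> : p i.+1 - p i = h by rewrite /p -natr1; ring.
    have -> : \int[leb R]_(r in `]p i, p i.+1]) n r = Nn (p i.+1) - Nn (p i).
      rewrite /Nn -(Rintegral_itv_add p0 pp pS1 in_n).
      rewrite -(Rintegral_itv_add a0 (pa _) pS1 in_n) -(Rintegral_itv_add a0 (pa i) pSi in_n).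
      by ring.
    by have := IHi (ltnW ik); lra.
  have := ind k.+1 (leqnn _).
  have -> : p k.+1 = b by rewrite /p /h mulrC divfK ?pnatr_eq0// subrKC.
  move=> H; apply: le_trans H _; rewrite /C /h.
  by rewrite le_eqVlt; apply/orP; left; apply/eqP; ring.
rewrite -subr_le0; apply/ler_addgt0Pr => e e0; rewrite add0r.
have C0 : 0 <= C.
  rewrite /C !mulr_ge0 ?subr_ge0//.
  by apply: Rintegral_ge0 => r _; exact: ip_ge0.
have e1 : 0 < e / (C + 1) by rewrite divr_gt0//; lra.
have [N _ /(_ N (leqnn N)) /= HN] := near_infty_natSinv_lt (PosNum e1).
apply: le_trans (key N) _.
apply: (@le_trans _ _ (C * (e / (C + 1)))); first by rewrite ler_wpM2l// ltW.
rewrite mulrCA ger_pMr// ler_pdivrMr; lra.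
Qed.

End nonincreasing.
End energy.

(** * Dirac masses and the bound on selections *)

Section lam.
Context {R : realType}.
Local Notation T := (measurableTypeR R).
Implicit Types (f g v w z Om sg : R -> R) (nu : {charge set T -> \bar R})
  (A P : set T) (a b c x y : R).

Lemma measurable_set_ind (D : set T) P : measurable D -> measurable P ->
  measurable_fun D (\1_P : R -> R).
Proof. by move=> mD mP; apply: measurable_funTS; exact: measurable_indic. Qed.

(** Cutting by [I] makes Lebesgue measure on [P] finite, as a charge has to be. *)
Definition lam P : set T -> \bar R := fun A => (leb R) (A `&` (P `&` I)).

Section lam_measure.
Variable P : set T.
Hypothesis mP : measurable P.

Let mPI : measurable (P `&` I : set T).
Proof. exact: measurableI. Qed.

Let lam_lty : (leb R (P `&` I) < +oo)%E.
Proof.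
apply: le_lt_trans leI_lty; apply: le_measure => //; rewrite ?inE//.
Qed.

Definition lamm : {finite_measure set T -> \bar R} := mfrestr mPI lam_lty.

Lemma lammE A : lamm A = lam P A. Proof. by []. Qed.

Lemma lamm_lty : (lamm I < +oo)%E.
Proof.
rewrite lammE /lam; apply: le_lt_trans leI_lty.
by apply: le_measure => //; rewrite ?inE//; apply: measurableI => //; exact: mI.
Qed.

Lemma Rintegral_lam f M : measurable_fun I f -> (forall x, I x -> `|f x| <= M) ->
  \int[lamm]_(x in I) f x = \int[leb R]_(x in I) (f x * \1_P x).
Proof.
move=> mf fM.
have mIP : measurable (I `&` P : set T) by apply: measurableI => //; exact: mI.
have mID : measurable (I `\` P : set T) by apply: measurableD => //; exact: mI.
have E : I = (I `&` P) `|` (I `\` P) :> set T by rewrite setUIDK.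
have i1 : lamm.-integrable I (EFin \o f) := bounded_integrableI mf fM lamm_lty.
have L0 : lamm (I `\` P) = 0%E.
  rewrite lammE /lam [X in leb R X](_ : _ = set0) ?measure0//.
  by apply/seteqP; split => x // -[[_ nP] [Px _]].
rewrite [in LHS]E Rintegral_setU//; last 2 first.
- by rewrite -E.
- by apply/disj_setPS => x [[_ ?] [_ ?]].
rewrite [X in _ + X](_ : _ = 0) ?addr0; last first.
  rewrite /Rintegral null_set_integral//.
  apply/measurable_EFinP; apply: (@measurable_funS _ _ _ _ (I : set T)) => //.
transitivity (\int[leb R]_(x in I `&` P) f x).
  rewrite /Rintegral; congr fine; apply: eq_measure_integral => A mA AIP.
  transitivity (lam P A) => //; rewrite /lam; congr (leb R _); apply/seteqP; split => [x []//|x Ax].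
  by split=> //; have [? ?] := AIP x Ax.
rewrite Rintegral_mkcondr; apply: eq_Rintegral => x _.
by rewrite patchE indicE; case: ifPn; rewrite ?mulr1 ?mulr0.
Qed.

End lam_measure.

Definition lamc P (mP : measurable P) : {charge set T -> \bar R} :=
  charge_of_finite_measure (lamm mP).

(** The derivative of a function with slope 1 on [P] and -1 off [P]: Lebesgue measure on [I] with
    density [2 * \1_P - 1]. *)
Definition slopec P (mP : measurable P) : {charge set T -> \bar R} :=
  cadd (lamc mP) (copp (lamc (measurableC mP))).

Lemma charge_diff_slope P (mP : measurable P) :
  charge_diff (slopec mP) (lamm mP) (lamm (measurableC mP)).
Proof.
split; [exact: lamm_lty|exact: lamm_lty|move=> A mA _].
by rewrite /slopec caddE coppE.
Qed.

Lemma slope_int P (mP : measurable P) f M : measurable_fun I f ->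
  (forall x, I x -> `|f x| <= M) ->
  charge_int (slopec mP) I f = \int[leb R]_(x in I) ((2 * \1_P x - 1) * f x).
Proof.
move=> mf fM; rewrite (charge_intE mf fM (charge_diff_slope mP)).
have i1 (Q : set T) : measurable Q ->
    (leb R).-integrable I (EFin \o (fun x => f x * \1_Q x)).
  move=> mQ; apply: (@integrable_mul_bounded R _ _ _ _ _ _ 1).
  - exact: mI.
  - exact: (bounded_integrableI mf fM leI_lty).
  - by apply: measurable_set_ind => //; exact: mI.
  - by move=> x _; rewrite indicE; case: (_ \in _); rewrite ?normr1 ?normr0.
rewrite !(Rintegral_lam _ mf fM) -RintegralB//; [|exact: i1|apply: i1; exact: measurableC].
apply: eq_Rintegral => x _; rewrite !indicE in_setC.
by case: (x \in P) => /=; ring.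
Qed.

Lemma slope_integrable P (mP : measurable P) :
  (leb R).-integrable I (EFin \o (fun x => 2 * \1_P x - 1)).
Proof.
apply: (@bounded_integrableI _ _ 1); last exact: leI_lty.
  apply: measurable_funB => //; apply: measurable_funM => //.
by move=> x _; rewrite indicE ler_norml; case: (_ \in _); rewrite /=; lra.
Qed.

Lemma is_Dmeas_slope f c P (mP : measurable P) :
  (forall x, -1 < x < 1 -> f x = c + \int[leb R]_(y in `]-1, x]) (2 * \1_P y - 1)) ->
  is_Dmeas f (slopec mP).
Proof.
move=> Hf phi tphi; have [M hM] := tf_bounded tphi.
have mphi : measurable_fun (I : set T) phi.
  by apply: (continuous_mfun mI); exact: (tf_continuous tphi).
rewrite (slope_int mP mphi (fun x _ => hM x)).
apply: (AC_weak _ _ Hf tphi); first lra.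
exact: slope_integrable.
Qed.

(** The identity is the profile whose slope is 1 everywhere, which puts [v + x] and [v - x] in the
    same calculus. *)
Lemma is_Dmeas_id : is_Dmeas (fun x : R => x) (slopec (@measurableT _ T)).
Proof.
apply: (@is_Dmeas_slope _ (-1)) => x /andP[x1 x2].
transitivity (-1 + \int[leb R]_(y in `]-1, x]) (1 : R)).
  by rewrite Rintegral_itv_cst ?ltW//; ring.
congr (_ + _); apply: eq_Rintegral => y _.
by rewrite indicE in_setT /=; ring.
Qed.

Lemma integrable_id : (leb R).-integrable I (EFin \o (fun x : R => x)).
Proof.
apply: (@bounded_integrableI _ _ 1); last exact: leI_lty.
  exact: measurable_funTS.
by move=> x; rewrite /Iint/= in_itv/= ler_norml => /andP[/ltW -> /ltW ->].
Qed.

Lemma BV_id : BV_I (fun x : R => x).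
Proof. by split; [exact: integrable_id|eexists; exact: is_Dmeas_id]. Qed.

Lemma BV_D v w : BV_I v -> BV_I w -> BV_I (fun x => v x + w x).
Proof.
move=> [iv [nu Hv]] [iw [mu Hw]]; split; first by have := integrableRD mI iv iw.
by eexists; exact: is_DmeasD Hv Hw.
Qed.

Lemma BV_N v : BV_I v -> BV_I (fun x => - v x).
Proof.
move=> [iv [nu Hv]]; split; first exact: integrableN.
by eexists; exact: is_DmeasN Hv.
Qed.

Lemma tvar_addD v w nu : BV_I v -> BV_I w -> is_Dmeas w nu ->
  fine (tvar (Dmeas (fun x => v x + w x)) I) <= fine (tvar (Dmeas v) I) + fine (tvar nu I).
Proof.
move=> [iv Ev] [iw _] Hw.
rewrite (tvar_ext (DmeasE (is_DmeasD iv iw (DmeasP Ev) Hw))).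
exact: fine_tvar_add.
Qed.

Lemma intW_fin v : intW v = (fine (intW v))%:E.
Proof. by rewrite fineK// /intW fin_numD !tvar_fin. Qed.

Lemma intW_fineE v : fine (intW v) = fine (tvar (Dmeas (fun x => v x + x)) I) +
  fine (tvar (Dmeas (fun x => v x - x)) I).
Proof. by rewrite /intW fineD ?tvar_fin. Qed.

(** [W] is Lipschitz with constant 2: each of the two variations grows by at most the variation of
    [Dw]. This is the origin of the bound 2 on fluxes. *)
Lemma intW_add v w nu : BV_I v -> BV_I w -> is_Dmeas w nu ->
  fine (intW (fun x => v x + w x)) <= fine (intW v) + 2 * fine (tvar nu I).
Proof.
move=> Bv Bw Hw; rewrite (intW_fineE v) (intW_fineE (fun x => v x + w x)).
have -> : (fun x => v x + w x + x) = (fun x => (v x + x) + w x).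
  by apply/funext => x; ring.
have -> : (fun x => v x + w x - x) = (fun x => (v x - x) + w x).
  by apply/funext => x; ring.
have t1 := tvar_addD (BV_D Bv BV_id) Bw Hw.
have t2 := tvar_addD (BV_D Bv (BV_N BV_id)) Bw Hw.
by apply: (le_trans (lerD t1 t2)); rewrite addrACA lerD2l -mulr2n mulr_natl.
Qed.

Definition pointm y : {finite_measure set T -> \bar R} := @dirac _ T y R.

Definition diracc y : {charge set T -> \bar R} :=
  charge_of_finite_measure (pointm y).

Lemma dirac_lty y : (pointm y I < +oo)%E.
Proof. by rewrite /pointm/= diracE ltry. Qed.

Lemma charge_diff_dirac y :
  charge_diff (diracc y) (pointm y) mzero.
Proof.
split; [exact: dirac_lty|by rewrite /mzero ltry|].
by move=> A mA _; rewrite /mzero sube0.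
Qed.

Lemma dirac_int y f M : measurable_fun I f -> (forall x, I x -> `|f x| <= M) ->
  I y -> charge_int (diracc y) I f = f y.
Proof.
move=> mf fM Iy; rewrite (charge_intE mf fM (charge_diff_dirac y)).
rewrite /Rintegral integral_measure_zero subr0 /pointm/= integral_dirac//; last 2 first.
- exact: mI.
- exact/measurable_EFinP.
have D1 : pointm y I = 1%E by rewrite /pointm/= diracE mem_set.
by rewrite -[X in fine (X * _)%E]/(pointm y I) D1 mul1e.
Qed.

Lemma dirac_tvar y : fine (tvar (diracc y) I) <= 1.
Proof.
have := tvar_le (charge_diff_dirac y).
rewrite /mzero adde0 => h.
rewrite -lee_fin fineK ?tvar_fin//; apply: le_trans h _.
by rewrite /pointm/= diracE lee_fin; case: (_ \in _).
Qed.

Lemma diracN_tvar y : fine (tvar (copp (diracc y)) I) <= 1.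
Proof.
have := tvar_le (charge_diff_opp (charge_diff_dirac y)).
rewrite /mzero add0e => h.
rewrite -lee_fin fineK ?tvar_fin//; apply: le_trans h _.
by rewrite /pointm/= diracE lee_fin; case: (_ \in _).
Qed.

Lemma BV_step y : I y ->
  BV_I (fun x => (y <= x)%R%:R : R) /\ is_Dmeas (fun x => (y <= x)%R%:R) (diracc y).
Proof.
move=> Iy; have y1 : -1 < y < 1 by move: Iy; rewrite /Iint/= in_itv.
suff H : is_Dmeas (fun x => (y <= x)%R%:R) (diracc y).
  split => //; split; last by exists (diracc y).
  apply: (@bounded_integrableI _ _ 1); last exact: leI_lty.
    rewrite (_ : (fun x => _) = fun x : R => if y <= x then 1 else 0 : R).
      by apply: measurable_funTS; apply: measurable_fun_ifT => //; exact: measurable_fun_ler.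
    by apply/funext => x; case: (y <= x).
  by move=> x _; case: (y <= x); rewrite ?normr1 ?normr0.
move=> phi tphi; have [M hM] := tf_bounded tphi.
have mphi : measurable_fun (I : set T) phi.
  by apply: (continuous_mfun mI); exact: (tf_continuous tphi).
rewrite (dirac_int mphi (fun x _ => hM x))// -(tf_FTC tphi y1).
have /andP[y0 _] := y1.
rewrite -(Rintegral_ge_ind _ _ y0).
by apply: eq_Rintegral => x _; rewrite mulrC.
Qed.

(** The a priori bound [M] makes the charge integrals additive; the conclusion replaces it by the
    sharp constant. *)
Lemma selection_bound v Om M y : BV_I v -> selection v Om ->
  measurable_fun I Om -> (forall x, I x -> `|Om x| <= M) -> I y -> `|Om y| <= 2.
Proof.
have fin (p q r s k : R) : p + (s + k - s) <= q -> q <= p + 2 * r -> r <= 1 -> k <= 2 by lra.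
move=> Bv Sel mO bO Iy; have [Bs Ds] := BV_step Iy.
have [iv Ev] := Bv; have [is_ _] := Bs.
(* Stated for any perturbation of variation at most 1, so that jumps up and down are treated
   alike. *)
have key w nu : BV_I w -> is_Dmeas w nu -> fine (tvar nu I) <= 1 ->
    charge_int nu I Om <= 2.
  move=> Bw Hw t1; have [iw _] := Bw.
  have := Sel _ (BV_D Bv Bw).
  have E := DmeasE (is_DmeasD iv iw (DmeasP Ev) Hw).
  rewrite intW_fin [in X in (_ <= X)%E -> _]intW_fin -EFinD lee_fin.
  rewrite (charge_int_add _ _ mO bO) (charge_int_opp _ mO bO).
  rewrite (charge_int_ext mO bO E) (charge_int_add _ _ mO bO).
  by move=> h; exact: fin h (intW_add Bv Bw Hw) t1.
rewrite ler_norml; apply/andP; split; last first.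
  by rewrite -(dirac_int mO bO Iy); exact: key Bs Ds (dirac_tvar y).
have := key _ _ (BV_N Bs) (is_DmeasN is_ Ds) (diracN_tvar y).
by rewrite (charge_int_opp _ mO bO) (dirac_int mO bO Iy); lra.
Qed.

End lam.

(** * Traces *)

Section slices.
Context {R : realType}.
Local Notation T := (measurableTypeR R).
Implicit Types (f v w z Om : R -> R) (nu : {charge set T -> \bar R})
  (A P : set T) (a b c x y : R).

(** A null set contains no interval, so a property valid almost everywhere is met arbitrarily close
    to an endpoint. This is what makes essential limits unique. *)
Lemma ae_ex_near (e : R) c (Q : R -> Prop) : c = -1 \/ c = 1 -> 0 < e ->
  (\forall x \ae leb R, Q x) -> exists x, [/\ I x, `|x - c| < e & Q x].
Proof.
move=> c1 e0 HQ; pose d := Num.min e 1.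
have d0 : 0 < d by rewrite lt_min e0 ltr01.
have [de d1] : d <= e /\ d <= 1 by rewrite !ge_min !lexx orbT.
case: c1 => ->.
- have [x /andP[x1 x2] Qx] := @ae_ex _ (-1) (-1 + d) Q (ltac:(lra)) HQ.
  exists x; split => //; first by rewrite /Iint/= in_itv/=; lra.
  by rewrite ltr_norml; lra.
- have [x /andP[x1 x2] Qx] := @ae_ex _ (1 - d) 1 Q (ltac:(lra)) HQ.
  exists x; split => //; first by rewrite /Iint/= in_itv/=; lra.
  by rewrite ltr_norml; lra.
Qed.

Lemma has_trace_uniq v c (l l' : R) : c = -1 \/ c = 1 ->
  has_trace v c l -> has_trace v c l' -> l = l'.
Proof.
move=> c1 H H'; apply/eqP/negPn/negP => ll'.
have e0 : 0 < `|l - l'| / 2 by rewrite divr_gt0// normr_gt0 subr_eq0.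
have [d d0 Hd] := H _ e0; have [d' d0' Hd'] := H' _ e0.
have m0 : 0 < Num.min d d' by rewrite lt_min d0.
have [x [Ix xc [Hx Hx']]] := ae_ex_near c1 m0 (ae_and Hd Hd').
move: xc; rewrite lt_min => /andP[xd xd'].
have := Hx Ix xd; have := Hx' Ix xd'.
have : `|l - l'| <= `|v x - l| + `|v x - l'|.
  by rewrite -(normrN (v x - l)) (le_trans _ (ler_normD _ _))// opprB addrA subrK.
lra.
Qed.

Lemma has_traceB v w c (l l' : R) : has_trace v c l -> has_trace w c l' ->
  has_trace (fun x => v x - w x) c (l - l').
Proof.
move=> H H' e e0.
have e0' : 0 < e / 2 by rewrite divr_gt0.
have [d d0 Hd] := H _ e0'; have [d' d0' Hd'] := H' _ e0'.
exists (Num.min d d'); first by rewrite lt_min d0.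
apply: (ae_mono (ae_and Hd Hd')) => x [Hx Hx'] Ix.
rewrite lt_min => /andP[xd xd'].
have := Hx Ix xd; have := Hx' Ix xd'.
have : `|v x - w x - (l - l')| <= `|v x - l| + `|w x - l'|.
  by rewrite -(normrN (w x - l')) (le_trans _ (ler_normD _ _))// [leLHS](_ : _ = `|v x - l + - (w x - l')|)//; congr (`|_|); ring.
lra.
Qed.

Lemma has_trace_le v c l (M : R) : c = -1 \/ c = 1 ->
  (forall x, I x -> `|v x| <= M) -> has_trace v c l -> `|l| <= M.
Proof.
move=> c1 bv H; rewrite leNgt; apply/negP => Ml.
have e0 : 0 < `|l| - M by lra.
have [d d0 Hd] := H _ e0.
have [x [Ix xc Hx]] := ae_ex_near c1 d0 Hd.
have := Hx Ix xc; have := bv x Ix.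
have : `|l| <= `|v x| + `|v x - l|.
  by rewrite -(normrN (v x - l)) (le_trans _ (ler_normD _ _))// opprB subrKC.
lra.
Qed.

Lemma has_trace_cvg v c l : (forall e, 0 < e -> exists2 d : R, 0 < d &
    forall x, I x -> `|x - c| < d -> `|v x - l| < e) -> has_trace v c l.
Proof.
move=> H e e0; have [d d0 Hd] := H e e0; exists d => //.
by exists set0; split => // x; rewrite /setC/= => nH; case: nH => ? ?; exact: Hd.
Qed.

Lemma has_trace_ae v w c l : (\forall x \ae leb R, I x -> v x = w x) ->
  has_trace v c l -> has_trace w c l.
Proof.
move=> E H e e0; have [d d0 Hd] := H e e0; exists d => //.
by apply: (ae_mono (ae_and Hd E)) => x [Hx Ex] Ix; rewrite -(Ex Ix); exact: Hx.
Qed.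

(** Weighted Young against the indicator of []-1, x]], whose squared norm is [x + 1]. *)
Lemma L2_primitive_small z x : L2_I z -> -1 < x < 1 -> forall k, 0 < k ->
  `|\int[leb R]_(y in `]-1, x]) z y| <= k * ip z z + k^-1 * (x + 1).
Proof.
move=> Lz /andP[x1 x2] k k0.
have Li : L2_I (fun y => (y <= x)%R%:R).
  apply: (@bounded_L2 _ _ 1); first exact: measurable_le_ind.
  by move=> y _; case: (y <= x); rewrite ?normr1 ?normr0.
rewrite -(Rintegral_le_ind (leb R) (-1) z x2).
have := ip_abs k0 Lz Li; rewrite /ip => h; apply: le_trans h _.
rewrite lerD2l ler_wpM2l ?invr_ge0 ?(ltW k0)//.
rewrite (@Rintegral_le_ind R (leb R) (-1) 1 (fun y => (y <= x)%R%:R) x x2).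
rewrite [leLHS](_ : _ = \int[leb R]_(y in `]-1, x]) (1 : R)).
  by rewrite (Rintegral_itv_cst _ (ltW x1)); lra.
by apply: eq_Rintegral => y; rewrite inE/= in_itv/= => /andP[_ ->].
Qed.

Lemma L2_primitive_cosmall z x : L2_I z -> -1 < x < 1 -> forall k, 0 < k ->
  `|\int[leb R]_(y in I) z y - \int[leb R]_(y in `]-1, x]) z y| <=
  k * ip z z + k^-1 * (1 - x).
Proof.
move=> Lz /andP[x1 x2] k k0.
have iz := L2_int Lz.
pose h y : R := 1 - (y <= x)%R%:R.
have Li : L2_I h.
  apply: (@bounded_L2 _ _ 1).
    apply: measurable_funB => //; exact: measurable_le_ind.
  by move=> y _; rewrite /h; case: (y <= x); rewrite ?subrr ?subr0 ?normr1 ?normr0.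
have -> : \int[leb R]_(y in I) z y - \int[leb R]_(y in `]-1, x]) z y = ip z h.
  rewrite -(Rintegral_le_ind (leb R) (-1) z x2) -RintegralB//; last exact: integrable_le_ind.
  by apply: eq_Rintegral => y _; rewrite /h; ring.
apply: le_trans (ip_abs k0 Lz Li) _.
rewrite lerD2l ler_wpM2l ?invr_ge0 ?(ltW k0)//.
have icst : (leb R).-integrable I (EFin \o (fun=> 1 : R)).
  by apply: integrable_cst1 => //; exact: leI_lty.
rewrite /ip [leLHS](_ : _ = \int[leb R]_(y in I) (1 - 1 * (y <= x)%R%:R)).
  rewrite RintegralB//; last exact: integrable_le_ind.
  rewrite (Rintegral_le_ind (leb R) (-1) (fun=> 1) x2) (Rintegral_itv_cst _ (ltW x1)).
  suff -> : \int[leb R]_(y in I) (1 : R) = 2 by lra.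
  rewrite Rintegral_cst; last exact: mI.
  have /= := @lebesgue_measure_itv R `]-1, 1[; rewrite lte_fin => E.
  rewrite mul1r; apply: (etrans (congr1 fine E)).
  by rewrite gtrN ?ltr01//= opprK.
by apply: eq_Rintegral => y _; rewrite /h; case: (y <= x) => /=; ring.
Qed.

(** The weight [k] is chosen first, to make [k * X] small; then [d] is adapted to [k]. *)
Lemma small_split (X e : R) : 0 <= X -> 0 < e -> exists k d : R,
  [/\ 0 < k, 0 < d & forall y, y < d -> k * X + k^-1 * y < e].
Proof.
move=> X0 e0; pose k := e / (2 * (X + 1)); exists k, (k * (e / 2)).
have k0 : 0 < k by rewrite /k divr_gt0//; lra.
split=> //; first by rewrite mulr_gt0//; lra.
move=> y yd; have h : k * X <= e / 2.
  rewrite /k [leLHS](_ : _ = (e / 2) * (X / (X + 1))); last by field; rewrite gt_eqF//; lra.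
  by rewrite ger_pMr ?divr_gt0// ler_pdivrMr; lra.
have : k^-1 * y < e / 2 by rewrite mulrC ltr_pdivrMr// mulrC.
lra.
Qed.

(** For a flux this identifies its boundary values with the constants that occur in [BV_ibp]. *)
Lemma primitive_traces f (g0 : R) z : L2_I z ->
  (forall x, I x -> f x = g0 + \int[leb R]_(y in `]-1, x]) z y) ->
  has_trace f (-1) g0 /\ has_trace f 1 (g0 + \int[leb R]_(y in I) z y).
Proof.
move=> Lz Hf; split; apply: has_trace_cvg => e e0.
- have [k [d [k0 d0 H]]] := small_split (ip_ge0 z) e0; exists d => // x Ix.
  have Ix' : -1 < x < 1 by move: Ix; rewrite /Iint/= in_itv.
  rewrite Hf// opprK ger0_norm; last by lra.
  move=> xd; rewrite (addrC g0) addrK; apply: le_lt_trans (L2_primitive_small Lz Ix' k0) _.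
  exact: H.
- have [k [d [k0 d0 H]]] := small_split (ip_ge0 z) e0; exists d => // x Ix.
  have Ix' : -1 < x < 1 by move: Ix; rewrite /Iint/= in_itv.
  rewrite Hf// distrC ger0_norm; last by lra.
  move=> xd; rewrite distrC opprD addrACA subrr add0r.
  by apply: le_lt_trans (L2_primitive_cosmall Lz Ix' k0) _; exact: H.
Qed.

(** Continuity from above of a finite measure along intervals in [I] that shrink towards an
    endpoint. The endpoints are not in [I], so the intersections are empty. *)
Lemma measure_end_small (m : {measure set T -> \bar R}) (e : R) :
  (m I < +oo)%E -> 0 < e -> exists2 d : R, 0 < d & forall x, I x ->
    (x + 1 < d -> fine (m `]-1, x]%classic) < e) /\ (1 - x < d -> fine (m `]x, 1[%classic) < e).
Proof.
move=> moo e0.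
have key (F : (set T)^nat) : (forall n, measurable (F n)) -> (forall n, F n `<=` I) ->
    nonincreasing_seq F -> \bigcap_n F n = set0 ->
    exists N, forall n, (N <= n)%N -> (m (F n) < e%:E)%E.
  move=> mF FI dF F0.
  have F00 : (m (F 0%N) < +oo)%E.
    by apply: le_lt_trans moo; apply: le_measure => //; rewrite inE//; exact: mI.
  have := nonincreasing_cvg_mu F00 mF (bigcapT_measurable mF) dF.
  rewrite F0 measure0 => /(_ [set y | (y < e%:E)%E]) [|N _ HN].
    exists e => //= y /=; rewrite sub0r normrN => h.
    by rewrite lte_fin (le_lt_trans (ler_norm _) h).
  by exists N => n Nn; exact: HN.
pose F1 n : set T := `]-1, -1 + n.+1%:R^-1]%classic.
pose F2 n : set T := `]1 - n.+1%:R^-1, 1[%classic.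
have n1 n : 0 < n.+1%:R^-1 :> R by rewrite invr_gt0.
have n2 n : n.+1%:R^-1 <= 1 :> R by rewrite invf_le1// ler1n.
have dn (i j : nat) : (i <= j)%N -> j.+1%:R^-1 <= i.+1%:R^-1 :> R.
  by move=> ij; rewrite lef_pV2 ?posrE// ler_nat.
have arch (y : R) : 0 < y -> exists n, n.+1%:R^-1 < y.
  move=> y0; have [N _ /(_ N (leqnn N)) /= HN] := near_infty_natSinv_lt (PosNum y0).
  by exists N.
have [||||N1 H1] := key F1.
- by move=> n; exact: measurable_itv.
- move=> n x; rewrite /F1 /Iint /= !in_itv/= => /andP[-> xn] /=.
  by move: (n1 n) (n2 n) xn; move: (n.+1%:R^-1) => r; lra.
- move=> i j ij; apply/subsetPset => x; rewrite /F1 /= !in_itv/= => /andP[-> xn] /=.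
  by apply: (le_trans xn); rewrite lerD2l dn.
- apply/seteqP; split => // x Hx.
  have x1 : 0 < x + 1 by have := Hx 0%N Logic.I; rewrite /F1 /= in_itv/=; lra.
  have [n Hn] := arch _ x1.
  by have := Hx n Logic.I; rewrite /F1 /= in_itv/= => /andP[_]; move: Hn; move: (n.+1%:R^-1) => r; lra.
have [||||N2 H2] := key F2.
- by move=> n; exact: measurable_itv.
- move=> n x; rewrite /F2 /Iint /= !in_itv/= => /andP[xn ->].
  by move: (n1 n) (n2 n) xn; move: (n.+1%:R^-1) => r; rewrite andbT; lra.
- move=> i j ij; apply/subsetPset => x; rewrite /F2 /= !in_itv/= => /andP[xn ->].
  by rewrite andbT; apply: le_lt_trans xn; rewrite lerD2l lerN2 dn.
- apply/seteqP; split => // x Hx.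
  have x1 : 0 < 1 - x by have := Hx 0%N Logic.I; rewrite /F2 /= in_itv/=; lra.
  have [n Hn] := arch _ x1.
  by have := Hx n Logic.I; rewrite /F2 /= in_itv/= => /andP[]; move: Hn; move: (n.+1%:R^-1) => r; lra.
pose N := maxn N1 N2; exists (N.+1%:R^-1) => // x.
rewrite /Iint /= in_itv/= => /andP[x1 x2].
have fin A B : measurable A -> measurable B -> A `<=` B -> B `<=` I -> (m B < e%:E)%E ->
    fine (m A) < e.
  move=> mA mB AB BI mBe; rewrite -lte_fin fineK; last first.
    by apply: measure_subI_fin => //; exact: subset_trans BI.
  by apply: le_lt_trans mBe; apply: le_measure => //; rewrite inE.
split=> xN.
- apply: (fin _ (F1 N)); rewrite ?H1 ?leq_maxl//.
  + exact: measurable_itv.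
  + move=> y; rewrite /F1 /= !in_itv/= => /andP[-> yx] /=.
    by move: xN; move: (N.+1%:R^-1) => r; lra.
  + move=> y; rewrite /F1 /Iint /= !in_itv/= => /andP[-> xn] /=.
    by move: (n1 N) (n2 N) xn; move: (N.+1%:R^-1) => r; lra.
- apply: (fin _ (F2 N)); rewrite ?H2 ?leq_maxr//.
  + exact: measurable_itv.
  + move=> y; rewrite /F2 /= !in_itv/= => /andP[yx ->]; rewrite andbT.
    by move: xN; move: (N.+1%:R^-1) => r; lra.
  + move=> y; rewrite /F2 /Iint /= !in_itv/= => /andP[xn ->].
    by move: (n1 N) (n2 N) xn; move: (N.+1%:R^-1) => r; rewrite andbT; lra.
Qed.

Lemma cumulE nu x : -1 < x < 1 ->
  cumul nu x = fine (jordan_pos (hahn_PN nu) `]-1, x]%classic) - fine (jordan_neg (hahn_PN nu) `]-1, x]%classic).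
Proof.
move=> /andP[x1 x2]; rewrite /cumul /charge_int.
have E (m : {sigma_finite_measure set T -> \bar R}) :
    \int[m]_(y in I) (y <= x)%R%:R = fine (m `]-1, x]%classic).
  by rewrite Rintegral_bigcst// Rintegral_cst ?mul1r.
by rewrite !E.
Qed.

Lemma cumul_coE nu x : -1 < x < 1 ->
  charge_int nu I (fun=> 1) - cumul nu x =
  fine (jordan_pos (hahn_PN nu) `]x, 1[%classic) - fine (jordan_neg (hahn_PN nu) `]x, 1[%classic).
Proof.
move=> x12; rewrite cumulE// /charge_int; have /andP[x1 x2] := x12.
have [f1 f2 _] := charge_diff_jordan nu.
have E (m : {measure set T -> \bar R}) : (m I < +oo)%E ->
    \int[m]_(y in I) (1 : R) = fine (m `]-1, x]%classic) + fine (m `]x, 1[%classic).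
  move=> moo; rewrite Rintegral_cst ?mul1r; last exact: mI.
  have s1 : `]-1, x]%classic `<=` (I : set T).
    by move=> y; rewrite /Iint /= !in_itv/=; lra.
  have s2 : `]x, 1[%classic `<=` (I : set T).
    by move=> y; rewrite /Iint /= !in_itv/=; lra.
  rewrite -fineD; [|exact: (measure_subI_fin moo)|exact: (measure_subI_fin moo)].
  rewrite -measureU//.
    congr (fine (m _)); apply/seteqP; split => y; rewrite /Iint /= !in_itv/=; last lra.
    by move=> y12; case: (leP y x) => yx; [left|right]; lra.
  by apply/seteqP; split => y //=; rewrite !in_itv/=; lra.
by rewrite !E//; ring.
Qed.

(** Near -1 the distribution function is a difference of two small masses; near 1 what is missing
    from [nu(I)] is such a difference. Each Jordan part contributes less than [e / 2]. *)
Lemma BV_traces v nu c : (\forall x \ae leb R, I x -> v x = c + cumul nu x) ->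
  has_trace v (-1) c /\ has_trace v 1 (c + charge_int nu I (fun=> 1)).
Proof.
move=> Hv; have [f1 f2 _] := charge_diff_jordan nu.
suff [H1 H2] : has_trace (fun x => c + cumul nu x) (-1) c /\
    has_trace (fun x => c + cumul nu x) 1 (c + charge_int nu I (fun=> 1)).
  have Hv' : \forall x \ae leb R, I x -> c + cumul nu x = v x.
    by apply: (ae_mono Hv) => x H Ix; rewrite H.
  by split; [exact: has_trace_ae H1|exact: has_trace_ae H2].
have tri (r1 r2 e : R) : 0 <= r1 -> 0 <= r2 -> r1 < e / 2 -> r2 < e / 2 -> `|r1 - r2| < e.
  by move=> *; rewrite ltr_norml; lra.
split; apply: has_trace_cvg => e e0.
- have [d d0 H1] := measure_end_small f1 (divr_gt0 e0 (ltr0n R 2)).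
  have [d' d0' H2] := measure_end_small f2 (divr_gt0 e0 (ltr0n R 2)).
  exists (Num.min d d'); first by rewrite lt_min d0.
  move=> x Ix; have Ix' : -1 < x < 1 by move: Ix; rewrite /Iint/= in_itv.
  rewrite opprK ger0_norm; last by lra.
  rewrite lt_min => /andP[xd xd'].
  rewrite (addrC c) addrK cumulE//; apply: tri; rewrite ?fine_ge0//.
    by have [+ _] := H1 x Ix; exact.
  by have [+ _] := H2 x Ix; exact.
- have [d d0 H1] := measure_end_small f1 (divr_gt0 e0 (ltr0n R 2)).
  have [d' d0' H2] := measure_end_small f2 (divr_gt0 e0 (ltr0n R 2)).
  exists (Num.min d d'); first by rewrite lt_min d0.
  move=> x Ix; have Ix' : -1 < x < 1 by move: Ix; rewrite /Iint/= in_itv.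
  rewrite distrC ger0_norm; last by lra.
  rewrite lt_min => /andP[xd xd'].
  rewrite distrC opprD addrACA subrr add0r cumul_coE//; apply: tri; rewrite ?fine_ge0//.
    by have [_] := H1 x Ix; exact.
  by have [_] := H2 x Ix; exact.
Qed.

End slices.

(** * Uniqueness of solutions *)

Section uniqueness.
Context {R : realType}.
Local Notation T := (measurableTypeR R).
Implicit Types (f v w : R -> R) (nu : {charge set T -> \bar R})
  (A P : set T) (a b c t x y S : R).

(* What a solution satisfies at almost every time, with v = u t and z = u_t. *)
Definition slice v Om z := [/\ BV_I v, L2_I z,
  exists g0, (forall x, I x -> Om x = g0 + \int[leb R]_(y in `]-1, x]) z y),
  selection v Om & dirichlet0 v Om].

Lemma itvI x : I x -> -1 < x < 1.
Proof. by rewrite /Iint/= in_itv. Qed.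

Lemma slice_flux v Om z : slice v Om z ->
  measurable_fun I Om /\ (forall x, I x -> `|Om x| <= 2).
Proof.
move=> [Bv Lz [g0 HO] Sel _].
have iz := L2_int Lz.
have mO : measurable_fun (I : set T) Om.
  have : measurable_fun (I : set T) (fun x => g0 + \int[leb R]_(y in `]-1, x]) z y).
    by apply: measurable_funD => //; exact: measurable_primitive.
  by apply: eq_measurable_fun => x; rewrite inE => /HO ->.
split=> // x; apply: (selection_bound (M := `|g0| + \int[leb R]_(x in I) `|z x|) Bv Sel mO).
move=> y Iy; rewrite HO// (le_trans (ler_normD _ _))// lerD2l.
exact: primitive_bounded (itvI Iy) iz.
Qed.

(** The condition at [x = 1] is a decreasing graph: the flux jumps from 2 to -2 as the trace of the
    solution crosses 0, and at trace 0 it is confined to [[-2, 2]]. *)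
Lemma slice_boundary (a1 a2 b1 b2 : R) : `|b1| <= 2 -> `|b2| <= 2 ->
  [\/ a1 = 0, (0 < a1 /\ b1 = - 2) | (a1 < 0 /\ b1 = 2)] ->
  [\/ a2 = 0, (0 < a2 /\ b2 = - 2) | (a2 < 0 /\ b2 = 2)] ->
  (b1 - b2) * (a1 - a2) <= 0.
Proof.
rewrite !ler_norml => /andP[l1 u1] /andP[l2 u2] [->|[h1 ->]|[h1 ->]] [->|[h2 ->]|[h2 ->]]; nra.
Qed.

Lemma charge_int_subE nu1 nu2 f M : measurable_fun (I : set T) f ->
  (forall x, I x -> `|f x| <= M) ->
  charge_int (cadd nu1 (copp nu2)) I f = charge_int nu1 I f - charge_int nu2 I f.
Proof. by move=> mO bO; rewrite (charge_int_add _ _ mO bO) (charge_int_opp _ mO bO). Qed.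

Lemma selection_le v w f M : BV_I w -> selection v f ->
  measurable_fun (I : set T) f -> (forall x, I x -> `|f x| <= M) ->
  fine (intW v) + (charge_int (Dmeas w) I f - charge_int (Dmeas v) I f) <= fine (intW w).
Proof.
move=> Bw Sel mf bf; rewrite -(charge_int_subE _ _ mf bf).
have := Sel _ Bw.
have [r1 ->] : exists r, intW v = r%:E by eexists; exact: intW_fin.
have [r2 ->] : exists r, intW w = r%:E by eexists; exact: intW_fin.
by move: (charge_int _ _ _) => k; rewrite -EFinD lee_fin.
Qed.

Lemma selection_monotone v1 v2 (f1 f2 : R -> R) M : BV_I v1 -> BV_I v2 ->
  selection v1 f1 -> selection v2 f2 ->
  measurable_fun (I : set T) f1 -> (forall x, I x -> `|f1 x| <= M) ->
  measurable_fun (I : set T) f2 -> (forall x, I x -> `|f2 x| <= M) ->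
  0 <= charge_int (Dmeas v1) I f1 - charge_int (Dmeas v2) I f1 -
    (charge_int (Dmeas v1) I f2 - charge_int (Dmeas v2) I f2).
Proof.
have fin (p q k1 k2 k3 k4 : R) : p + (k2 - k1) <= q -> q + (k3 - k4) <= p ->
    0 <= k1 - k2 - (k3 - k4) by lra.
move=> B1 B2 S1 S2 m1 b1 m2 b2.
exact: fin (selection_le B2 S1 m1 b1) (selection_le B1 S2 m2 b2).
Qed.

Lemma slice_monotone v1 v2 Om1 Om2 z1 z2 : slice v1 Om1 z1 -> slice v2 Om2 z2 ->
  ip (fun x => v1 x - v2 x) (fun x => z1 x - z2 x) <= 0.
Proof.
move=> S1 S2; have [m1 b1] := slice_flux S1; have [m2 b2] := slice_flux S2.
have [Bv1 Lz1 [g1 H1] Sel1 [[al1 [bl1 [tv1 tO1 Dl1]]] [ar1 [br1 [sv1 sO1 Dr1]]]]] := S1.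
have [Bv2 Lz2 [g2 H2] Sel2 [[al2 [bl2 [tv2 tO2 Dl2]]] [ar2 [br2 [sv2 sO2 Dr2]]]]] := S2.
have [iv1 Ev1] := Bv1; have [iv2 Ev2] := Bv2.
pose w x := v1 x - v2 x; pose z x := z1 x - z2 x; pose G x := Om1 x - Om2 x.
pose nu := cadd (Dmeas v1) (copp (Dmeas v2)) : {charge set T -> \bar R}.
have iw : (leb R).-integrable I (EFin \o w) by exact: (integrableRB mI iv1 iv2).
have Hw : is_Dmeas w nu by apply: is_DmeasB => //; exact: DmeasP.
have [c Hc] := BV_primitive iw Hw.
have [iz1 iz2] : (leb R).-integrable (I : set T) (EFin \o z1) /\
  (leb R).-integrable (I : set T) (EFin \o z2) by split; exact: L2_int.
have Lz : L2_I z by exact: L2_B.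
have HG x : I x -> G x = (g1 - g2) + \int[leb R]_(y in `]-1, x]) z y.
  move=> Ix; rewrite /G H1// H2// RintegralB//; first ring.
  - by apply: integrableS iz1 => // y; rewrite /Iint /= !in_itv/=; have := itvI Ix; lra.
  - by apply: integrableS iz2 => // y; rewrite /Iint /= !in_itv/=; have := itvI Ix; lra.
have E := BV_ibp (L2_int Lz) HG (integrable_mfun iw) Hc.
have -> : ip w z = \int[leb R]_(x in I) (z x * w x) by rewrite ipC.
rewrite E.
have [tG sG] := primitive_traces Lz HG.
have [tw sw] := BV_traces Hc.
have L1 : -1 = -1 :> R \/ -1 = 1 :> R by left.
have L2 : 1 = -1 :> R \/ 1 = 1 :> R by right.
have Eg := has_trace_uniq L1 tG (has_traceB tO1 tO2).
have Eg' := has_trace_uniq L2 sG (has_traceB sO1 sO2).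
have Ec := has_trace_uniq L1 tw (has_traceB tv1 tv2).
have Ec' := has_trace_uniq L2 sw (has_traceB sv1 sv2).
have hl1 := has_trace_le L1 b1 tO1; have hl2 := has_trace_le L1 b2 tO2.
have hr1 := has_trace_le L2 b1 sO1; have hr2 := has_trace_le L2 b2 sO2.
(* Uniqueness of traces replaces the constants of the integration by parts by differences of the
   boundary values of the two solutions. *)
rewrite Eg' Ec' Eg Ec.
have Br := slice_boundary hr1 hr2 Dr1 Dr2.
(* At -1 the boundary condition is the one at 1 with the sign of the flux reversed. *)
have Bl : (- bl1 - - bl2) * (al1 - al2) <= 0.
  by apply: slice_boundary; rewrite ?normrN//;
    [case: Dl1 => [->|[h ->]|[h ->]]|case: Dl2 => [->|[h ->]|[h ->]]];
    [constructor 1|constructor 2|constructor 3|constructor 1|constructor 2|constructor 3];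
    rewrite ?opprK.
suff : 0 <= charge_int nu I G by lra.
have NG : charge_int nu I G = charge_int nu I Om1 - charge_int nu I Om2.
  have bG x : I x -> `|G x| <= 4.
    by move=> Ix; have := b1 x Ix; have := b2 x Ix; rewrite /G !ler_norml; lra.
  have mG : measurable_fun (I : set T) G by exact: measurable_funB.
  have := charge_intD nu mG bG m2 b2.
  have -> : (fun x => G x + Om2 x) = Om1 by apply/funext => x; rewrite /G subrK.
  by move=> ->; rewrite addrK.
rewrite NG (charge_int_subE _ _ m1 b1) (charge_int_subE _ _ m2 b2).
exact: (selection_monotone Bv1 Bv2 Sel1 Sel2 m1 b1 m2 b2).
Qed.

Lemma is_solution_meas (u0 : R -> R) (u Om : R -> R -> R) S :
  is_solution u0 u Om -> 0 < S -> meas_Q S u.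
Proof. by move=> [Hs _ _ _] S0; have [[mu _] _ _] := Hs _ S0. Qed.

(** The equation says that [u_t] is the weak derivative of the flux; as the flux is continuous in
    [x], it is a primitive of [u_t] at every point of [I]. *)
Lemma is_solution_slice u0 (u Om : R -> R -> R) S : is_solution u0 u Om -> 0 < S ->
  exists ut, [/\ L2_Q S ut, time_deriv S u ut &
    \forall t \ae leb R, 0 < t < S -> slice (u t) (Om t) (ut t)].
Proof.
move=> [Hs HC _ HD] S0; have [[_ [C HBV]] [_ [g _ HW]] [ut [Lut Hut HP]]] := Hs _ S0.
exists ut; split => //.
apply: (ae_mono (ae_and (ae_and HBV HW) (ae_and HP (ae_and HD (L2Q_ae Lut))))).
move=> t [[h1 h2] [h3 [h4 h5]]] tS; have [t0 _] := andP tS.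
have [Bv _] := h1 tS; have [cO LO _ _] := h2 tS; have [PDE Sel] := h3 tS.
have Lz := h5 tS.
split => //; last exact: h4.
have [g0 Hg] : exists c, forall x, -1 < x < 1 ->
    Om t x = c + \int[leb R]_(y in `]-1, x]) ut t y.
  apply: W_primitive; [lra| |exact: L2_int|exact: L2_int|].
  - move: cO; rewrite continuous_open_subspace; last exact: interval_open.
    by move=> cO x xI; apply: cO; rewrite inE.
  - by move=> phi tphi; rewrite (PDE _ tphi) opprK.
by exists g0 => x /itvI; exact: Hg.
Qed.

Lemma L2_Q_B S (u v : R -> R -> R) : L2_Q S u -> L2_Q S v ->
  L2_Q S (fun t x => u t x - v t x).
Proof.
move=> Lu Lv; have [mu uoo] := Lu; have [mv voo] := Lv.
have mJ := @measurable_itv R `]0, S[.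
split; first exact: measurable_funB.
have mn (w : R -> R -> R) : meas_Q S w ->
    measurable_fun (`]0%R, S[%classic : set T)
      (fun t => \int[leb R]_(x in I) ((w t x) ^+ 2)%:E)%E.
  move=> mw.
  have m2 : measurable_fun (`]0%R, S[%classic `*` (I : set T))
    (fun p : T * T => w p.1 p.2 ^+ 2) by exact: measurable_funX.
  have := @measurable_integral_abs _ _ T T R (leb R) (`]0%R, S[%classic : set T) I
    (fun t x => w t x ^+ 2) mJ mI m2.
  apply: eq_measurable_fun => t _; apply: eq_integral => x _.
  by rewrite gee0_abs// lee_fin sqr_ge0.
have k0 (w : R -> R -> R) t : (0 <= \int[leb R]_(x in I) ((w t x) ^+ 2)%:E)%E.
  by apply: integral_ge0 => x _; rewrite lee_fin sqr_ge0.
apply: (@le_lt_trans _ _ (\int[leb R]_(t in `]0%R, S[)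
  (2%:E * (\int[leb R]_(x in I) ((u t x) ^+ 2)%:E + \int[leb R]_(x in I) ((v t x) ^+ 2)%:E)))%E).
  apply: ge0_le_integral => //.
  - by move=> t _; apply: integral_ge0 => x _; rewrite lee_fin sqr_ge0.
  - by apply: mn; exact: measurable_funB.
  - by apply: emeasurable_funM => //; apply: emeasurable_funD; exact: mn.
  - move=> t; rewrite /= in_itv/= => tS.
    have mut := L2Q_mfun Lu tS; have mvt := L2Q_mfun Lv tS.
    have mX (f : R -> R) : measurable_fun (I : set T) f ->
        measurable_fun (I : set T) (fun x => (f x ^+ 2)%:E).
      by move=> mf; apply/measurable_EFinP; exact: measurable_funX.
    have s0 (f : R -> R) x : I x -> (0 <= (f x ^+ 2)%:E)%E.
      by move=> _; rewrite lee_fin sqr_ge0.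
    have mu2 := mX _ mut; have mv2 := mX _ mvt.
    have su := s0 (u t); have sv := s0 (v t).
    have muv := emeasurable_funD mu2 mv2.
    have suv x : I x -> (0 <= (u t x ^+ 2)%:E + (v t x ^+ 2)%:E)%E.
      by move=> Ix; rewrite adde_ge0 ?su ?sv.
    rewrite -(ge0_integralD _ mI su mu2 sv mv2) -(ge0_integralZl _ mI muv suv)//.
    have muv' : measurable_fun (I : set T) (fun x => u t x - v t x) by exact: measurable_funB.
    have h0 x : I x -> (0 <= (((u t x - v t x) ^+ 2)%:E : \bar R))%E.
      by move=> _; rewrite lee_fin sqr_ge0.
    apply: ge0_le_integral => //; first exact: mI.
    + by apply/measurable_EFinP; exact: (measurable_funX 2 muv').
    + by apply: emeasurable_funM.
    + move=> x _; rewrite -EFinD -EFinM lee_fin.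
      by have := sqr_ge0 (u t x + v t x); rewrite !expr2; lra.
rewrite ge0_integralZl//; last 2 first.
- by apply: emeasurable_funD; exact: mn.
- by move=> t _; rewrite adde_ge0.
apply: lte_mul_pinfty => //.
rewrite ge0_integralD//; [|exact: mn|exact: mn].
exact: lte_add_pinfty uoo voo.
Qed.

(** The null set in [x] may depend on [t], but no time is excluded: the squared norm of the
    difference is controlled at each [t]. *)
Theorem solution_unique u0 (u1 u2 Om1 Om2 : R -> R -> R) :
  is_solution u0 u1 Om1 -> is_solution u0 u2 Om2 ->
  forall t, 0 <= t -> \forall x \ae leb R, I x -> u1 t x = u2 t x.
Proof.
move=> H1 H2 b b0.
(* The horizon [b + 1] puts [b] strictly inside the window, since the time identities hold on an
   open interval. *)
have S0 : 0 < b + 1 by lra.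
have [_ HC1 I1 _] := H1; have [_ HC2 I2 _] := H2.
have [ut1 [Lz1 Tz1 sl1]] := is_solution_slice H1 S0.
have [ut2 [Lz2 Tz2 sl2]] := is_solution_slice H2 S0.
have C1 := HC1 _ S0; have C2 := HC2 _ S0.
have [L1 _] := C1; have [L2 _] := C2.
have M1 := is_solution_meas H1 S0; have M2 := is_solution_meas H2 S0.
pose w t x := u1 t x - u2 t x; pose z t x := ut1 t x - ut2 t x.
have Lw t : 0 <= t <= b + 1 -> L2_I (w t) by move=> tS; apply: L2_B; [exact: L1|exact: L2].
have Lw' t : 0 < t < b + 1 -> L2_I (w t) by move=> tS; apply: Lw; lra.
have Lz : L2_Q (b + 1) z by exact: L2_Q_B.
have wz chi : L2_I chi -> exists c, forall t, 0 < t < b + 1 ->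
    ip (w t) chi = c + \int[leb R]_(r in `]0, t]) ip (z r) chi.
  move=> Lc; have [c1 E1] := time_ip S0 M1 C1 Lz1 Tz1 Lc.
  have [c2 E2] := time_ip S0 M2 C2 Lz2 Tz2 Lc.
  exists (c1 - c2) => t tS; rewrite ipBl//; [|apply: L1; lra|apply: L2; lra].
  have sub (g : R -> R) : (leb R).-integrable `]0, b + 1[ (EFin \o g) ->
      (leb R).-integrable `]0, t] (EFin \o g).
    by apply: integrableS => // x; rewrite /= !in_itv/=; lra.
  have i1 := sub _ (L2Q_ip_integrable Lz1 Lc); have i2 := sub _ (L2Q_ip_integrable Lz2 Lc).
  rewrite E1// E2// [X in _ = _ + X](_ : _ =
     \int[leb R]_(r in `]0, t]) (ip (ut1 r) chi - ip (ut2 r) chi)); last first.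
    apply: Rintegral_ae_eq => //.
    - by apply: sub; exact: L2Q_ip_integrable.
    - exact: integrableRB.
    - apply: (ae_mono (ae_and (L2Q_ae Lz1) (L2Q_ae Lz2))) => r [r1 r2].
      rewrite /= in_itv/= => rt; rewrite ipBl//; [apply: r1; lra|apply: r2; lra].
  by rewrite (RintegralB _ i1 i2)// opprD addrACA.
have wz0 : \forall t \ae leb R, 0 < t < b + 1 -> ip (w t) (z t) <= 0.
  apply: (ae_mono (ae_and sl1 sl2)) => t [s1 s2] tS.
  exact: slice_monotone (s1 tS) (s2 tS).
have E0 : ip (w 0) (w 0) = 0.
  rewrite /ip; transitivity (\int[leb R]_(x in I) (0 : R)); last by rewrite Rintegral_cst ?mul0r//; exact: mI.
  apply: Rintegral_ae_eq; [exact: mI| |apply: integrable_cst1; [exact: mI|exact: leI_lty]|].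
  - by apply: L2_mul; apply: Lw; lra.
  - apply: (ae_mono (ae_and I1 I2)) => x [e1 e2] Ix.
    by rewrite /w (e1 Ix) (e2 Ix) subrr mul0r.
have Eb : ip (w b) (w b) <= 0.
  move: b0; rewrite le_eqVlt => /orP[/eqP <-|b0]; first by rewrite E0.
  apply/ler_addgt0Pr => e e0; rewrite add0r.
  have e4 : 0 < e / 4 by rewrite divr_gt0.
  have S00 : (0 : R) <= 0 <= b + 1 by lra.
  have [d1 d10 Hd1] := C_L2_eps C1 S00 e4; have [d2 d20 Hd2] := C_L2_eps C2 S00 e4.
  (* The energy is monotone only between positive times, so it is started at a small [a]. There
     [|w a|^2] is at most twice the sum of the squared distances of each solution to its initial
     value, each below [e / 4]. *)
  pose a := Num.min (Num.min (d1 / 2) (d2 / 2)) b.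
  have a0 : 0 < a by rewrite !lt_min b0 !divr_gt0.
  have [ad1 ad2 ab] : [/\ a <= d1 / 2, a <= d2 / 2 & a <= b].
    by split; rewrite !ge_min lexx ?orbT.
  apply: (le_trans (energy_nonincreasing Lw' Lz wz wz0 a0 ab (ltac:(lra)))).
  have aS : 0 <= a <= b + 1 by lra.
  have := Hd1 a aS; have := Hd2 a aS; rewrite sub0r normrN gtr0_norm//.
  move=> /(_ (ltac:(lra))) D2 /(_ (ltac:(lra))) D1.
  have [La Lb] : L2_I (fun x => u1 a x - u1 0 x) /\ L2_I (fun x => u2 a x - u2 0 x).
    by split; apply: L2_B; [exact: L1|exact: L1|exact: L2|exact: L2].
  suff : ip (w a) (w a) <= 2 * ip (fun x => u1 a x - u1 0 x) (fun x => u1 a x - u1 0 x) +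
    2 * ip (fun x => u2 a x - u2 0 x) (fun x => u2 a x - u2 0 x) by lra.
  have i1 := L2_mul La La; have i2 := L2_mul Lb Lb.
  rewrite /ip -!RintegralZl//.
  have j1 := integrableRZ mI 2 i1; have j2 := integrableRZ mI 2 i2.
  rewrite -(RintegralD mI j1 j2).
  apply: Rintegral_ae_le; [exact: mI| | |].
  - by apply: L2_mul; apply: Lw.
  - by apply: (integrableRD mI); exact: (integrableRZ mI).
  - apply: (ae_mono (ae_and I1 I2)) => x [e1 e2] Ix.
    rewrite /w (e1 Ix) (e2 Ix).
    by have := sqr_ge0 ((u1 a x - u0 x) + (u2 a x - u0 x)); rewrite expr2; lra.
have {}Eb : ip (w b) (w b) = 0 by apply/eqP; rewrite eq_le Eb ip_ge0.
have := ip0_ae (Lw b (ltac:(lra))) Eb.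
by move=> h; apply: (ae_mono h) => x hx Ix; apply/eqP; rewrite -subr_eq0; apply/eqP; exact: hx.
Qed.

End uniqueness.

(** * Profiles with slopes 1 and -1 *)

Section hat.
Context {R : realType}.
Local Notation T := (measurableTypeR R).
Implicit Types (f v w Om : R -> R) (nu : {charge set T -> \bar R})
  (A P : set T) (a b c t x y r k S : R).

Lemma int_le_step a x : -1 <= a -> -1 < x < 1 ->
  \int[leb R]_(y in `]-1, x]) (y <= a)%R%:R = Num.min x a + 1.
Proof.
move=> a1 /andP[x1 x2].
have m1 : Num.min x a < 1 by rewrite gt_min x2.
have m2 : -1 <= Num.min x a by rewrite le_min (ltW x1).
rewrite -(Rintegral_le_ind (leb R) (-1) (fun y => (y <= a)%R%:R) x2).
transitivity (\int[leb R]_(y in `]-1, 1[) (1 * (y <= Num.min x a)%R%:R)).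
  by apply: eq_Rintegral => y _; rewrite le_min; case: (y <= x); case: (y <= a); rewrite /=; ring.
by rewrite (Rintegral_le_ind (leb R) (-1) (fun=> 1) m1) Rintegral_itv_cst//; ring.
Qed.

(** Every slope and every rate in the explicit solutions is, up to a null set, a combination of at
    most three half-line indicators; this integrates them all. *)
Lemma step_primitive (c0 c1 c2 c3 : R) a b c x : -1 <= a -> -1 <= b -> -1 <= c ->
  -1 < x < 1 -> \int[leb R]_(y in `]-1, x]) (c0 + c1 * (y <= a)%R%:R +
    c2 * (y <= b)%R%:R + c3 * (y <= c)%R%:R) =
  c0 * (x + 1) + c1 * (Num.min x a + 1) + c2 * (Num.min x b + 1) + c3 * (Num.min x c + 1).
Proof.
move=> a1 b1 c1' x12; have /andP[x1 x2] := x12.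
have mx : measurable (`]-1, x]%classic : set T) by [].
have fx : (leb R (`](-1)%R, x]%classic : set T) < +oo)%E.
  by apply: (@itv_lt_pinfty _ _ (-1) x); exact: subset_itv_oc_cc.
have i1 d : (leb R).-integrable `]-1, x] (EFin \o (fun=> d : R)).
  by apply: integrable_cst1.
have i2 d e : (leb R).-integrable `]-1, x] (EFin \o (fun y => d * (y <= e)%R%:R)).
  exact: integrable_le_ind.
have i3 e : (leb R).-integrable `]-1, x] (EFin \o (fun y => (y <= e)%R%:R : R)).
  by apply: eq_integrable (i2 1 e) => // y _; rewrite /= mul1r.
have ia := integrableRD mx (i1 c0) (i2 c1 a).
have ib := integrableRD mx ia (i2 c2 b).
rewrite (RintegralD mx ib (i2 c3 c)) (RintegralD mx ia (i2 c2 b)) (RintegralD mx (i1 c0) (i2 c1 a)).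
rewrite (RintegralZl _ mx (i3 a)) (RintegralZl _ mx (i3 b)) (RintegralZl _ mx (i3 c)).
rewrite !int_le_step// Rintegral_itv_cst ?opprK//; exact: ltW.
Qed.

(** Where [| |x| - r |] increases: between the left kink and the peak at 0, and to the right of the
    right kink. *)
Definition hatP r : set T := `]- r, 0] `|` `]r, +oo[.

Lemma mhatP r : measurable (hatP r).
Proof. exact: measurableU. Qed.

Lemma hatPE r y : 0 <= r -> 2 * \1_(hatP r) y - 1 =
  1 + -2 * (y <= - r)%R%:R + -2 * (y <= r)%R%:R + 2 * (y <= 0)%R%:R :> R.
Proof.
move=> r0; rewrite indicE.
have -> : (y \in hatP r) = (- r < y <= 0) || (r < y).
  by rewrite /hatP in_setU !mem_setE !in_itv/= andbT.
have [h1|h1] := leP y (- r); have [h2|h2] := leP y r; have [h3|h3] := leP y 0; rewrite /=; try ring;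
  by exfalso; lra.
Qed.

Definition hat k r x := k + `| `|x| - r|.

Lemma hat_primitive k r x : 0 <= r -> r <= 1 -> -1 < x < 1 ->
  hat k r x = (k + 1 - r) + \int[leb R]_(y in `]-1, x]) (2 * \1_(hatP r) y - 1).
Proof.
move=> r0 r1 x12; under eq_Rintegral do rewrite (hatPE _ r0).
rewrite step_primitive//; [|lra|lra].
rewrite /hat; have [h1|h1] := leP x (- r); have [h2|h2] := leP x r; have [h3|h3] := leP x 0;
  try by exfalso; lra.
- by rewrite (ler0_norm h3) ger0_norm; lra.
- by rewrite (ler0_norm h3) ler0_norm; lra.
- by rewrite (gtr0_norm h3) ler0_norm; lra.
- by rewrite (gtr0_norm h3) ger0_norm; lra.
Qed.

Section fixed.
Variables (k r : R).
Hypotheses (r0 : 0 <= r) (r1 : r <= 1).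

Lemma hat_Dmeas : is_Dmeas (hat k r) (slopec (mhatP r)).
Proof. by apply: is_Dmeas_slope => x x12; exact: hat_primitive. Qed.

Lemma measurable_hat : measurable_fun (I : set T) (hat k r).
Proof.
apply: measurable_funD => //; apply: measurableT_comp => //.
by apply: measurable_funB => //; apply: measurable_funTS; exact: continuous_measurable_fun (@norm_continuous _ _).
Qed.

Lemma hat_bound x : I x -> `|hat k r x| <= `|k| + 1.
Proof.
move=> /itvI /andP[x1 x2]; rewrite (le_trans (ler_normD _ _))// lerD2l normr_id.
have h : 0 <= `|x| <= 1 by rewrite normr_ge0 ler_norml; lra.
have aux (s t : R) : 0 <= s <= 1 -> 0 <= t <= 1 -> `|s - t| <= 1.
  by move=> *; rewrite ler_norml; lra.
by apply: aux => //; rewrite r0 r1.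
Qed.

Lemma BV_hat : BV_I (hat k r).
Proof.
split; last by eexists; exact: hat_Dmeas.
exact: (bounded_integrableI measurable_hat hat_bound leI_lty).
Qed.

Let mP := mhatP r.
Let P := hatP r.

(** Splits the length of [A] within [I] into its parts in [P] and off [P]. The complement of the
    whole line is the negative part of the derivative of the identity and carries nothing. *)
Lemma lamm_split (A : set T) : measurable A -> exists p n,
  [/\ lamm mP A = p%:E, lamm (measurableC mP) A = n%:E,
     lamm (@measurableT _ T) A = (p + n)%:E & lamm (measurableC (@measurableT _ T)) A = 0].
Proof.
move=> mA.
have fP := @fin_num_measure _ _ _ (lamm mP) A mA.
have fN := @fin_num_measure _ _ _ (lamm (measurableC mP)) A mA.
exists (fine (lamm mP A)), (fine (lamm (measurableC mP) A)).
rewrite EFinD !fineK//; split => //; rewrite !lammE /lam.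
- rewrite -measureU//.
  + congr (leb R _); apply/seteqP; split => x.
      by move=> [Ax [_ Ix]]; case: (pselect (hatP r x)) => Px; [left|right].
    by move=> [[? [_ ?]]|[? [_ ?]]].
  + by apply: measurableI => //; apply: measurableI => //; exact: mI.
  + by apply: measurableI => //; apply: measurableI; [exact: measurableC|exact: mI].
  + by apply/seteqP; split => // x [[_ [? _]] [_ [? _]]].
- by rewrite setCT set0I setI0 measure0.
Qed.

Lemma lamT_I : lamm (@measurableT _ T) I = 2%:E.
Proof.
rewrite lammE /lam setTI setIid.
have /= := @lebesgue_measure_itv R `]-1, 1[; rewrite lte_fin gtrN ?ltr01// => E.
by apply: (etrans E); rewrite -EFinD opprK.
Qed.

(** The measure [D(v + x)] is twice Lebesgue measure on [P] and [D(v - x)] is minus twice Lebesgue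
    measure off [P]; the total is twice the length of [I]. The upper bound is the direction that a
    selection needs. *)
Lemma intW_hat : fine (intW (hat k r)) <= 4.
Proof.
have [iv Ev] := BV_hat.
have Dp := is_DmeasD iv integrable_id hat_Dmeas is_Dmeas_id.
have Dm := is_DmeasB iv integrable_id hat_Dmeas is_Dmeas_id.
have [p [n [Ep En Et Ez]]] := lamm_split mI.
have pn : p + n = 2 by move: Et; rewrite lamT_I => -[].
have zoo : ((mzero : {measure set T -> \bar R}) I < +oo)%E by rewrite /mzero ltry.
have calc1 (a b c d : \bar R) (q m : R) : a = q%:E -> b = m%:E -> c = (q + m)%:E ->
    d = 0%E -> (a - b + (c - d) = a + a)%E.
  by move=> -> -> -> ->; rewrite sube0 -EFinN -!EFinD; congr EFin; ring.
have calc2 (a b c d : \bar R) (q m : R) : a = q%:E -> b = m%:E -> c = (q + m)%:E ->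
    d = 0%E -> (a - b - (c - d) = - (b + b))%E.
  by move=> -> -> -> ->; rewrite sube0; apply: (congr1 EFin (_ : (q - m - (q + m) : R) = - (m + m))); ring.
have c1 : charge_diff (cadd (slopec mP) (slopec (@measurableT _ T)))
    (madd (lamm mP) (lamm mP)) mzero.
  split => //; first by apply: (@le_lt_trans _ _ (p%:E + p%:E)%E); [rewrite maddE -Ep|rewrite -EFinD ltry].
  move=> A mA _; rewrite maddE /mzero sube0 caddE /slopec !caddE !coppE.
  have [q [m [Eq Em Es E0]]] := lamm_split mA.
  exact: (calc1 _ _ _ _ _ _ Eq Em Es E0).
have c2 : charge_diff (cadd (slopec mP) (copp (slopec (@measurableT _ T))))
    mzero (madd (lamm (measurableC mP)) (lamm (measurableC mP))).
  split => //; first by apply: (@le_lt_trans _ _ (n%:E + n%:E)%E); [rewrite maddE -En|rewrite -EFinD ltry].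
  move=> A mA _; rewrite maddE /mzero add0e caddE coppE /slopec !caddE !coppE.
  have [q [m [Eq Em Es E0]]] := lamm_split mA.
  exact: (calc2 _ _ _ _ _ _ Eq Em Es E0).
have t1 := tvar_le c1; have t2 := tvar_le c2.
rewrite intW_fineE (tvar_ext (DmeasE Dp)) (tvar_ext (DmeasE Dm)).
have helper (X a : \bar R) (q : R) : X \is a fin_num -> (X <= a)%E -> a = q%:E -> fine X <= q.
  by move=> fX Xa aq; rewrite -lee_fin fineK// -aq.
have h1 := helper _ _ (p + p) (tvar_fin _) t1.
have h2 := helper _ _ (n + n) (tvar_fin _) t2.
have {}h1 : fine (tvar (cadd (slopec mP) (slopec (@measurableT _ T))) I) <= p + p.
  by apply: h1; rewrite maddE /mzero adde0; exact: (congr2 adde Ep Ep).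
have {}h2 : fine (tvar (cadd (slopec mP) (copp (slopec (@measurableT _ T)))) I) <= n + n.
  by apply: h2; rewrite maddE /mzero add0e; exact: (congr2 adde En En).
apply: (le_trans (lerD h1 h2)); lra.
Qed.

(** Fenchel's inequality for measures: on [[-2, 2]] the convex conjugate of [W] is [|q| - 2]. *)
Lemma intW_ge w Om : BV_I w -> measurable_fun I Om -> (forall x, I x -> `|Om x| <= 2) ->
  charge_int (Dmeas w) I Om + \int[leb R]_(x in I) (2 - `|Om x|) <= fine (intW w).
Proof.
move=> Bw mO bO; have [iw Ew] := Bw.
have Dp := is_DmeasD iw integrable_id (DmeasP Ew) is_Dmeas_id.
have Dm := is_DmeasB iw integrable_id (DmeasP Ew) is_Dmeas_id.
pose al x := Om x / 2 + (1 - `|Om x| / 2); pose be x := Om x / 2 - (1 - `|Om x| / 2).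
have mh : measurable_fun (I : set T) (fun x => Om x / 2) by exact: measurable_funM.
have mn : measurable_fun (I : set T) (fun x => 1 - `|Om x| / 2).
  apply: measurable_funB => //; apply: measurable_funM => //.
  exact: measurableT_comp.
have ma : measurable_fun (I : set T) al by exact: measurable_funD.
have mb : measurable_fun (I : set T) be by exact: measurable_funB.
have ba x : I x -> `|al x| <= 1.
  move=> /bO; have := ler_norm (Om x); have := ler_norm (- Om x); rewrite normrN /al.
  move: (Om x) (`|Om x|) => o n on1 on2 n2.
  by rewrite ler_norml; apply/andP; split; lra.
have bb x : I x -> `|be x| <= 1.
  move=> /bO; have := ler_norm (Om x); have := ler_norm (- Om x); rewrite normrN /be.
  move: (Om x) (`|Om x|) => o n on1 on2 n2.
  by rewrite ler_norml; apply/andP; split; lra.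
rewrite intW_fineE (tvar_ext (DmeasE Dp)) (tvar_ext (DmeasE Dm)).
have := charge_int_le_tvar (cadd (Dmeas w) (slopec (@measurableT _ T))) ma ba.
have := charge_int_le_tvar (cadd (Dmeas w) (copp (slopec (@measurableT _ T)))) mb bb.
rewrite (charge_int_subE _ _ mb bb) (charge_int_add _ _ ma ba).
rewrite (slope_int _ ma ba) (slope_int _ mb bb).
have sl (g : R -> R) : \int[leb R]_(x in I) ((2 * \1_[set: T] x - 1) * g x) =
    \int[leb R]_(x in I) g x.
  by apply: eq_Rintegral => x _; rewrite indicE in_setT /=; ring.
rewrite !sl !mul1r.
have <- : charge_int (Dmeas w) I al + charge_int (Dmeas w) I be = charge_int (Dmeas w) I Om.
  rewrite -(charge_intD _ ma ba mb bb); congr charge_int; apply/funext => x.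
  by rewrite /al /be; field.
have <- : \int[leb R]_(x in I) al x - \int[leb R]_(x in I) be x = \int[leb R]_(x in I) (2 - `|Om x|).
  rewrite -(RintegralB mI (bounded_integrableI ma ba leI_lty) (bounded_integrableI mb bb leI_lty)).
  by apply: eq_Rintegral => x _; rewrite /al /be; field.
move: (charge_int _ _ _) (charge_int _ _ _) (fine _) (fine _) => *; lra.
Qed.

(** The equality case of [intW_ge]: pairing the flux with the slope of the profile gives the
    integral of [|Om|], and adding that of [2 - |Om|] gives 4. *)
Lemma hat_selection Om : measurable_fun I Om -> (forall x, I x -> `|Om x| <= 2) ->
  (forall x, I x -> (2 * \1_P x - 1) * Om x = `|Om x|) -> selection (hat k r) Om.
Proof.
move=> mO bO sO w Bw.
have [iv Ev] := BV_hat.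
rewrite (charge_int_subE _ _ mO bO) (charge_int_ext mO bO (DmeasE hat_Dmeas)) (slope_int _ mO bO).
have -> : \int[leb R]_(x in I) ((2 * \1_(hatP r) x - 1) * Om x) = \int[leb R]_(x in I) `|Om x|.
  by apply: eq_Rintegral => x; rewrite inE => /sO.
have ge := intW_ge Bw mO bO; have le4 := intW_hat.
have mn : measurable_fun (I : set T) (fun x => `|Om x|) by exact: measurableT_comp.
have bn x : I x -> `| (`|Om x|) | <= 2 by move=> /bO; rewrite normr_id.
have i2 : (leb R).-integrable I (EFin \o (fun=> 2 : R)).
  by apply: integrable_cst1; [exact: mI|exact: leI_lty].
rewrite (RintegralB mI i2 (bounded_integrableI mn bn leI_lty)) in ge.
have E4 : \int[leb R]_(x in I) (2 : R) = 4.
  rewrite Rintegral_cst; last exact: mI.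
  have /= := @lebesgue_measure_itv R `]-1, 1[; rewrite lte_fin gtrN ?ltr01// => E.
  by rewrite (etrans (congr1 fine E) (_ : _ = 2))/= ?opprK//; ring.
rewrite E4 in ge.
move: ge le4.
have [q1 ->] : exists q, intW w = q%:E by eexists; exact: intW_fin.
have [q2 ->] : exists q, intW (hat k r) = q%:E by eexists; exact: intW_fin.
by move: (charge_int _ _ _) (\int[leb R]_(x in I) `|Om x|) => e1 e2 /=; rewrite -EFinD lee_fin; lra.
Qed.

End fixed.
End hat.

(** * Explicit solutions *)

Section explicit.
Context {R : realType}.
Local Notation T := (measurableTypeR R).
Implicit Types (f v w : R -> R) (u ut Om : R -> R -> R) (a b c t x y S : R) (k r : R -> R).

Lemma Rint_I_cst c : \int[leb R]_(x in I) c = 2 * c :> R.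
Proof.
rewrite Rintegral_cst; last exact: mI.
have /= := @lebesgue_measure_itv R `]-1, 1[; rewrite lte_fin gtrN ?ltr01// => E.
by rewrite mulrC; congr (_ * _); apply: (etrans (congr1 fine E)); rewrite /= opprK.
Qed.

Lemma integrable_I_cst c : (leb R).-integrable (I : set T) (EFin \o (fun=> c)).
Proof. by apply: integrable_cst1; [exact: mI|exact: leI_lty]. Qed.

Lemma ip_bounded f (M : R) : measurable_fun (I : set T) f ->
  (forall x, I x -> `|f x| <= M) -> ip f f <= 2 * M ^+ 2.
Proof.
move=> mf bf; have Lf := bounded_L2 mf bf.
rewrite -Rint_I_cst; apply: Rintegral_ae_le; [exact: mI|exact: L2_mul|exact: integrable_I_cst|].
exists set0; split => // x; rewrite /setC/= => nH; case: nH => Ix.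
have := bf x Ix; rewrite ler_norml => /andP[h1 h2].
have : 0 <= (M - f x) * (M + f x) by rewrite mulr_ge0//; lra.
by rewrite expr2; lra.
Qed.

Lemma bounded_L2Q S (f : R -> R -> R) (M : R) : meas_Q S f ->
  (forall t x, 0 < t < S -> I x -> `|f t x| <= M) -> L2_Q S f.
Proof.
move=> mf bf; split => //.
have m2 : measurable_fun (`]0%R, S[%classic `*` (I : set T))
    (fun p : T * T => f p.1 p.2 ^+ 2) by exact: measurable_funX.
apply: (@le_lt_trans _ _ (\int[leb R]_(t in `]0%R, S[) (2 * M ^+ 2)%:E)%E); last first.
  rewrite integral_cst//.
  have M0 : 0 <= 2 * M ^+ 2 by rewrite mulr_ge0// sqr_ge0.
  by rewrite lte_mul_pinfty// ?lee_fin//; exact: itvoo_lty.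
apply: ge0_le_integral => //.
- by move=> t _; apply: integral_ge0 => x _; rewrite lee_fin sqr_ge0.
- have := @measurable_integral_abs _ _ T T R (leb R) (`]0%R, S[%classic : set T) I
    (fun t x => f t x ^+ 2) (measurable_itv _) mI m2.
  apply: eq_measurable_fun => t _; apply: eq_integral => x _.
  by rewrite gee0_abs// lee_fin sqr_ge0.
- move=> t; rewrite /= in_itv/= => tS.
  have mft : measurable_fun (I : set T) (f t).
    by apply: (@measurable_section1 _ _ T T R (`]0%R, S[%classic : set T) I f).
  have bft x : I x -> `|f t x| <= M by exact: bf.
  by rewrite (L2_ipE (bounded_L2 mft bft)) lee_fin ip_bounded.
Qed.

Lemma hat_diff (k1 k2 r1 r2 : R) x : `|hat k1 r1 x - hat k2 r2 x| <= `|k1 - k2| + `|r1 - r2|.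
Proof.
rewrite /hat [X in `|X|](_ : _ = (k1 - k2) + (`| `|x| - r1| - `| `|x| - r2|)); last by ring.
apply: (le_trans (ler_normD _ _)); rewrite lerD2l.
apply: (le_trans (ler_dist_dist _ _)).
by rewrite opprB addrC addrA subrK distrC.
Qed.

Lemma measurable_fst_continuous (D : set (T * T)) f : measurable D -> continuous f ->
  measurable_fun D (fun p : T * T => f p.1).
Proof.
move=> mD cf; apply: measurable_funTS; apply: (measurableT_comp (f := f)) => //.
exact: continuous_measurable_fun.
Qed.

Lemma measurable_snd_continuous (D : set (T * T)) f : measurable D -> continuous f ->
  measurable_fun D (fun p : T * T => f p.2).
Proof.
move=> mD cf; apply: measurable_funTS; apply: (measurableT_comp (f := f)) => //.
exact: continuous_measurable_fun.
Qed.

Lemma primitive_time_deriv f u ut S : 0 < S ->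
  (forall x, I x -> (leb R).-integrable `]0, S[ (EFin \o ut^~ x)) ->
  (forall x t, 0 < t -> I x -> u t x = f x + \int[leb R]_(s in `]0, t]) ut s x) ->
  time_deriv S u ut.
Proof.
move=> S0 iut utE psi tpsi; exists set0; split => // x; rewrite /setC/= => nH; case: nH => Ix.
by apply: (AC_weak (c := f x) S0 (iut _ Ix) _ tpsi) => t /andP[t0 _]; exact: utE.
Qed.

Section profile.
Variables (k r : R -> R) (u0 : R -> R) (ut Om : R -> R -> R).
Hypotheses (ck : continuous k) (cr : continuous r).
Hypothesis r01 : forall t, 0 <= r t <= 1.
Let u t := hat (k t) (r t).

Lemma mQ S : measurable (`]0%R, S[%classic `*` (I : set T) : set (T * T)).
Proof. by apply: measurableX; [exact: measurable_itv|exact: mI]. Qed.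

Lemma meas_Q_hat S : meas_Q S u.
Proof.
rewrite /meas_Q /u /hat.
apply: measurable_funD; first exact: measurable_fst_continuous (mQ S) ck.
apply: measurableT_comp => //; apply: measurable_funB.
  exact: measurable_snd_continuous (mQ S) (@norm_continuous _ _).
exact: measurable_fst_continuous (mQ S) cr.
Qed.

Lemma C_L2_hat S : C_L2 S u.
Proof.
have Lu t : L2_I (u t).
  by have /andP[r0 r1] := r01 t; exact: bounded_L2 (measurable_hat _ _) (hat_bound _ r0 r1).
split => // s _.
suff H : (fun t : R => (\int[leb R]_(x in I) ((u t x - u s x) ^+ 2)%:E)%E) @ s --> 0%E.
  by apply: cvg_trans H; apply: cvg_app; exact: cvg_within.
apply/fine_cvgP; split.
  by apply: nearW => t; rewrite (L2_ipE (L2_B (Lu t) (Lu s))).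
apply/cvgrPdist_lt => e e0.
(* If [k] and [r] both move by less than [eta], the profile moves by at most [2 eta] and its squared
   norm by at most [8 eta^2]. This is at most [8 eta] because [eta <= 1], hence below [e]. *)
pose eta := Num.min 1 (e / 9).
have eta0 : 0 < eta by rewrite lt_min ltr01 divr_gt0.
have [eta1 eta2] : eta <= 1 /\ eta <= e / 9 by rewrite !ge_min !lexx orbT.
have Hk : \forall t \near s, `|k s - k t| < eta by have /cvgrPdist_lt/(_ _ eta0) := ck (x := s).
have Hr : \forall t \near s, `|r s - r t| < eta by have /cvgrPdist_lt/(_ _ eta0) := cr (x := s).
near=> t.
have E := L2_ipE (L2_B (Lu t) (Lu s)).
rewrite /= E /= sub0r normrN ger0_norm ?ip_ge0//.
have kt : `|k s - k t| < eta by near: t.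
have rt : `|r s - r t| < eta by near: t.
have b x : I x -> `|u t x - u s x| <= 2 * eta.
  move=> _; apply: (le_trans (hat_diff _ _ _ _ _)).
  by rewrite (distrC (k t)) (distrC (r t)); lra.
apply: (le_lt_trans (ip_bounded (L2_mfun (L2_B (Lu t) (Lu s))) b)).
have : eta ^+ 2 <= eta by rewrite expr2 ger_pMr.
by rewrite exprMn; lra.
Unshelve. all: by end_near. Qed.

(** The profile is at most [|k0| + 1] on an interval of length 2, and slopes of size 1 give total
    variation 2. *)
Lemma hat_BV_norm (k0 r0 : R) : 0 <= r0 <= 1 ->
  (BV_norm (hat k0 r0) <= (2 * (`|k0| + 1) + 2)%:E)%E.
Proof.
move=> /andP[h0 h1]; rewrite /BV_norm EFinD; apply: leeD.
  apply: (@le_trans _ _ (\int[leb R]_(x in I) (`|k0| + 1)%:E)%E).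
    apply: ge0_le_integral; [exact: mI|by []| | |].
    - by apply: measurableT_comp => //; apply/measurable_EFinP; exact: measurable_hat.
    - exact: measurable_cst.
    - by move=> x Ix; rewrite abse_EFin lee_fin; exact: hat_bound.
  rewrite integral_cst; last exact: mI.
  have /= E := @lebesgue_measure_itv R `]-1, 1[; move: E; rewrite lte_fin gtrN ?ltr01// => E.
  have {}E : leb R I = 2%:E by apply: (etrans E); rewrite -EFinD opprK.
  by rewrite E -EFinM mulrC.
rewrite (tvar_ext (DmeasE (hat_Dmeas k0 h0 h1))).
apply: le_trans (tvar_le (charge_diff_slope (mhatP r0))) _.
have [p [n [Ep En Et Ez]]] := lamm_split r0 mI.
have pn : p + n = 2 by move: Et; rewrite lamT_I => -[].
have <- : (p + n)%:E = 2%:E :> \bar R by rewrite pn.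
by rewrite EFinD; apply: leeD; [rewrite -Ep|rewrite -En].
Qed.

Hypothesis u0E : forall x, I x -> u 0 x = u0 x.
Hypothesis mOm : forall S, meas_Q S Om.
Hypothesis bOm : forall t x, 0 < t -> I x -> `|Om t x| <= 2.
Hypothesis Lut : forall S, 0 < S -> L2_Q S ut.
Hypothesis utL2 : forall t, 0 < t -> L2_I (ut t).
Hypothesis cOm : forall t, 0 < t -> continuous (Om t).
Hypothesis OmE : forall t, 0 < t -> exists g0, forall x, -1 < x < 1 ->
  Om t x = g0 + \int[leb R]_(y in `]-1, x]) ut t y.
Hypothesis sOm : forall t x, 0 < t -> I x ->
  (2 * \1_(hatP (r t)) x - 1) * Om t x = `|Om t x|.
Hypothesis iut : forall S x, 0 < S -> I x -> (leb R).-integrable `]0, S[ (EFin \o ut^~ x).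
Hypothesis utE : forall x t, 0 < t -> I x ->
  u t x = u0 x + \int[leb R]_(s in `]0, t]) ut s x.
Hypothesis dirO : forall t, 0 < t -> dirichlet0 (u t) (Om t).

(** Reduces both cases to pointwise checks: [OmE] makes [ut] the weak derivative of the flux, which
    is the equation, [sOm] is the equality case behind the selection, and [utE] yields the time
    derivative. *)
Lemma explicit_solution : is_solution u0 u Om.
Proof.
have all_ae (Q : R -> Prop) : (forall x, Q x) -> \forall x \ae leb R, Q x.
  by move=> H; exists set0; split => // x; rewrite /setC/= => nH; case: nH.
have PDE t phi : 0 < t -> test_function (-1) 1 phi ->
    \int[leb R]_(x in I) (Om t x * derive1 phi x) = - \int[leb R]_(x in I) (ut t x * phi x).
  move=> t0 tphi; have [g0 Hg] := OmE t0.
  by apply: (AC_weak _ (L2_int (utL2 t0)) Hg tphi); lra.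
have mOt t : 0 < t -> measurable_fun (I : set T) (Om t).
  by move=> t0; apply: measurable_funTS; apply: continuous_measurable_fun; exact: cOm.
split.
- move=> S S0; split.
  + split; first exact: meas_Q_hat.
    have [K HK] : exists K, forall t, 0 < t < S -> `|k t| <= K.
      have cK : {within `[0, S], continuous (fun t => `|k t|)}.
        apply: continuous_subspaceT => t.
        by apply: continuous_comp; [exact: ck|exact: norm_continuous].
      have [c _ H] := EVT_max (ltW S0) cK; exists (`|k c|) => t tS.
      by apply: H; rewrite in_itv/=; lra.
    exists (2 * (K + 1) + 2); apply: all_ae => t tS; have /andP[r0 r1] := r01 t.
    split; first exact: BV_hat.
    apply: le_trans (hat_BV_norm _ (r01 t)) _.
    by rewrite lee_fin; have := HK t tS; lra.
  + split; first by apply: (bounded_L2Q (M := 2)) => // t x /andP[t0 _]; exact: bOm.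
    exists ut; first exact: Lut.
    apply: all_ae => t /andP[t0 tS]; split.
    * by apply: continuous_subspaceT; exact: cOm.
    * by apply: (bounded_L2 (M := 2)); [exact: mOt|move=> x; exact: bOm].
    * exact: utL2.
    * by move=> phi; exact: PDE.
  + exists ut; split; first exact: Lut.
    * by apply: (primitive_time_deriv (f := u0)) => // x Ix; exact: iut.
    * apply: all_ae => t /andP[t0 tS]; split.
        by move=> phi tphi; rewrite (PDE _ _ t0 tphi) opprK.
      have /andP[r0 r1] := r01 t; apply: hat_selection => //; [exact: mOt| |].
        by move=> x; exact: bOm.
      by move=> x; exact: sOm.
- by move=> S _; exact: C_L2_hat.
- exact: all_ae.
- exact: all_ae.
Qed.

End profile.
End explicit.

(** * Traces of the profiles and integrability of the inverse square root *)

Section helpers.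
Context {R : realType}.
Local Notation T := (measurableTypeR R).
Implicit Types (f g v w : R -> R) (u ut Om : R -> R -> R) (a b c t x y S : R) (k r : R -> R).

Lemma ae_neq c : \forall x \ae leb R, x != c.
Proof.
exists [set c]; split; [exact: measurable_set1|exact: lebesgue_measure_set1|].
by move=> x /=; rewrite /setC/= => /negP/negPn/eqP.
Qed.

Lemma has_trace_lip f c (L : R) : (forall x, I x -> `|f x - f c| <= L * `|x - c|) ->
  has_trace f c (f c).
Proof.
move=> H; apply: has_trace_cvg => e e0.
have L0 : 0 < `|L| + 1 by rewrite ltr_wpDl.
exists (e / (`|L| + 1)); first by rewrite divr_gt0.
move=> x Ix; rewrite ltr_pdivlMr// => xe; apply: (le_lt_trans (H x Ix)); apply: le_lt_trans xe.
rewrite mulrC ler_wpM2l//; have := ler_norm L; lra.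
Qed.

Lemma hat_lip (k r : R) x y : `|hat k r x - hat k r y| <= `|x - y|.
Proof.
rewrite /hat opprD addrACA subrr add0r.
apply: (le_trans (ler_dist_dist _ _)); rewrite opprB addrA subrK.
exact: ler_dist_dist.
Qed.

Lemma hat_traces (k r : R) : r <= 1 ->
  has_trace (hat k r) (-1) (k + 1 - r) /\ has_trace (hat k r) 1 (k + 1 - r).
Proof.
move=> r1.
have E1 : hat k r 1 = k + 1 - r by rewrite /hat normr1 ger0_norm ?subr_ge0// addrA.
have E2 : hat k r (-1) = k + 1 - r by rewrite /hat normrN normr1 ger0_norm ?subr_ge0// addrA.
by split; [rewrite -E2|rewrite -E1]; apply: (has_trace_lip (L := 1)) => x _;
  rewrite mul1r hat_lip.
Qed.

Lemma int0_le_ind f a t : 0 < t ->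
  \int[leb R]_(s in `]0, t]) (f s * (s <= a)%R%:R) = \int[leb R]_(s in `]0, Num.min t a]) f s.
Proof.
move=> t0.
have t1 : t < t + 1 by rewrite ltrDl.
have m1 : Num.min t a < t + 1 by rewrite gt_min t1.
rewrite -(Rintegral_le_ind (leb R) 0 _ t1) -(Rintegral_le_ind (leb R) 0 _ m1).
by apply: eq_Rintegral => s _; rewrite le_min; case: (s <= t); case: (s <= a); rewrite /=; ring.
Qed.

Lemma continuous_min_cst a : continuous (fun t : R => Num.min t a).
Proof.
move=> t; apply: (@continuous_min R R (fun x => x) (fun=> a)); first exact: cvg_id.
exact: cvg_cst.
Qed.

Lemma measurable_lt_nat d (X : measurableType d) (D : set X) (F G : X -> R) :
  measurable D -> measurable_fun D F -> measurable_fun D G ->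
  measurable_fun D (fun p => (F p < G p)%R%:R : R).
Proof.
move=> mD mF mG; rewrite (_ : (fun p => _) = fun p => if F p < G p then 1 else 0 : R).
  apply: measurable_fun_if => //.
  exact: measurable_fun_ltr.
by apply/funext => p; case: (F p < G p).
Qed.

(** The derivative of [sqrt(2s)], that is, the speed of the kinks in (b). *)
Definition isq (s : R) := (Num.sqrt (2 * s))^-1.

Lemma isq_continuous s : 0 < s -> {for s, continuous isq}.
Proof.
move=> s0; rewrite /isq; apply: cvgV; first by rewrite sqrtr_eq0 -ltNge mulr_gt0.
have c2 : {for (s : R), continuous (fun s : R => 2 * s)}.
  by apply: cvgM; [exact: cvg_cst|exact: cvg_id].
exact: (continuous_comp c2 (@sqrt_continuous R (2 * s))).
Qed.

Lemma is_derive_sqrt2 (s : R) : 0 < s ->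
  is_derive s 1 (fun s : R => Num.sqrt 2 * Num.sqrt s) (isq s).
Proof.
move=> s0.
suff <- : Num.sqrt 2 * (2 * Num.sqrt s)^-1 = isq s by exact: is_deriveZ (is_derive1_sqrt s0).
rewrite /isq sqrtrM//.
have : Num.sqrt 2 != 0 :> R by rewrite sqrtr_eq0 -ltNge.
have : Num.sqrt s != 0 by rewrite sqrtr_eq0 -ltNge.
have : Num.sqrt 2 * Num.sqrt 2 = 2 :> R by rewrite -expr2 sqr_sqrtr.
move: (Num.sqrt 2) (Num.sqrt s) => p q pp q0 p0; rewrite -pp; field.
by rewrite p0 q0.
Qed.

Lemma int_isq a b : 0 < a -> a <= b ->
  (\int[leb R]_(s in `]a, b]) (isq s)%:E = (Num.sqrt (2 * b) - Num.sqrt (2 * a))%:E)%E.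
Proof.
move=> a0; rewrite le_eqVlt => /orP[/eqP <-|ab].
  by rewrite subrr set_itv_ge ?integral_set0// bnd_simp ltxx.
have cq : {within `[a, b], continuous isq}.
  apply: continuous_in_subspaceT => x; rewrite inE/= in_itv/= => /andP[ax _].
  by apply: isq_continuous; exact: lt_le_trans ax.
rewrite integral_itv_obnd_cbnd; last first.
  have := @subset_itv_oc_cc _ _ a b => sub; apply/measurable_EFinP.
  apply: (measurable_funS (measurable_itv `[a, b])) => //.
  by apply: subspace_continuous_measurable_fun => //.
rewrite (@continuous_FTC2 _ _ (fun s => Num.sqrt 2 * Num.sqrt s))//.
- by rewrite -!sqrtrM.
- have cF : continuous (fun s : R => Num.sqrt 2 * Num.sqrt s).
    by move=> x; apply: cvgM; [exact: cvg_cst|exact: sqrt_continuous].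
  split.
  + move=> x; rewrite in_itv/= => /andP[ax _].
    by have [] := is_derive_sqrt2 (lt_trans a0 ax).
  + by apply: cvg_at_right_filter; exact: cF.
  + by apply: cvg_at_left_filter; exact: cF.
- move=> x; rewrite in_itv/= => /andP[ax _].
  by rewrite derive1E; have := is_derive_sqrt2 (lt_trans a0 ax) => dF; rewrite derive_val.
Qed.

Lemma isq_ge0 s : 0 <= isq s.
Proof. by rewrite /isq invr_ge0 sqrtr_ge0. Qed.

Lemma measurable_isq (D : set T) : measurable D -> (forall s, D s -> 0 < s) ->
  measurable_fun D isq.
Proof.
move=> mD D0.
have H : measurable_fun (`]0%R, +oo[%classic : set T) isq.
  apply: open_continuous_measurable_fun; first exact: interval_open.
  by move=> s; rewrite inE/= in_itv/= andbT; exact: isq_continuous.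
apply: (measurable_funS _ _ H) => // s /D0; rewrite /= in_itv/= => ->//.
Qed.

(** The singularity at 0 is approached by monotone convergence along []1/(n+1), b]], where the
    fundamental theorem gives integrals bounded by [sqrt(2b)]. *)
Lemma isq_lty b : 0 < b -> (\int[leb R]_(s in `]0%R, b]) (isq s)%:E < +oo)%E.
Proof.
move=> b0; pose F n : set T := `](n.+1%:R^-1 : R), b]%classic.
have n1 n : 0 < n.+1%:R^-1 :> R by rewrite invr_gt0.
have UF : \bigcup_n F n = `]0%R, b]%classic.
  apply/seteqP; split => [s [n _]|s]; rewrite /F /= !in_itv/= => /andP[h sb].
    by rewrite sb andbT; move: (n1 n) h; exact: lt_trans.
  have [N _ /(_ N (leqnn N)) /= HN] := near_infty_natSinv_lt (PosNum h).
  by exists N => //; rewrite /F /= in_itv/= HN.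
have mF i : measurable (F i) by exact: measurable_itv.
have nF : nondecreasing_seq F.
  move=> i j ij; apply/subsetPset => s; rewrite /F /= !in_itv/= => /andP[h ->]; rewrite andbT.
  by apply: le_lt_trans h; rewrite lef_pV2 ?posrE// ler_nat.
have mf i : measurable_fun (F i) (EFin \o isq).
  apply/measurable_EFinP; apply: measurable_isq => // s; rewrite /F /= in_itv/= => /andP[h _].
  exact: lt_trans (n1 i) h.
have f0 i s : F i s -> (0 <= (EFin \o isq) s)%E by move=> _; rewrite /= lee_fin isq_ge0.
have H := @ge0_nondecreasing_set_cvg_integral _ T R F (EFin \o isq) (leb R) nF mF mf f0.
rewrite UF in H.
apply: (@le_lt_trans _ _ (Num.sqrt (2 * b))%:E); last exact: ltry.
rewrite -(cvg_lim _ H)//; apply: lime_le; first by apply/cvg_ex; eexists; exact: H.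
near=> n; have nb : n.+1%:R^-1 <= b.
  near: n; have [N _ HN] := near_infty_natSinv_lt (PosNum b0).
  by exists N => // n Nn; apply: ltW; exact: HN.
by rewrite (int_isq (n1 n) nb) lee_fin lerBlDr lerDl sqrtr_ge0.
Unshelve. all: by end_near. Qed.

End helpers.

(** * The explicit solution of (a) *)

Section caseA.
Context {R : realType}.
Local Notation T := (measurableTypeR R).
Variable d : R.
Hypothesis d1 : 1 < d.
Let Te := (d - 1) / 2.
Implicit Types (t x s : R).

Definition kA t := d - 1 - 2 * Num.min t Te.
Definition utA t x : R := -2 * (t <= Te)%R%:R.
(** After extinction the flux is constant in [x], and 0 is the constant that suits slopes of both
    signs in [Om v_x = |Om|]. *)
Definition OmA t x : R := -2 * (t <= Te)%R%:R * x.

Let Te0 : 0 < Te. Proof. by have := d1; rewrite /Te; lra. Qed.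

Lemma OmA_primitive t x : -1 < x < 1 ->
  OmA t x = 2 * (t <= Te)%R%:R + \int[leb R]_(y in `]-1, x]) utA t y.
Proof.
move=> /andP[x1 x2]; rewrite (Rintegral_itv_cst _ (ltW x1)) /OmA; ring.
Qed.

Lemma L2_utA t : L2_I (utA t).
Proof.
apply: (@bounded_L2 _ _ `|-2 * (t <= Te)%R%:R|); first exact: measurable_cst.
by [].
Qed.

Lemma L2Q_utA S : L2_Q S utA.
Proof.
have n2 : `|-2| = 2 :> R by rewrite normrN ger0_norm.
apply: (bounded_L2Q (M := 2)).
  apply: (@measurable_fstJ _ S (fun t => -2 * (t <= Te)%R%:R)); apply: measurable_funM => //.
  by apply: measurable_funTS; apply: measurable_le_nat.
move=> t x _ _; rewrite /utA !normrM n2.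
by case: (t <= Te); rewrite /= ?normr1 ?normr0; lra.
Qed.

Lemma integrable_utA S x : (leb R).-integrable `]0, S[ (EFin \o utA^~ x).
Proof.
have n2 : `|-2| = 2 :> R by rewrite normrN ger0_norm.
apply: (bounded_integrable (M := 2)) => //; first exact: itvoo_lty.
  apply: measurable_funM => //.
  by apply: measurable_funTS; apply: measurable_le_nat.
move=> t _; rewrite /utA !normrM n2.
by case: (t <= Te); rewrite /= ?normr1 ?normr0; lra.
Qed.

Lemma utA_int x t : 0 < t -> I x ->
  hat (kA t) 1 x = - `|x| + d + \int[leb R]_(s in `]0, t]) utA s x.
Proof.
move=> t0 /itvI x12; rewrite /utA.
rewrite (@int0_le_ind R (fun=> -2) Te t t0) Rintegral_itv_cst; last by rewrite le_min (ltW t0) ltW.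
rewrite /hat /kA ler0_norm; first by ring.
by have : `|x| <= 1 by [rewrite ler_norml; lra]; lra.
Qed.

Lemma time_deriv_A S : 0 < S -> time_deriv S (fun t => hat (kA t) 1) utA.
Proof.
move=> S0; apply: (primitive_time_deriv (f := fun x => - `|x| + d)) => // x.
- by move=> _; exact: integrable_utA.
- by move=> t; exact: utA_int.
Qed.

Lemma solutionA : is_solution (fun x => - `|x| + d) (fun t => hat (kA t) 1) OmA.
Proof.
have n2 : `|-2| = 2 :> R by rewrite normrN ger0_norm.
have d1' := d1.
apply: (@explicit_solution _ kA (fun=> 1) _ utA).
- move=> t; apply: cvgB; first exact: cvg_cst.
  by apply: cvgM; [exact: cvg_cst|exact: continuous_min_cst].
- by move=> t; exact: cvg_cst.
- by move=> t; rewrite ler01 lexx.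
- move=> x /itvI x12; rewrite /hat /kA min_l ?(ltW Te0)// ler0_norm; first by ring.
  by have : `|x| <= 1 by [rewrite ler_norml; lra]; lra.
- move=> S; apply: measurable_funM; last exact: (measurable_sndI (chi := fun x => x)).
  apply: (@measurable_fstJ _ S (fun t => -2 * (t <= Te)%R%:R)); apply: measurable_funM => //.
  by apply: measurable_funTS; apply: measurable_le_nat.
- move=> t x _ /itvI x12; rewrite /OmA !normrM n2.
  have : `|x| <= 1 by rewrite ler_norml; lra.
  by case: (t <= Te); rewrite /= ?normr1 ?normr0; lra.
- by move=> S _; exact: L2Q_utA.
- by move=> t _; exact: L2_utA.
- by move=> t _ x; apply: cvgM; [exact: cvg_cst|exact: cvg_id].
- by move=> t _; exists (2 * (t <= Te)%R%:R) => x; exact: OmA_primitive.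
- move=> t x _ /itvI /andP[x1 x2]; rewrite hatPE// /OmA.
  have -> : (x <= -1) = false by apply/negbTE; rewrite -ltNge.
  rewrite (ltW x2).
  case: (t <= Te); rewrite /= ?mulr0 ?mul0r ?mulr0 ?normr0//.
  have [x0|x0] := leP x 0; rewrite /=.
    by rewrite ger0_norm; lra.
  by rewrite ler0_norm; lra.
- by move=> S x _ _; exact: integrable_utA.
- by move=> x t; exact: utA_int.
- move=> t t0.
  have HO (x : R) : I x -> OmA t x = 2 * (t <= Te)%R%:R + \int[leb R]_(y in `]-1, x]) utA t y.
    by move=> /itvI; exact: OmA_primitive.
  have [t1 t2] := primitive_traces (L2_utA t) HO.
  have [h1 h2] := hat_traces (kA t) (lexx 1).
  rewrite Rint_I_cst in t2.
  split; (do 2 eexists; split; [eassumption|eassumption|]); rewrite /kA;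
    have [tT|tT] := leP t Te; rewrite /=.
  (* At the extinction time itself the trace already vanishes, so the first alternative applies
     there although [t <= Te]. *)
  + have [e|n] := eqVneq t Te; [constructor 1|constructor 2]; first by rewrite e /Te; field.
    have {n}tT : t < Te by rewrite lt_neqAle n.
    by split; [move: tT; rewrite /Te; lra|ring].
  + by constructor 1; rewrite /Te; field.
  + have [e|n] := eqVneq t Te; [constructor 1|constructor 2]; first by rewrite e /Te; field.
    have {n}tT : t < Te by rewrite lt_neqAle n.
    by split; [move: tT; rewrite /Te; lra|ring].
  + by constructor 1; rewrite /Te; field.
Qed.

End caseA.

(** * The explicit solution of (b) *)

Section caseB.
Context {R : realType}.
Local Notation T := (measurableTypeR R).

Lemma step_integral_I (c0 c1 c2 a b : R) : -1 <= a <= 1 -> -1 <= b <= 1 ->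
  \int[leb R]_(y in I) (c0 + c1 * (y <= a)%R%:R + c2 * (y <= b)%R%:R) =
  c0 * 2 + c1 * (a + 1) + c2 * (b + 1).
Proof.
have i1 (c : R) := integrable_I_cst c.
have i2 (c e : R) : (leb R).-integrable I (EFin \o (fun y => c * (y <= e)%R%:R)).
  by apply: integrable_le_ind => //; exact: mI.
have i3 (e : R) : (leb R).-integrable I (EFin \o (fun y => (y <= e)%R%:R : R)).
  by apply: eq_integrable (i2 1 e) => [|y _]; [exact: mI|rewrite /= mul1r].
have E (e : R) : -1 <= e <= 1 -> \int[leb R]_(y in I) (y <= e)%R%:R = e + 1.
  move=> /andP[e1]; rewrite le_eqVlt => /orP[/eqP ->|e2].
    transitivity (\int[leb R]_(y in I) (1 : R)); last by rewrite Rint_I_cst; ring.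
    by apply: eq_Rintegral => y; rewrite inE => /itvI /andP[_ /ltW ->].
  transitivity (\int[leb R]_(y in I) (1 * (y <= e)%R%:R)).
    by apply: eq_Rintegral => y _; rewrite mul1r.
  by rewrite (Rintegral_le_ind (leb R) (-1) (fun=> 1) e2) Rintegral_itv_cst//; ring.
move=> ha hb.
have ia := integrableRD mI (i1 c0) (i2 c1 a).
rewrite (RintegralD mI ia (i2 c2 b)) (RintegralD mI (i1 c0) (i2 c1 a)).
rewrite (RintegralZl _ mI (i3 a)) (RintegralZl _ mI (i3 b)).
by rewrite !E// Rint_I_cst; ring.
Qed.

(** Indicators of [y <= a] are closed on the right, so the point [- r] has to be excluded. The last
    term pads the sum to the three thresholds of [step_primitive]. *)
Lemma far_indE (r y : R) : 0 <= r -> y != - r ->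
  (r < `|y|)%R%:R = 1 + -1 * (y <= r)%R%:R + 1 * (y <= - r)%R%:R + 0 * (y <= r)%R%:R :> R.
Proof.
move=> r0 yr; rewrite ltr_normr ltrNr.
have [h1|h1] := leP y r; have [h2|h2] := leP y (- r); have [h3|h3] := ltP y (- r);
  rewrite /=; try ring; try by exfalso; lra.
Qed.

Variable e : R.
Hypotheses (e1 : -1 <= e) (e2 : e < 1).
Implicit Types (t x s : R).
(* sB t is the distance of the moving kinks from the boundary; it equals
   sqrt(2t) up to the extinction time TB, where isq t is its inverse. *)
Definition TB := (1 - e) ^+ 2 / 8.
Definition sB t := Num.sqrt (2 * Num.min t TB).
Definition rB t := 1 - sB t.
Definition kB t := e - rB t.
Definition cB t : R := 2 * isq t * (t <= TB)%R%:R.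
(** Only the two strips between the kinks and the boundary move, at the common rate 2 divided by
    their width. *)
Definition utB t x : R := cB t * (rB t < `|x|)%R%:R.
(** [cB t] times the signed distance from [x] to the interval [[- rB t, rB t]], negative on the
    left. Minima are used because [step_primitive] produces them. *)
Definition OmB t x : R := cB t * (x - Num.min x (rB t) + rB t + Num.min x (- rB t)).

Lemma TB_gt0 : 0 < TB.
Proof. by rewrite /TB divr_gt0// exprn_gt0// subr_gt0. Qed.

Lemma sqrt_TB : Num.sqrt (2 * TB) = (1 - e) / 2.
Proof.
have -> : 2 * TB = ((1 - e) / 2) ^+ 2 by rewrite /TB; field.
by rewrite sqrtr_sqr ger0_norm//; have := e2; lra.
Qed.

Lemma sB_ge0 t : 0 <= sB t. Proof. exact: sqrtr_ge0. Qed.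

Lemma sB_le t : sB t <= (1 - e) / 2.
Proof.
rewrite -sqrt_TB ler_sqrt; last by rewrite pmulr_rge0// ltW// TB_gt0.
by rewrite ler_pM2l// ge_min lexx orbT.
Qed.

Lemma sBE t : t <= TB -> sB t = Num.sqrt (2 * t).
Proof. by move=> h; rewrite /sB min_l. Qed.

Lemma sB_end t : TB <= t -> sB t = (1 - e) / 2.
Proof. by move=> h; rewrite /sB min_r// sqrt_TB. Qed.

Lemma sB_lt t : t < TB -> sB t < (1 - e) / 2.
Proof.
move=> h; rewrite (sBE (ltW h)) -sqrt_TB ltr_sqrt; last by rewrite pmulr_rgt0// TB_gt0.
by rewrite ltr_pM2l.
Qed.

Lemma isq_sB t : 0 < t -> t <= TB -> isq t * sB t = 1.
Proof.
by move=> t0 h; rewrite (sBE h) /isq mulVf// sqrtr_eq0 -ltNge mulr_gt0.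
Qed.

Lemma cB_sB t : 0 < t -> cB t * sB t = 2 * (t <= TB)%R%:R.
Proof.
move=> t0; rewrite /cB; have [h|_] := leP t TB; last by rewrite mulr0 mul0r mulr0.
by rewrite mulr1 -mulrA isq_sB// !mulr1.
Qed.

Lemma cB_ge0 t : 0 <= cB t.
Proof. by rewrite /cB mulr_ge0// mulr_ge0// isq_ge0. Qed.

(** The kinks stop at [(1 + e) / 2]; the assumption [-1 <= e] keeps them from crossing at the
    origin. *)
Lemma rB01 t : 0 <= rB t <= 1.
Proof. by rewrite /rB; have := sB_ge0 t; have := sB_le t; have := e1; lra. Qed.

Lemma sB_continuous : continuous sB.
Proof.
move=> t.
have c1 : {for t, continuous (fun t => 2 * Num.min t TB)}.
  by apply: cvgM; [exact: cvg_cst|exact: continuous_min_cst].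
exact: (continuous_comp c1 (@sqrt_continuous R _)).
Qed.

Lemma rB_continuous : continuous rB.
Proof. by move=> t; apply: cvgB; [exact: cvg_cst|exact: sB_continuous]. Qed.

Lemma kB_continuous : continuous kB.
Proof. by move=> t; apply: cvgB; [exact: cvg_cst|exact: rB_continuous]. Qed.

Lemma measurable_utB t : measurable_fun (I : set T) (utB t).
Proof.
apply: measurable_funM; first exact: measurable_cst.
apply: measurable_lt_nat; [exact: mI|exact: measurable_cst|].
by apply: measurable_funTS; exact: continuous_measurable_fun (@norm_continuous _ _).
Qed.

Lemma L2_utB t : L2_I (utB t).
Proof.
apply: (@bounded_L2 _ _ `|cB t|); first exact: measurable_utB.
by move=> x _; rewrite /utB; case: (_ < _); rewrite ?mulr1 ?mulr0 ?normr0.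
Qed.

(** This is the total rise of the flux, from -2 at the left endpoint to 2 at the right one. *)
Lemma int_utB t : 0 < t -> \int[leb R]_(y in I) utB t y = 4 * (t <= TB)%R%:R.
Proof.
move=> t0; have /andP[r0 r1] := rB01 t.
transitivity (\int[leb R]_(y in I)
    (cB t + (- cB t) * (y <= rB t)%R%:R + cB t * (y <= - rB t)%R%:R)).
  apply: Rintegral_ae_eq; [exact: mI|exact: L2_int (L2_utB t)| |].
  - apply: (integrableRD mI).
      apply: (integrableRD mI); first exact: integrable_I_cst.
      by apply: integrable_le_ind; [exact: mI|exact: integrable_I_cst].
    by apply: integrable_le_ind; [exact: mI|exact: integrable_I_cst].
  - apply: (ae_mono (ae_neq (- rB t))) => y yr _.
    by rewrite /utB far_indE//; ring.
rewrite step_integral_I; [|lra|lra].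
have := cB_sB t0; rewrite /rB; move: (cB t) (sB t) => c s cs.
by transitivity (2 * (c * s)); [ring|rewrite cs; ring].
Qed.

Lemma OmB_primitive t x : 0 < t -> -1 < x < 1 ->
  OmB t x = -2 * (t <= TB)%R%:R + \int[leb R]_(y in `]-1, x]) utB t y.
Proof.
move=> t0 x12; have /andP[r0 r1] := rB01 t; have /andP[x1 x2] := x12.
have sub : `]-1, x]%classic `<=` (I : set T).
  by move=> y; rewrite /Iint /= !in_itv/=; lra.
have i1 (c a : R) : (leb R).-integrable `]-1, x] (EFin \o (fun y => c * (y <= a)%R%:R)).
  apply: (integrableS mI _ sub) => //.
  by apply: integrable_le_ind; [exact: mI|exact: integrable_I_cst].
have i0 (c : R) : (leb R).-integrable `]-1, x] (EFin \o (fun=> c)).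
  by apply: (integrableS mI _ sub) => //; exact: integrable_I_cst.
have mx : measurable (`]-1, x]%classic : set T) by exact: measurable_itv.
have -> : \int[leb R]_(y in `]-1, x]) utB t y = \int[leb R]_(y in `]-1, x])
    (cB t + (- cB t) * (y <= rB t)%R%:R + cB t * (y <= - rB t)%R%:R + 0 * (y <= rB t)%R%:R).
  apply: Rintegral_ae_eq => //.
  - by apply: (integrableS mI _ sub) => //; exact: L2_int (L2_utB t).
  - by do 3 apply: (integrableRD mx) => //.
  - apply: (ae_mono (ae_neq (- rB t))) => y yr _.
    by rewrite /utB far_indE//; ring.
rewrite step_primitive//; [|lra|lra|lra].
have := cB_sB t0; rewrite /OmB; have -> : rB t = 1 - sB t by [].
move: (cB t) (sB t) (Num.min _ _) (Num.min _ _) => c s m1 m2 cs.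
have -> : -2 * (t <= TB)%R%:R = - (2 * (t <= TB)%R%:R) :> R by ring.
by rewrite -cs; ring.
Qed.

Lemma measurable_utBQ S : meas_Q S utB.
Proof.
rewrite /meas_Q /utB; apply: measurable_funM.
  apply: (@measurable_fstJ _ S cB); apply: measurable_funM.
    apply: measurable_funM => //; apply: measurable_isq; first exact: measurable_itv.
    by move=> s; rewrite /= in_itv/= => /andP[].
  by apply: measurable_funTS; apply: measurable_le_nat.
apply: measurable_lt_nat; first exact: mQ.
  exact: measurable_fst_continuous (mQ S) rB_continuous.
exact: measurable_snd_continuous (mQ S) (@norm_continuous _ _).
Qed.

(** The rate takes only the values 0 and [cB t], so its square is [cB t] times itself. Although it
    is unbounded as [t] tends to 0, its squared norm grows only like [t^(-1/2)], which is
    integrable. *)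
Lemma ip_utB t : 0 < t -> ip (utB t) (utB t) <= 8 * isq t.
Proof.
move=> t0; rewrite /ip [leLHS](_ : _ = \int[leb R]_(x in I) (cB t * utB t x)).
  rewrite RintegralZl; [|exact: mI|exact: L2_int (L2_utB t)].
  rewrite int_utB// /cB; have := isq_ge0 t.
  by case: (t <= TB); rewrite /=; lra.
by apply: eq_Rintegral => x _; rewrite /utB; case: (_ < _); rewrite /=; ring.
Qed.

Lemma L2Q_utB S : 0 < S -> L2_Q S utB.
Proof.
move=> S0; split; first exact: measurable_utBQ.
have misq (D : set T) : measurable D -> D `<=` `]0, S]%classic ->
    measurable_fun D (fun t => (8 * isq t)%:E).
  move=> mD DS; apply/measurable_EFinP; apply: measurable_funM => //.
  by apply: measurable_isq => // s /DS; rewrite /= in_itv/= => /andP[].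
have sub : `]0, S[%classic `<=` (`]0, S]%classic : set T).
  by move=> s; rewrite /= !in_itv/= => /andP[-> /ltW ->].
apply: (@le_lt_trans _ _ (\int[leb R]_(t in `]0%R, S[) (8 * isq t)%:E)%E).
  apply: ge0_le_integral => //.
  - by move=> t _; apply: integral_ge0 => x _; rewrite lee_fin sqr_ge0.
  - have m2 : measurable_fun (`]0%R, S[%classic `*` (I : set T))
      (fun p : T * T => utB p.1 p.2 ^+ 2) by apply: measurable_funX; exact: measurable_utBQ.
    have := @measurable_integral_abs _ _ T T R (leb R) (`]0%R, S[%classic : set T) I
      (fun t x => utB t x ^+ 2) (measurable_itv _) mI m2.
    apply: eq_measurable_fun => t _; apply: eq_integral => x _.
    by rewrite gee0_abs// lee_fin sqr_ge0.
  - exact: misq.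
  - by move=> t; rewrite /= in_itv/= => /andP[t0 _]; rewrite (L2_ipE (L2_utB t)) lee_fin ip_utB.
apply: (@le_lt_trans _ _ (\int[leb R]_(t in `]0%R, S]) (8 * isq t)%:E)%E).
  apply: ge0_subset_integral => //; [exact: misq|].
  by move=> t _; rewrite lee_fin mulr_ge0// isq_ge0.
under eq_integral do rewrite EFinM.
rewrite ge0_integralZl//.
- by apply: lte_mul_pinfty => //; exact: isq_lty.
- apply/measurable_EFinP; apply: measurable_isq => // s; rewrite /= in_itv/= => /andP[]//.
- by move=> t _; rewrite lee_fin isq_ge0.
Qed.

Lemma OmB_core_bound t x : -1 < x < 1 ->
  `|x - Num.min x (rB t) + rB t + Num.min x (- rB t)| <= sB t.
Proof.
have /andP[r0 r1] := rB01 t; have -> : sB t = 1 - rB t by rewrite /rB; ring.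
move: (rB t) r0 r1 => r r0 r1 x12.
by have [h1|h1] := leP x r; have [h2|h2] := leP x (- r); rewrite ler_norml; lra.
Qed.

(** Inverts the motion of the kinks: they reach the points at distance [1 - |x|] from the boundary
    at time [(1 - |x|)^2 / 2]. *)
Lemma far_iff t x : 0 < t -> t <= TB -> I x ->
  (rB t < `|x|) = ((1 - `|x|) ^+ 2 / 2 < t).
Proof.
move=> t0 tT /itvI x12; have x1 : 0 <= 1 - `|x| by have : `|x| <= 1 by [rewrite ler_norml; lra]; lra.
rewrite /rB ltrBlDr -ltrBlDl (sBE tT).
rewrite -[LHS](@ltr_pXn2r _ 2)// ?nnegrE ?sqrtr_ge0// sqr_sqrtr ?mulr_ge0 ?(ltW t0)//.
by rewrite ltr_pdivrMr// mulrC.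
Qed.

(** A fixed [x] moves only once the strip has become wider than [1 - |x|], so the singularity at
    [t = 0] is not felt there. This gives integrability in time at each point. *)
Lemma utB_bound x t : I x -> 0 < t -> `|utB t x| <= 2 * (1 - `|x|)^-1.
Proof.
move=> Ix t0; have x12 := itvI Ix.
have x1 : 0 < 1 - `|x| by have : `|x| < 1 by [rewrite ltr_norml; lra]; lra.
have b0 : 0 <= 2 * (1 - `|x|)^-1 by rewrite mulr_ge0// invr_ge0 ltW.
rewrite /utB /cB; have [tT|_] := leP t TB; last by rewrite /= mulr0 mul0r normr0.
have [far|_] := ltP (rB t) `|x|; last by rewrite /= mulr0 normr0.
rewrite /= !mulr1 ger0_norm ?mulr_ge0 ?isq_ge0// ler_pM2l// /isq.
have st : 1 - `|x| < Num.sqrt (2 * t) by rewrite -(sBE tT); move: far; rewrite /rB; lra.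
by rewrite lef_pV2 ?posrE ?(lt_trans x1 st)// ltW.
Qed.

Lemma utB_int x t : 0 < t -> I x ->
  hat (kB t) (rB t) x = - `|x| + e + \int[leb R]_(s in `]0, t]) utB s x.
Proof.
move=> t0 Ix; have x12 := itvI Ix.
have x1 : 0 < 1 - `|x| by have : `|x| < 1 by [rewrite ltr_norml; lra]; lra.
(* The point [x] rests until the kink passes at [t1], and stops at extinction; in between it moves
   at speed [2 * isq s]. *)
pose t1 := (1 - `|x|) ^+ 2 / 2; pose m := Num.min t TB.
have t10 : 0 < t1 by rewrite /t1 divr_gt0// exprn_gt0.
have m0 : 0 < m by rewrite lt_min t0 TB_gt0.
have st1 : Num.sqrt (2 * t1) = 1 - `|x|.
  by rewrite /t1 mulrCA divff// mulr1 sqrtr_sqr gtr0_norm.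
have E : \int[leb R]_(s in `]0, t]) utB s x =
    \int[leb R]_(s in `]0, t] `&` `]t1, TB]) (2 * isq s).
  rewrite Rintegral_mkcondr; apply: eq_Rintegral => s; rewrite inE/= in_itv/= => /andP[s0 sT].
  rewrite patchE mem_setE in_itv/= /utB /cB.
  have [sTB|_] := leP s TB; last by rewrite andbF /= mulr0 mul0r.
  by rewrite far_iff// -/t1 andbT; case: (t1 < s); rewrite /= !(mulr1, mulr0).
have E2 : `]0, t] `&` `]t1, TB] = `]t1, m]%classic :> set T.
  apply/seteqP; split => s; rewrite /= !in_itv/= le_min.
    by move=> [/andP[_ ->] /andP[-> ->]].
  by move=> /andP[t1s /andP[-> ->]]; rewrite t1s (lt_trans t10 t1s).
rewrite E E2 /hat.
have rm : rB t = 1 - Num.sqrt (2 * m) by [].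
have [mt|tm] := leP m t1.
  rewrite set_itv_ge ?bnd_simp -?leNgt// Rintegral_set0 addr0.
  have h : Num.sqrt (2 * m) <= 1 - `|x| by rewrite -st1 ler_sqrt; [rewrite ler_pM2l|rewrite pmulr_rge0// ltW].
  by rewrite ler0_norm /kB; [ring|rewrite rm; lra].
have -> : \int[leb R]_(s in `]t1, m]) (2 * isq s) = 2 * (Num.sqrt (2 * m) - (1 - `|x|)).
  have iq : (leb R).-integrable `]t1, m] (EFin \o isq).
    apply: (@bounded_integrable _ _ _ _ _ _ (isq t1)) => //.
    - by apply: (@itv_lt_pinfty _ _ t1 m); exact: subset_itv_oc_cc.
    - apply: measurable_isq => // s; rewrite /= in_itv/= => /andP[h _]; exact: lt_trans h.
    - move=> s; rewrite /= in_itv/= => /andP[h _]; rewrite ger0_norm ?isq_ge0// /isq.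
      have s0 := lt_trans t10 h.
      rewrite lef_pV2 ?posrE ?sqrtr_gt0 ?mulr_gt0//.
      by rewrite ler_sqrt; [rewrite ler_pM2l// ltW|rewrite pmulr_rge0// ltW].
  rewrite RintegralZl//; congr (_ * _).
  by rewrite /Rintegral (int_isq t10 (ltW tm)) /= st1.
have h : 1 - `|x| <= Num.sqrt (2 * m).
  by rewrite -st1 ler_sqrt; [rewrite ler_pM2l// ltW|rewrite pmulr_rge0// ltW].
by rewrite ger0_norm /kB ?rm; [ring|lra].
Qed.

Lemma integrable_utB S x : I x -> (leb R).-integrable `]0, S[ (EFin \o utB^~ x).
Proof.
move=> Ix; apply: (bounded_integrable (M := 2 * (1 - `|x|)^-1)) => //.
+ exact: itvoo_lty.
+ apply: measurable_funM.
    apply: measurable_funM.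
      apply: measurable_funM => //; apply: measurable_isq => //.
      by move=> s; rewrite /= in_itv/= => /andP[].
    by apply: measurable_funTS; apply: measurable_le_nat.
  apply: measurable_lt_nat => //; apply: measurable_funTS.
  exact: continuous_measurable_fun rB_continuous.
+ by move=> t; rewrite /= in_itv/= => /andP[t0 _]; exact: utB_bound.
Qed.

Lemma time_deriv_B S : 0 < S -> time_deriv S (fun t => hat (kB t) (rB t)) utB.
Proof.
move=> S0; apply: (primitive_time_deriv (f := fun x => - `|x| + e)) => // x.
- exact: integrable_utB.
- by move=> t; exact: utB_int.
Qed.

Lemma OmB_continuous t : continuous (OmB t).
Proof.
move=> x; apply: cvgM; first exact: cvg_cst.
apply: cvgD; last exact: continuous_min_cst.
apply: cvgD; last exact: cvg_cst.
by apply: cvgB; [exact: cvg_id|exact: continuous_min_cst].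
Qed.

Lemma meas_OmB S : meas_Q S OmB.
Proof.
have mr := measurable_fst_continuous (mQ S) rB_continuous.
have mx := measurable_snd_continuous (mQ S) (fun x : R => @cvg_id R (nbhs x)).
have mrN : measurable_fun (`]0%R, S[%classic `*` (I : set T)) (fun p : T * T => - rB p.1).
  exact: measurableT_comp.
rewrite /meas_Q /OmB; apply: measurable_funM.
  apply: (@measurable_fstJ _ S cB); apply: measurable_funM.
    apply: measurable_funM => //; apply: measurable_isq; first exact: measurable_itv.
    by move=> s; rewrite /= in_itv/= => /andP[].
  by apply: measurable_funTS; apply: measurable_le_nat.
apply: measurable_funD; last exact: (measurable_minr mx mrN).
apply: measurable_funD => //; apply: measurable_funB => //; exact: (measurable_minr mx mr).
Qed.

Lemma solutionB : is_solution (fun x => - `|x| + e) (fun t => hat (kB t) (rB t)) OmB.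
Proof.
apply: (@explicit_solution _ kB rB _ utB).
- exact: kB_continuous.
- exact: rB_continuous.
- exact: rB01.
- move=> x /itvI x12; rewrite /hat /kB /rB /sB min_l ?(ltW TB_gt0)// mulr0 sqrtr0 subr0.
  have : `|x| <= 1 by rewrite ler_norml; lra.
  by move=> h; rewrite ler0_norm; [ring|lra].
- exact: meas_OmB.
- move=> t x t0 /itvI x12; rewrite /OmB normrM (ger0_norm (cB_ge0 t)).
  apply: (@le_trans _ _ (cB t * sB t)).
    by rewrite ler_wpM2l ?cB_ge0// OmB_core_bound.
  by rewrite cB_sB//; case: (t <= TB); rewrite /=; lra.
- exact: L2Q_utB.
- by move=> t _; exact: L2_utB.
- by move=> t _; exact: OmB_continuous.
- by move=> t t0; exists (-2 * (t <= TB)%R%:R) => x; exact: OmB_primitive.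
- move=> t x t0 /itvI x12; have /andP[r0 r1] := rB01 t.
  rewrite hatPE// /OmB normrM (ger0_norm (cB_ge0 t)) mulrCA; congr (_ * _).
  move: (rB t) r0 r1 => r r0 r1.
  have [h1|h1] := leP x r; have [h2|h2] := leP x (- r); have [h3|h3] := leP x 0; rewrite /=;
    try by exfalso; lra.
  + by rewrite ler0_norm; lra.
  + by rewrite [X in `|X|](_ : _ = 0) ?normr0; ring.
  + by rewrite [X in `|X|](_ : _ = 0) ?normr0; ring.
  + by rewrite ger0_norm; lra.
- by move=> S x _; exact: integrable_utB.
- by move=> x t t0 Ix; exact: utB_int.
- move=> t t0.
  have HO (x : R) : I x -> OmB t x = -2 * (t <= TB)%R%:R + \int[leb R]_(y in `]-1, x]) utB t y.
    by move=> /itvI; exact: OmB_primitive.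
  have [q1 q2] := primitive_traces (L2_utB t) HO.
  have /andP[r0 r1] := rB01 t; have [h1 h2] := hat_traces (kB t) r1.
  rewrite int_utB// in q2.
  have E : kB t + 1 - rB t = e - 1 + 2 * sB t by rewrite /kB /rB; ring.
  rewrite E in h1 h2.
  (* The boundary value [e - 1 + 2 * sB t] is negative before extinction and zero from then on. *)
  split; (do 2 eexists; split; [eassumption|eassumption|]);
    (have [tT|tT] := ltP t TB; [constructor 3|constructor 1]).
  + by rewrite (ltW tT); split; [have := sB_lt tT; lra|rewrite /=; ring].
  + by rewrite (sB_end tT); field.
  + by rewrite (ltW tT); split; [have := sB_lt tT; lra|rewrite /=; ring].
  + by rewrite (sB_end tT); field.
Qed.

End caseB.

(** * Uniqueness of the time derivative and of the flux *)

Section transfer.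
Context {R : realType}.
Local Notation T := (measurableTypeR R).
Implicit Types (f g h chi psi : R -> R) (u v w z ut vt Om : R -> R -> R) (a b c t s x y S : R).

Lemma Rintegral0_ae (D : set T) f : measurable D -> (leb R).-integrable D (EFin \o f) ->
  (forall x, D x -> 0 <= f x) -> \int[leb R]_(x in D) f x = 0 ->
  \forall x \ae leb R, D x -> f x = 0.
Proof.
move=> mD intf f0 I0; have mf : measurable_fun D (EFin \o f) by case/integrableP: intf.
have [+ _] := ae_eq_integral_abs (leb R) mD mf.
have E0 : (\int[leb R]_(x in D) (EFin \o f) x = 0)%E.
  rewrite -(fineK (integrable_fin_num mD intf)); congr EFin; exact: I0.
rewrite (_ : (\int[leb R]_(x in D) _)%E = 0%E); last first.
  apply: etrans E0; apply: eq_integral => x; rewrite inE => Dx /=.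
  by rewrite ger0_norm// f0.
by move=> /(_ erefl) H; apply: (ae_mono H) => x /= + Dx => /(_ Dx)[].
Qed.

(** Fubini for [|u - v|]: its double integral vanishes, hence so do almost all integrals in time. *)
Lemma sections_ae_eq S u v : meas_Q S u -> meas_Q S v ->
  (forall t, 0 < t < S -> \forall x \ae leb R, I x -> u t x = v t x) ->
  \forall x \ae leb R, I x -> \forall t \ae leb R, 0 < t < S -> u t x = v t x.
Proof.
move=> mu mv uv.
have mS : measurable (`]0, S[%classic : set T) by exact: measurable_itv.
pose G t x := `|u t x - v t x|.
have mG : measurable_fun (`]0, S[%classic `*` (I : set T)) (fun p : T * T => G p.1 p.2).
  by apply: measurableT_comp => //; exact: measurable_funB.
have mGt t : 0 < t < S -> measurable_fun (I : set T) (G t).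
  by move=> tS; apply: (@measurable_section1 _ _ T T R (`]0, S[%classic : set T) I G).
have z0 t : 0 < t < S -> (\int[leb R]_(x in I) `|(G t x)%:E| = 0)%E.
  move=> tS; apply/ae_eq_integral_abs; [exact: mI|by apply/measurable_EFinP; exact: mGt|].
  by apply: (ae_mono (uv t tS)) => x h Ix /=; rewrite /G h// subrr normr0.
have G_lty : (\int[leb R]_(t in `]0%R, S[) \int[leb R]_(x in I) `|(G t x)%:E| < +oo)%E.
  rewrite integral0_eq// => t; rewrite /= in_itv/=; exact: z0.
have E := Rfubini mS mI mG G_lty.
have zR : \int[leb R]_(t in `]0, S[) \int[leb R]_(x in I) G t x = 0.
  transitivity (\int[leb R]_(t in `]0, S[) (0 : R)); last by rewrite Rintegral_cst// mul0r.
  apply: eq_Rintegral => t; rewrite inE/= in_itv/= => tS; rewrite /Rintegral.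
  rewrite (_ : (\int[leb R]_(x in I) (G t x)%:E = 0)%E)//.
  by apply: etrans (z0 t tS); apply: eq_integral => x _; rewrite gee0_abs// lee_fin normr_ge0.
rewrite zR in E.
have Gx0 x : I x -> 0 <= \int[leb R]_(t in `]0, S[) G t x.
  by move=> _; apply: Rintegral_ge0 => t _; exact: normr_ge0.
have F0 := Rintegral0_ae mI (Rintegrable_fubini2 mS mI mG G_lty) Gx0 (esym E).
apply: (ae_mono (ae_and F0 (Rfubini_ae2 mS mI mG G_lty))) => x [h1 h2] Ix.
have H := Rintegral0_ae mS (h2 Ix) (fun t _ => normr_ge0 _) (h1 Ix).
apply: (ae_mono H) => t ht tS; apply/eqP; rewrite -subr_eq0 -normr_eq0; apply/eqP.
by apply: ht; rewrite /= in_itv.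
Qed.

Lemma time_deriv_transfer S u v vt : meas_Q S u -> meas_Q S v ->
  (forall t, 0 < t < S -> \forall x \ae leb R, I x -> u t x = v t x) ->
  time_deriv S v vt -> time_deriv S u vt.
Proof.
move=> mu mv uv Hv psi tpsi.
have mS : measurable (`]0, S[%classic : set T) by exact: measurable_itv.
have mdpsi : measurable_fun (`]0, S[%classic : set T) (derive1 psi).
  by apply: (continuous_mfun mS); exact: (tf_derive_continuous tpsi).
have msec w x : meas_Q S w -> I x -> measurable_fun (`]0, S[%classic : set T) (w^~ x).
  by move=> mw Ix; apply: (@measurable_section2 _ _ T T R (`]0, S[%classic : set T) I w).
apply: (ae_mono (ae_and (Hv _ tpsi) (sections_ae_eq mu mv uv))) => x [h1 h2] Ix.
rewrite -(h1 Ix) /Rintegral; congr fine; apply: ae_eq_integral => //.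
- by apply/measurable_EFinP; apply: measurable_funM => //; exact: msec.
- by apply/measurable_EFinP; apply: measurable_funM => //; exact: msec.
- by apply: (ae_mono (h2 Ix)) => t ht; rewrite /= in_itv/= => tS; rewrite ht.
Qed.

(** At a Lebesgue point the primitive has derivative [h], and it is constant. The constant is left
    free because it comes from two instances of [time_ip]. *)
Lemma int0_ae0 S h c : (leb R).-integrable `]0, S[ (EFin \o h) ->
  (forall t, 0 < t < S -> \int[leb R]_(s in `]0, t]) h s = c) ->
  \forall t \ae leb R, 0 < t < S -> h t = 0.
Proof.
move=> ih H; apply: (ae_mono (ae_lebesgue_pt ih)) => x Lx /andP[x0 xS].
(* An upper limit beyond [x] but inside the window, so that [x] is interior to the interval of
   integration. *)
have [xu uS] : x < (x + S) / 2 /\ (x + S) / 2 < S by lra.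
set u := (x + S) / 2 in xu uS.
pose g := h \_ `]0, S[.
have gE t : 0 < t < S -> g t = h t by move=> tS; rewrite /g patchE mem_setE in_itv/= tS.
have ig : (leb R).-integrable `]0, u] (EFin \o g).
  have ih' : (leb R).-integrable `]0, u] (EFin \o h).
    by apply: integrableS ih => // t; rewrite /= !in_itv/=; lra.
  apply: eq_integrable ih' => [|t]; first exact: measurable_itv.
  by rewrite inE/= in_itv/= => tu; rewrite gE//; lra.
have [_] := FTC1_lebesgue_pt xu ig (a := BRight 0) x0 Lx.
rewrite gE ?x0// => <-.
rewrite derive1E (@near_eq_derive _ _ _ _ (fun=> c)) ?derive_cst//.
near=> t; have tS : 0 < t < S.
  by apply/andP; split; near: t; [exact: lt_nbhsr|exact: lt_nbhsl].
rewrite -(H t tS); apply: eq_Rintegral => s; rewrite inE/= in_itv/= => st.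
by rewrite gE//; lra.
Unshelve. all: by end_near. Qed.

(** A rational [q] slightly below [x] changes the indicator by a function of squared norm [x - q];
    Young makes the error as small as desired. Countably many tests therefore suffice. *)
Lemma rational_primitive_eq0 (z : R -> R) : L2_I z ->
  (forall q : rat, ip z (fun y => (y <= ratr q)%R%:R) = 0) ->
  forall x, I x -> \int[leb R]_(y in `]-1, x]) z y = 0.
Proof.
move=> Lz Hq x /itvI /andP[x1 x2].
rewrite -(Rintegral_le_ind (leb R) (-1) z x2).
have Li a : L2_I (fun y => (y <= a)%R%:R).
  apply: (@bounded_L2 _ _ 1); first by apply: measurable_le_ind; exact: mI.
  by move=> y _; case: (y <= a); rewrite ?normr1 ?normr0.
apply/eqP; rewrite -normr_eq0 eq_le normr_ge0 andbT; apply/ler_addgt0Pr => e e0; rewrite add0r.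
have [k [d [k0 d0 H]]] := small_split (ip_ge0 z) e0.
have mx : Num.max (-1) (x - d) < x by rewrite gt_max x1 ltrBlDr ltrDl.
have [q] := rat_in_itvoo mx; rewrite in_itv/= gt_max => /andP[/andP[q1 qd] qx].
have q2 := lt_trans qx x2.
pose h y : R := (y <= x)%R%:R - (y <= ratr q)%R%:R.
have Lh : L2_I h by apply: L2_B.
have -> : \int[leb R]_(y in `]-1, 1[) (z y * (y <= x)%R%:R) = ip z h.
  by rewrite /h ipBr// Hq subr0.
apply: (le_trans (ip_abs k0 Lz Lh)); apply: ltW.
suff -> : ip h h = x - ratr q by apply: H; lra.
have i1 a : (leb R).-integrable I (EFin \o (fun y => 1 * (y <= a)%R%:R : R)).
  by apply: integrable_le_ind; [exact: mI|exact: integrable_I_cst].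
transitivity (\int[leb R]_(y in I) (1 * (y <= x)%R%:R - 1 * (y <= ratr q)%R%:R)).
  apply: eq_Rintegral => y _; rewrite /h.
  have [yx|xy] := leP y x; have [yq|qy] := leP y (ratr q); rewrite /=; try ring.
  by exfalso; lra.
rewrite (RintegralB mI (i1 x) (i1 (ratr q))).
rewrite (Rintegral_le_ind (leb R) (-1) (fun=> 1) x2) (Rintegral_le_ind (leb R) (-1) (fun=> 1) q2).
by rewrite (Rintegral_itv_cst _ (ltW x1)) (Rintegral_itv_cst _ (ltW q1)); ring.
Qed.

(** For each [chi] the time identities determine [ip (ut t) chi] off a null set of times.
    Restricting [chi] to rational half-line indicators leaves one null set, off which the primitives
    of [ut t] and [vt t] agree. *)
Lemma flux_unique (u0 : R -> R) u Om v vt S : 0 < S -> is_solution u0 u Om ->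
  meas_Q S v -> C_L2 S v -> L2_Q S vt -> time_deriv S v vt ->
  (forall t, 0 < t < S -> \forall x \ae leb R, I x -> u t x = v t x) ->
  \forall t \ae leb R, 0 < t < S ->
    exists g0 : R, forall x, I x -> Om t x = g0 + \int[leb R]_(y in `]-1, x]) vt t y.
Proof.
move=> S0 Hsol mv Cv Lvt Tvt uv.
have [_ HC _ _] := Hsol; have Cu := HC _ S0; have [L2u _] := Cu; have [L2v _] := Cv.
have [ut [Lut Tut Hsl]] := is_solution_slice Hsol S0.
have mu := is_solution_meas Hsol S0.
(* An enumeration of the rationals; codes that decode to nothing are sent to 0. *)
pose chi (n : nat) y : R := (y <= ratr (odflt 0 (unpickle n) : rat))%R%:R.
have Lchi n : L2_I (chi n).
  apply: (@bounded_L2 _ _ 1); first by apply: measurable_le_ind; exact: mI.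
  by move=> y _; rewrite /chi normr_nat lern1 leq_b1.
have Hn n : \forall t \ae leb R, 0 < t < S -> ip (ut t) (chi n) - ip (vt t) (chi n) = 0.
  have [c1 E1] := time_ip S0 mu Cu Lut Tut (Lchi n).
  have [c2 E2] := time_ip S0 mv Cv Lvt Tvt (Lchi n).
  have j1 := L2Q_ip_integrable Lut (Lchi n); have j2 := L2Q_ip_integrable Lvt (Lchi n).
  apply: (int0_ae0 (c := c2 - c1)).
    by apply: integrableRB => //; exact: measurable_itv.
  move=> t tS; have sub (g : R -> R) : (leb R).-integrable `]0, S[ (EFin \o g) ->
      (leb R).-integrable `]0, t] (EFin \o g).
    by apply: integrableS => // x; rewrite /= !in_itv/=; lra.
  rewrite (RintegralB _ (sub _ j1) (sub _ j2))//.
  have tS' : 0 <= t <= S by lra.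
  have E : ip (u t) (chi n) = ip (v t) (chi n).
    apply: Rintegral_ae_eq; [exact: mI|apply: L2_mul; [exact: L2u|exact: Lchi]|
      apply: L2_mul; [exact: L2v|exact: Lchi]|].
    by apply: (ae_mono (uv t tS)) => x h Ix; rewrite h.
  by have := E1 t tS; have := E2 t tS; rewrite E => -> h; lra.
have all_n := ae_foralln Hn.
apply: (ae_mono (ae_and (ae_and all_n (L2Q_ae Lvt)) Hsl)) => t [[h1 h2] h3] tS.
have Lv := h2 tS; have [_ Lu [g0 Hg] _ _] := h3 tS.
exists g0 => x Ix; rewrite Hg//; congr (_ + _); apply/eqP; rewrite -subr_eq0; apply/eqP.
have sub (g : R -> R) : L2_I g -> (leb R).-integrable `]-1, x] (EFin \o g).
  move=> /L2_int; apply: integrableS => //.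
  by move=> y; rewrite /Iint /= !in_itv/=; have := itvI Ix; lra.
rewrite -(RintegralB _ (sub _ Lu) (sub _ Lv))//.
apply: rational_primitive_eq0 => //; first exact: L2_B.
move=> q; have := h1 (pickle q) tS; rewrite /chi pickleK /=.
have Li : L2_I (fun y => (y <= ratr q)%R%:R : R).
  by have := Lchi (pickle q); rewrite /chi pickleK.
by rewrite ipBl.
Qed.

End transfer.

(** * From the explicit solutions to arbitrary ones *)

Section conclusions.
Context {R : realType}.
Local Notation T := (measurableTypeR R).
Implicit Types (u v ut vt Om : R -> R -> R) (t x s S : R).

(** By uniqueness the explicit rate [vt] is also a time derivative of [u], so it serves as witness.
    It is nonzero at every time before [Te], and any set of full measure meets each window ending at
    [Te]. *)
Lemma extinction_transfer (u0 : R -> R) u Om v Omv vt (Te : R) : 0 < Te ->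
  is_solution u0 u Om -> is_solution u0 v Omv ->
  (forall S, 0 < S -> L2_Q S vt) -> (forall S, 0 < S -> time_deriv S v vt) ->
  (forall t x, Te < t -> vt t x = 0) ->
  (forall t, 0 < t < Te -> ~ \forall x \ae leb R, I x -> vt t x = 0) ->
  extinction_time u Te.
Proof.
move=> Te0 Hu Hv Lvt Tvt vt0 vtn; split => //; exists vt; split.
- move=> S S0; split; first exact: Lvt.
  apply: (@time_deriv_transfer _ S u v).
  + exact: is_solution_meas Hu S0.
  + exact: is_solution_meas Hv S0.
  + by move=> t /andP[t0 _]; apply: (solution_unique Hu Hv); exact: ltW.
  + exact: Tvt.
- exists set0; split => // t; rewrite /setC/= => nH; case: nH => tT.
  by exists set0; split => // x; rewrite /setC/= => nH; case: nH => _; exact: vt0.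
- move=> eps e0 H.
  (* The window is cut at 0 since [eps] may exceed [Te]. *)
  have mT : Num.max 0 (Te - eps) < Te by rewrite gt_max Te0 ltrBlDr ltrDl.
  have [t /andP[]] := ae_ex mT H; rewrite gt_max => /andP[t0 te] tT /(_ t0).
  by rewrite te tT => /(_ erefl); apply: vtn; rewrite t0.
Qed.

Lemma utA_nonzero (d t : R) : t < (d - 1) / 2 ->
  ~ \forall x \ae leb R, I x -> utA d t x = 0.
Proof.
move=> tT H; have [x /andP[x0 x1]] := ae_ex (ltr01 : (0 : R) < 1) H.
have Ix : I x by rewrite /Iint/= in_itv/=; lra.
by move=> /(_ Ix); rewrite /utA (ltW tT) /=; lra.
Qed.

(** At positive times the strip between the kink and the boundary has positive width, and
    [cB * sB = 2] excludes a zero rate on it. *)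
Lemma utB_nonzero (e t : R) : -1 <= e -> e < 1 -> 0 < t -> t < TB e ->
  ~ \forall x \ae leb R, I x -> utB e t x = 0.
Proof.
move=> e1 e2 t0 tT H; have /andP[r0 r1] := rB01 e1 e2 t.
have cs := cB_sB e t0; rewrite (ltW tT) mulr1 in cs.
have c0 : cB e t != 0 by apply/eqP => c0; move: cs; rewrite c0 mul0r => /eqP; rewrite eq_sym pnatr_eq0.
have s0 : sB e t != 0 by apply/eqP => s0; move: cs; rewrite s0 mulr0 => /eqP; rewrite eq_sym pnatr_eq0.
have sp : 0 < sB e t by rewrite lt_neqAle eq_sym s0 sB_ge0.
have r1' : rB e t < 1 by rewrite /rB; lra.
have [x /andP[x0 x1]] := ae_ex r1' H.
have Ix : I x by rewrite /Iint/= in_itv/=; lra.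
move=> /(_ Ix)/eqP; rewrite /utB gtr0_norm ?(le_lt_trans r0 x0)// x0 mulr1.
by rewrite (negbTE c0).
Qed.

Lemma solution_time_deriv_A (d : R) : 1 < d -> forall S, 0 < S ->
  L2_Q S (utA d) /\ time_deriv S (fun t => hat (kA d t) 1) (utA d).
Proof. by move=> d1 S S0; split; [exact: L2Q_utA|exact: time_deriv_A]. Qed.

Lemma partA (d : R) : 1 < d ->
  let u0 := fun x : R => - `|x| + d in
  let Text := (d - 1) / 2 in
  (exists u Om : R -> R -> R, is_solution u0 u Om) /\
  forall u Om : R -> R -> R, is_solution u0 u Om ->
    [/\ forall t : R, 0 <= t ->
          \forall x \ae leb R, I x ->
            u t x = - `|x| + d - 2 * Num.min t ((d - 1) / 2),
        \forall t \ae leb R, 0 < t < Text ->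
          forall x : R, I x -> Om t x = - 2 * x,
        extinction_time u Text &
        \forall x \ae leb R, I x -> u Text x = 1 - `|x|].
Proof.
move=> d1 u0 Text; have HA := solutionA d1; split; first by do 2 eexists; exact: HA.
move=> u Om Hu.
have T0 : 0 < Text by rewrite /Text; lra.
have form t : 0 <= t -> \forall x \ae leb R, I x ->
    u t x = - `|x| + d - 2 * Num.min t ((d - 1) / 2).
  move=> t0; apply: (ae_mono (solution_unique Hu HA t0)) => x H Ix; rewrite H//.
  have := itvI Ix => x12; rewrite /hat /kA ler0_norm; first by ring.
  by have : `|x| <= 1 by [rewrite ler_norml; lra]; lra.
have [_ Cv _ _] := HA.
have mv S : 0 < S -> meas_Q S (fun t => hat (kA d t) 1) := is_solution_meas HA (S := S).
have tder := solution_time_deriv_A d1.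
split => //.
- have [Lt Tt] := tder _ T0.
  have uv t : 0 < t < Text -> \forall x \ae leb R, I x -> u t x = hat (kA d t) 1 x.
    by move=> /andP[t0 _]; apply: (solution_unique Hu HA); exact: ltW.
  have Hfl := flux_unique T0 Hu (mv _ T0) (Cv _ T0) Lt Tt uv.
  have [_ _ _ Hdir] := Hu.
  apply: (ae_mono (ae_and Hfl Hdir)) => t [h1 h2] tT x Ix.
  have /andP[t0 tT'] := tT; have [g0 Hg] := h1 tT.
  have [[a [b [ta tb Dab]]] _] := h2 t0.
  have L1 : -1 = -1 :> R \/ -1 = 1 :> R by left.
  have [pt _] := primitive_traces (L2_utA d t) Hg.
  have [ht _] := hat_traces (kA d t) (lexx 1).
  have Eb := has_trace_uniq L1 pt tb.
  have Ea := has_trace_uniq L1 (has_trace_ae (uv t tT) ta) ht.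
  (* Before extinction the trace at -1 is positive, which leaves only the alternative where the flux
     is 2. *)
  have kp : 0 < a.
    by rewrite Ea /kA min_l; [move: tT'; rewrite /Text; lra|exact: ltW].
  have b2 : b = 2 by case: Dab => [a0|[_]|[a0]]; [lra| |lra].
  have /andP[x1 x2] := itvI Ix.
  rewrite Hg// Eb b2 /utA (ltW tT') (Rintegral_itv_cst _ (ltW x1)) /=; ring.
- apply: (extinction_transfer (vt := utA d) T0 Hu HA).
  + by move=> S /tder[].
  + by move=> S /tder[].
  + by move=> t x tT; rewrite /utA leNgt tT /= mulr0.
  + by move=> t /andP[_ tT]; exact: utA_nonzero.
- apply: (ae_mono (form _ (ltW T0))) => x H Ix.
  by rewrite H// /Text min_l//; field.
Qed.

Lemma solution_time_deriv_B (e : R) : -1 <= e -> e < 1 -> forall S, 0 < S ->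
  L2_Q S (utB e) /\ time_deriv S (fun t => hat (kB e t) (rB e t)) (utB e).
Proof. by move=> e1 e2 S S0; split; [exact: L2Q_utB|exact: time_deriv_B]. Qed.

Lemma partB (e : R) : -1 <= e -> e < 1 ->
  let u0 := fun x : R => - `|x| + e in
  let Text := (1 - e) ^+ 2 / 8 in
  (exists u Om : R -> R -> R, is_solution u0 u Om) /\
  forall u Om : R -> R -> R, is_solution u0 u Om ->
    [/\ forall t : R, 0 <= t ->
          \forall x \ae leb R, I x ->
            u t x = Num.max (u0 x)
              (`|x| - 2 + e + 2 * Num.min (Num.sqrt (2 * t)) ((1 - e) / 2)),
        extinction_time u Text &
        \forall x \ae leb R, I x ->
          [/\ -1 <= x <= - ((1 + e) / 2) -> u Text x = - x - 1,
              - ((1 + e) / 2) <= x <= (1 + e) / 2 -> u Text x = - `|x| + e &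
              (1 + e) / 2 <= x <= 1 -> u Text x = x - 1]].
Proof.
move=> e1 e2 u0 Text; have HB := solutionB e1 e2; split; first by do 2 eexists; exact: HB.
move=> u Om Hu.
have T0 : 0 < Text by exact: TB_gt0.
(* The minimum with [(1 - e) / 2 = sqrt(2 TB)] may be taken inside the square root, where it stops
   time at [TB]. *)
have sE t : 0 <= t -> Num.min (Num.sqrt (2 * t)) ((1 - e) / 2) = sB e t.
  move=> t0; have [tT|tT] := leP t (TB e).
    by rewrite (sBE tT) min_l// -(sBE tT) sB_le.
  rewrite (sB_end e2 (ltW tT)) min_r// -(sqrt_TB e2) ler_sqrt; last by rewrite pmulr_rge0.
  by rewrite ler_pM2l// ltW.
have form t : 0 <= t -> \forall x \ae leb R, I x -> u t x = hat (kB e t) (rB e t) x.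
  by move=> t0; exact: (solution_unique Hu HB).
have tder := solution_time_deriv_B e1 e2.
split.
- move=> t t0; apply: (ae_mono (form t t0)) => x H Ix.
  rewrite H// sE// /hat /kB /u0; have -> : rB e t = 1 - sB e t by [].
  move: (sB e t) (`|x|) => s y.
  have [h|h] := leP (1 - s) y.
    by rewrite ger0_norm ?subr_ge0// max_r; lra.
  by rewrite ler0_norm ?subr_le0 ?(ltW h)// max_l; lra.
- apply: (extinction_transfer (vt := utB e) T0 Hu HB).
  + by move=> S /tder[].
  + by move=> S /tder[].
  + by move=> t x tT; rewrite /utB /cB leNgt tT /= mulr0 mul0r.
  + by move=> t /andP[t0 tT]; exact: utB_nonzero.
- apply: (ae_mono (form _ (ltW T0))) => x H /[dup] Ix /itvI /andP[x1 x2].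
  (* At extinction the kinks sit at [(1 + e) / 2] in absolute value; the three cases resolve the
     outer absolute value. *)
  have -> : u Text x = e - (1 + e) / 2 + `| `|x| - (1 + e) / 2|.
    have E : 1 - (1 - e) / 2 = (1 + e) / 2 by field.
    by rewrite H// /hat /kB /rB (sB_end e2 (lexx _)) E.
  split=> /andP[h1 h2].
  + by rewrite (ler0_norm (x := x)) ?ger0_norm; lra.
  + have : `|x| <= (1 + e) / 2 by rewrite ler_norml h1.
    by move=> h; rewrite ler0_norm; lra.
  + by rewrite (ger0_norm (x := x)) ?ger0_norm; lra.
Qed.

End conclusions.

Theorem proposition4p4 (R : realType) :
  (forall d : R, 1 < d ->
     let u0 := fun x : R => - `|x| + d in
     let Text := (d - 1) / 2 in
     (exists u Om : R -> R -> R, is_solution u0 u Om) /\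
     forall u Om : R -> R -> R, is_solution u0 u Om ->
       [/\ forall t : R, 0 <= t ->
             \forall x \ae leb R, I x ->
               u t x = - `|x| + d - 2 * Num.min t ((d - 1) / 2),
           \forall t \ae leb R, 0 < t < Text ->
             forall x : R, I x -> Om t x = - 2 * x,
           extinction_time u Text &
           \forall x \ae leb R, I x -> u Text x = 1 - `|x|])
  /\
  (forall e : R, -1 <= e -> e < 1 ->
     let u0 := fun x : R => - `|x| + e in
     let Text := (1 - e) ^+ 2 / 8 in
     (exists u Om : R -> R -> R, is_solution u0 u Om) /\
     forall u Om : R -> R -> R, is_solution u0 u Om ->
       [/\ forall t : R, 0 <= t ->
             \forall x \ae leb R, I x ->
               u t x = Num.max (u0 x)
                 (`|x| - 2 + e + 2 * Num.min (Num.sqrt (2 * t)) ((1 - e) / 2)),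
           extinction_time u Text &
           \forall x \ae leb R, I x ->
             [/\ -1 <= x <= - ((1 + e) / 2) -> u Text x = - x - 1,
                 - ((1 + e) / 2) <= x <= (1 + e) / 2 -> u Text x = - `|x| + e &
                 (1 + e) / 2 <= x <= 1 -> u Text x = x - 1]]).
Proof. by split=> [d|e]; [exact: partA|exact: partB]. Qed.
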